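(* Let $V$ be an $\mathbb{R}$-reflexive Banach module and let $T\in\mathcal{K}(V)$ be injective and bisectorial of angle $\omega\in(0,\frac{\pi}{2})$. Let $\theta\in(\omega,\frac{\pi}{2})$, $f\in\mathcal{SH}_R^0(D_\theta)$, and $e(s)=\frac{s^m}{(1+s^2)^m}$ with arbitrary $m\in\mathbb{N}$. Then the operator $(fe)(T)e(T)^{-1}$ is closable, and the right $\omega$-functional calculus $f(T)=\frac{1}{2\pi}\int_{\partial D_\varphi\cap\mathbb{C}_J}f(s)\,ds_J\,S_R^{-1}(s,T)$ (with arbitrary $\varphi\in(\omega,\theta)$, $J\in\mathbb{S}$) can be written as $$f(T)=\overline{(fe)(T)e(T)^{-1}}.$$
   Context: Clifford algebra. Fix $n\ge 1$; $\mathbb{N}=\{1,2,\dots\}$. $\mathbb{R}_n$ is the real Clifford algebra with units $e_1,\dots,e_n$, $e_i^2=-1$, $e_ie_j=-e_je_i$ for $i\ne j$, with basis $e_A=e_{i_1}\cdots e_{i_r}$, $A=(i_1<\dots<i_r)\in\mathcal{A}$, and $|s|^2=\sum_A s_A^2$. Paravectors: $\mathbb{R}^{n+1}=\{s_0+s_1e_1+\dots+s_ne_n\}\subseteq\mathbb{R}_n$, with $\overline{s}=s_0-s_1e_1-\dots-s_ne_n$. $\mathbb{S}=\{J\in\mathbb{R}^{n+1}: J_0=0,|J|=1\}$ and $\mathbb{C}_J=\{x+Jy:x,y\in\mathbb{R}\}$ for $J\in\mathbb{S}$. Modules and operators. For a real Banach space $V_\mathbb{R}$, the Banach module is $V=\{\sum_A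 v_A\otimes e_A: v_A\in V_\mathbb{R}\}$ with $\|v\|^2=\sum_A\|v_A\|_\mathbb{R}^2$ and the left and right multiplications by $\mathbb{R}_n$ induced by the product of $\mathbb{R}_n$. $V$ is $\mathbb{R}$-reflexive if it is reflexive with respect to its $\mathbb{R}$-linear dual (equivalently $V_\mathbb{R}$ is reflexive). $\mathcal{B}(V)$ is the set of bounded everywhere defined right linear operators; $\mathcal{K}(V)$ is the set of closed right linear operators $T:\operatorname{dom}(T)\subseteq V\to V$. A Clifford number $a$ is also regarded as the operator $v\mapsto av$; products of operators and Clifford numbers are compositions. An operator is closable if it has a closed operator extension; its closure is the smallest such extension. Bisectorial operators. $Q_s[T]=T^2-2s_0T+|s|^2$ with domain $\operatorname{dom}(T^2)$; $\rho_S(T)=\{s\in\mathbb{R}^{n+1}:Q_s[T]^{-1}\in\mathcal{B}(V)\}$, $\sigma_S(T)=\mathbb{R}^{n+1}\setminus\rho_S(T)$; $S_L^{-1}(s,T)=Q_s[T]^{-1}\overline{s}-TQ_s[T]^{-1}$ and $S_R^{-1}(s,T)=(\overline{s}-T)Q_s[T]^{-1}$ for $s\in\rho_S(T)$. For $\omega\in(0,\frac{\pi}{2})$, $I_\omega=(-\omega,\omega)\cup(\pi-\omega,\pi+\omega)$ and $D_\omega=\{re^{J\phi}:r>0,J\in\mathbb{S},\phi\in I_\omega\}$. $T\in\mathcal{K}(V)$ is bisectorial of angle $\omega$ if $\sigma_S(T)\subseteq\overline{D_\omega}$ and for every $\varphi\in(\omega,\frac{\pi}{2})$ there is $C_\varphi\ge0$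 with $\|S_L^{-1}(s,T)\|\le C_\varphi/|s|$ for all $s\in\mathbb{R}^{n+1}\setminus(D_\varphi\cup\{0\})$. Functions. For open axially symmetric $U\subseteq\mathbb{R}^{n+1}$ and $\mathcal{U}=\{(x,y)\in\mathbb{R}^2: x+\mathbb{S}y\subseteq U\}$, $f:U\to\mathbb{R}_n$ is right slice hyperholomorphic, $f\in\mathcal{SH}_R(U)$, if there are $C^1$ functions $f_0,f_1:\mathcal{U}\to\mathbb{R}_n$ with $f(x+Jy)=f_0(x,y)+f_1(x,y)J$ for all $J\in\mathbb{S}$, $f_0(x,-y)=f_0(x,y)$, $f_1(x,-y)=-f_1(x,y)$, $\partial_xf_0=\partial_yf_1$, $\partial_yf_0=-\partial_xf_1$. For $\theta\in(0,\frac\pi2)$, $\mathcal{SH}_R^0(D_\theta)$ consists of the bounded $f\in\mathcal{SH}_R(D_\theta)$ with $\int_0^\infty|f(re^{J\phi})|\frac{dr}{r}<\infty$ for all $J\in\mathbb{S},\phi\in I_\theta$. Right $\omega$-functional calculus. In the integral in the claim, $ds_J=ds/J$, the boundary is positively oriented ($D_\varphi\cap\mathbb{C}_J$ lies to the left), and the value is independent of $\varphi\in(\omega,\theta)$ and $J\in\mathbb{S}$; it is an operator in $\mathcal{B}(V)$. The operators $(fe)(T)$ and $e(T)$ are given by the same integral formula; $e(T)$ is injective and $(fe)(T)e(T)^{-1}$ has domain $\operatorname{ran}(e(T))$. *)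

(* Defs.v *)
(* Stdlib reals and Coquelicot, with MathComp finite sets and big operators
   for the Clifford multi-indices. *)
From HB Require Import structures.
From mathcomp Require Import all_boot.
From Stdlib Require Import Reals Lra FunctionalExtensionality ProofIrrelevance.
From Coquelicot Require Import Coquelicot.

Set Implicit Arguments.
Unset Strict Implicit.
Unset Printing Implicit Defensive.

Open Scope R_scope.

HB.instance Definition _ (G : AbelianMonoid) :=
  Monoid.isComLaw.Build G zero (@plus G)
    (@plus_assoc G) (@plus_comm G) (@plus_zero_l G).

Section NormToUniform.
Context (E : ModuleSpace R_Ring) (N : E -> R).
Context (N_triangle : forall x y, N (plus x y) <= N x + N y).
Context (N_scal : forall (l : R) x, N (scal l x) <= Rabs l * N x).

Definition norm_ball (x : E) (eps : R) (y : E) : Prop := N (minus y x) < eps.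

Lemma norm_ball_center x (eps : posreal) : norm_ball x eps x.
Proof.
rewrite /norm_ball minus_eq_zero -(@scal_zero_l _ _ (zero : E)).
apply: Rle_lt_trans (N_scal _ _) _.
by rewrite /zero /= Rabs_R0 Rmult_0_l; apply: cond_pos.
Qed.

Lemma norm_ball_sym x y eps : norm_ball x eps y -> norm_ball y eps x.
Proof.
rewrite /norm_ball => h; apply: Rle_lt_trans h.
rewrite -opp_minus -scal_opp_one; apply: Rle_trans (N_scal _ _) _.
rewrite (_ : Rabs _ = 1) ?Rmult_1_l; first exact: Rle_refl.
by rewrite /opp /one /= Rabs_Ropp Rabs_R1.
Qed.

Lemma norm_ball_triangle x y z e1 e2 :
  norm_ball x e1 y -> norm_ball y e2 z -> norm_ball x (e1 + e2) z.
Proof.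
rewrite /norm_ball => h1 h2.
have -> : minus z x = plus (minus z y) (minus y x) :> E.
  by rewrite /minus -plus_assoc [plus (opp y) _]plus_assoc plus_opp_l plus_zero_l.
apply: Rle_lt_trans (N_triangle _ _) _; lra.
Qed.

Definition norm_uniform_mixin : UniformSpace.mixin_of E :=
  UniformSpace.Mixin E zero norm_ball norm_ball_center norm_ball_sym norm_ball_triangle.
End NormToUniform.

(* The module V = V_R (x) R_n: an element is the family of its components
   v_A over the subsets A of {0, ..., n-1}.  The case V_R = R is R_n itself. *)
Definition clmod (n : nat) (V : Type) : Type := {ffun {set 'I_n} -> V}.

Section CliffordModuleNorm.
Context (n : nat) (V : NormedModule R_AbsRing).
Implicit Types u v w : clmod n V.

Definition cm_plus u v : clmod n V := [ffun A => plus (u A) (v A)].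
Definition cm_zero : clmod n V := [ffun _ => zero].
Definition cm_opp u : clmod n V := [ffun A => opp (u A)].
Definition cm_scal (l : R) u : clmod n V := [ffun A => scal l (u A)].
Definition cm_norm u : R := sqrt (\big[Rplus/0]_(A : {set 'I_n}) (norm (u A)) ^ 2).

Lemma cm_plusC u v : cm_plus u v = cm_plus v u.
Proof. by apply/ffunP => A; rewrite !ffunE plus_comm. Qed.
Lemma cm_plusA u v w : cm_plus u (cm_plus v w) = cm_plus (cm_plus u v) w.
Proof. by apply/ffunP => A; rewrite !ffunE plus_assoc. Qed.
Lemma cm_plus0 u : cm_plus u cm_zero = u.
Proof. by apply/ffunP => A; rewrite !ffunE plus_zero_r. Qed.
Lemma cm_plusN u : cm_plus u (cm_opp u) = cm_zero.
Proof. by apply/ffunP => A; rewrite !ffunE plus_opp_r. Qed.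

Definition cm_AbelianMonoid_mixin : AbelianMonoid.mixin_of (clmod n V) :=
  AbelianMonoid.Mixin _ _ _ cm_plusC cm_plusA cm_plus0.
Canonical cm_AbelianMonoid : AbelianMonoid :=
  AbelianMonoid.Pack (clmod n V) cm_AbelianMonoid_mixin (clmod n V).
Definition cm_AbelianGroup_mixin : AbelianGroup.mixin_of cm_AbelianMonoid :=
  AbelianGroup.Mixin cm_AbelianMonoid cm_opp cm_plusN.
Canonical cm_AbelianGroup : AbelianGroup :=
  AbelianGroup.Pack (clmod n V)
    (AbelianGroup.Class _ _ cm_AbelianGroup_mixin) (clmod n V).

Lemma cm_scalA (x y : R_Ring) u : cm_scal x (cm_scal y u) = cm_scal (mult x y) u.
Proof. by apply/ffunP => A; rewrite !ffunE scal_assoc. Qed.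
Lemma cm_scal1 u : cm_scal (one : R_Ring) u = u.
Proof. by apply/ffunP => A; rewrite !ffunE scal_one. Qed.
Lemma cm_scalDr (x : R_Ring) u v :
  cm_scal x (cm_plus u v) = cm_plus (cm_scal x u) (cm_scal x v).
Proof. by apply/ffunP => A; rewrite !ffunE scal_distr_l. Qed.
Lemma cm_scalDl (x y : R_Ring) u :
  cm_scal (plus x y) u = cm_plus (cm_scal x u) (cm_scal y u).
Proof. by apply/ffunP => A; rewrite !ffunE scal_distr_r. Qed.

Definition cm_ModuleSpace_mixin : ModuleSpace.mixin_of R_Ring cm_AbelianGroup :=
  ModuleSpace.Mixin R_Ring cm_AbelianGroup cm_scal
    cm_scalA cm_scal1 cm_scalDr cm_scalDl.
Canonical cm_ModuleSpace : ModuleSpace R_Ring :=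
  ModuleSpace.Pack R_Ring (clmod n V)
    (ModuleSpace.Class _ _ _ cm_ModuleSpace_mixin) (clmod n V).

Lemma sqrt_minkowski2 a b c d : 0 <= a -> 0 <= b ->
  sqrt ((c + d) ^ 2 + (a + b) ^ 2) <= sqrt (c ^ 2 + a ^ 2) + sqrt (d ^ 2 + b ^ 2).
Proof.
move=> ha hb.
set s := sqrt (c ^ 2 + a ^ 2); set t := sqrt (d ^ 2 + b ^ 2).
have hs : s * s = c ^ 2 + a ^ 2 by apply: sqrt_sqrt; nra.
have ht : t * t = d ^ 2 + b ^ 2 by apply: sqrt_sqrt; nra.
have s0 : 0 <= s := sqrt_pos _.
have t0 : 0 <= t := sqrt_pos _.
have cs : a * b + c * d <= s * t.
  apply: Rsqr_incr_0_var; last by nra.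
  have -> : Rsqr (s * t) = (s * s) * (t * t) by rewrite /Rsqr; ring.
  rewrite hs ht /Rsqr; have := Rle_0_sqr (a * d - b * c); rewrite /Rsqr; nra.
rewrite -(sqrt_Rsqr (s + t)); last lra.
apply: sqrt_le_1_alt; rewrite /Rsqr; nra.
Qed.

Lemma sqrt_sum_sq_triangle (I : Type) (r : seq I) (g h k : I -> R) :
  (forall i, 0 <= k i <= g i + h i) ->
  sqrt (\big[Rplus/0]_(i <- r) k i ^ 2) <=
  sqrt (\big[Rplus/0]_(i <- r) g i ^ 2) + sqrt (\big[Rplus/0]_(i <- r) h i ^ 2).
Proof.
move=> hk.
have pos (f : I -> R) s : 0 <= \big[Rplus/0]_(i <- s) f i ^ 2.
  by apply: big_ind => [|x y hx hy|i _]; [lra | lra | apply: pow2_ge_0].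
elim: r => [|i r IH]; first by rewrite !big_nil sqrt_0; lra.
rewrite !big_cons.
have sq (f : I -> R) : \big[Rplus/0]_(j <- r) f j ^ 2 =
    sqrt (\big[Rplus/0]_(j <- r) f j ^ 2) ^ 2 by rewrite pow2_sqrt.
rewrite (sq k) (sq g) (sq h).
set K := sqrt (\big[Rplus/0]_(j <- r) k j ^ 2) in IH *.
set G := sqrt (\big[Rplus/0]_(j <- r) g j ^ 2) in IH *.
set H := sqrt (\big[Rplus/0]_(j <- r) h j ^ 2) in IH *.
have K0 : 0 <= K := sqrt_pos _.
have G0 : 0 <= G := sqrt_pos _.
have H0 : 0 <= H := sqrt_pos _.
apply: Rle_trans (sqrt_minkowski2 (g i) (h i) G0 H0).
apply: sqrt_le_1_alt; have := hk i; nra.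
Qed.

Lemma cm_norm_triangle u v : cm_norm (plus u v) <= cm_norm u + cm_norm v.
Proof.
apply: sqrt_sum_sq_triangle => A; split; first exact: norm_ge_0.
by rewrite ffunE; apply: norm_triangle.
Qed.

Lemma cm_norm_scal (l : R) u : cm_norm (scal l u) <= Rabs l * cm_norm u.
Proof.
rewrite -{1}(sqrt_Rsqr_abs l) /cm_norm.
rewrite -sqrt_mult_alt; last exact: Rle_0_sqr.
apply: sqrt_le_1_alt.
elim/big_rec2: _ => [|A x y _ hxy]; first lra.
have h : norm (scal l (u A)) <= Rabs l * norm (u A) := norm_scal l (u A).
have h0 := norm_ge_0 (scal l (u A)).
have h2 : Rabs l * Rabs l = l * l by rewrite -Rabs_mult Rabs_pos_eq //; nra.
rewrite ffunE /Rsqr in hxy *.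
have : norm (scal l (u A)) ^ 2 <= (Rabs l * norm (u A)) ^ 2.
  by apply: pow_incr.
rewrite Rpow_mult_distr; nra.
Qed.

Lemma cm_norm_eq0 u : cm_norm u = 0 -> u = zero.
Proof.
have pos (P : pred {set 'I_n}) : 0 <= \big[Rplus/0]_(A | P A) norm (u A) ^ 2.
  by apply: big_ind => [|x y hx hy|i _]; [lra | lra | apply: pow2_ge_0].
move=> /(sqrt_eq_0 _ (pos _)) h; apply/ffunP => A; rewrite ffunE.
have key : forall r : seq {set 'I_n}, \big[Rplus/0]_(A <- r) norm (u A) ^ 2 = 0 ->
    A \in r -> norm (u A) = 0.
  elim=> [//|B r IH]; rewrite big_cons in_cons => hr.
  have p1 : 0 <= \big[Rplus/0]_(A <- r) norm (u A) ^ 2.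
    by apply: big_ind => [|x y hx hy|i _]; [lra | lra | apply: pow2_ge_0].
  have p2 := pow2_ge_0 (norm (u B)).
  case/orP => [/eqP ->|/IH]; first nra.
  by apply; lra.
by apply: norm_eq_zero; apply: key h (mem_index_enum _).
Qed.

Canonical cm_UniformSpace : UniformSpace :=
  UniformSpace.Pack (clmod n V)
    (norm_uniform_mixin cm_norm_triangle cm_norm_scal) (clmod n V).
Canonical cm_NormedModuleAux : NormedModuleAux R_AbsRing :=
  NormedModuleAux.Pack R_AbsRing (clmod n V)
    (NormedModuleAux.Class _ _ (ModuleSpace.class _ cm_ModuleSpace)
       (UniformSpace.class cm_UniformSpace)) (clmod n V).

Lemma cm_norm_compat1 u v (eps : R) :
  cm_norm (minus v u) < eps -> ball (u : cm_NormedModuleAux) eps v.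
Proof. by []. Qed.
Lemma cm_norm_compat2 u v (eps : posreal) :
  ball (u : cm_NormedModuleAux) eps v -> cm_norm (minus v u) < 1 * eps.
Proof. by rewrite Rmult_1_l. Qed.

Definition cm_NormedModule_mixin :
    NormedModule.mixin_of R_AbsRing cm_NormedModuleAux :=
  NormedModule.Mixin R_AbsRing cm_NormedModuleAux cm_norm 1
    cm_norm_triangle cm_norm_scal cm_norm_compat1 cm_norm_compat2 cm_norm_eq0.
Canonical cm_NormedModule : NormedModule R_AbsRing :=
  NormedModule.Pack R_AbsRing (clmod n V)
    (NormedModule.Class _ _ _ cm_NormedModule_mixin) (clmod n V).
End CliffordModuleNorm.

Record blin (U W : NormedModule R_AbsRing) : Type := Blin {
  blin_fun :> U -> W;
  blin_linear : is_linear blin_fun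
}.

Section BoundedLinearNorm.
Context (U W : NormedModule R_AbsRing).
Implicit Types f g h : blin U W.

Lemma blinP f g : (forall x, f x = g x) -> f = g.
Proof.
case: f g => [f hf] [g hg] /= fg.
have e : f = g by apply: functional_extensionality.
by subst g; rewrite (proof_irrelevance _ hf hg).
Qed.

Definition opnorm_bound (f : U -> W) (M : R) : Prop :=
  0 <= M /\ forall x, norm (f x) <= M * norm x.
Definition bl_norm f : R := real (Glb_Rbar (opnorm_bound f)).

Lemma bl_normP f : opnorm_bound f (bl_norm f) /\
  forall M, opnorm_bound f M -> bl_norm f <= M.
Proof.
rewrite /bl_norm; have [lb glb] := Glb_Rbar_correct (opnorm_bound f).
have [M0 [M0pos hM0]] := linear_norm _ (blin_linear f).
have bM0 : opnorm_bound f M0 by split=> //; lra.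
have ge0 : Rbar_le 0 (Glb_Rbar (opnorm_bound f)).
  by apply: glb => M [hM _].
case E: (Glb_Rbar (opnorm_bound f)) lb glb ge0 => [l| |] lb glb ge0 //=.
- split; last by move=> M /lb.
  split=> // x; case: (Rle_lt_or_eq_dec _ _ (norm_ge_0 x)) => [xpos|x0].
  + suff : norm (f x) / norm x <= l.
      move=> /(Rmult_le_compat_r (norm x) _ _ (norm_ge_0 x)).
      by rewrite /Rdiv Rmult_assoc Rinv_l ?Rmult_1_r //; lra.
    apply: (glb (norm (f x) / norm x)) => M [hM hb] /=.
    apply: (Rmult_le_reg_r (norm x)) => //.
    by rewrite /Rdiv Rmult_assoc Rinv_l ?Rmult_1_r //; lra.
  + by have := hM0 x; rewrite -x0; lra.
- by have := lb _ bM0.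
Qed.

Lemma bl_plus_linear f g : is_linear (fun x => plus (f x) (g x)).
Proof.
have [f1 f2 [Mf [Mf0 hf]]] := blin_linear f.
have [g1 g2 [Mg [Mg0 hg]]] := blin_linear g.
split.
- move=> x y; rewrite f1 g1 -!plus_assoc; congr plus.
  by rewrite !plus_assoc; congr plus; apply: plus_comm.
- by move=> k x; rewrite f2 g2 scal_distr_l.
- exists (Mf + Mg); split; first lra.
  move=> x; apply: Rle_trans (norm_triangle _ _) _.
  by have := hf x; have := hg x; lra.
Qed.
Lemma bl_scal_linear (l : R) f : is_linear (fun x => scal l (f x)).
Proof.
have [f1 f2 [Mf [Mf0 hf]]] := blin_linear f.
split.
- by move=> x y; rewrite f1 scal_distr_l.
- by move=> k x; rewrite f2 !scal_assoc /mult /= Rmult_comm.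
- exists ((Rabs l + 1) * Mf); split.
    by apply: Rmult_lt_0_compat => //; have := Rabs_pos l; lra.
  move=> x; apply: Rle_trans (norm_scal _ _) _; rewrite Rmult_assoc.
  have := hf x; have := norm_ge_0 (f x); have := Rabs_pos l.
  rewrite /abs /=; nra.
Qed.
Lemma bl_zero_linear : is_linear (fun _ : U => zero : W).
Proof. exact: is_linear_zero. Qed.

Definition bl_plus f g : blin U W := Blin (bl_plus_linear f g).
Definition bl_scal (l : R) f : blin U W := Blin (bl_scal_linear l f).
Definition bl_zero : blin U W := Blin bl_zero_linear.
Definition bl_opp f : blin U W := bl_scal (-1) f.

Lemma bl_plusC f g : bl_plus f g = bl_plus g f.
Proof. by apply: blinP => x /=; rewrite plus_comm. Qed.
Lemma bl_plusA f g h : bl_plus f (bl_plus g h) = bl_plus (bl_plus f g) h.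
Proof. by apply: blinP => x /=; rewrite plus_assoc. Qed.
Lemma bl_plus0 f : bl_plus f bl_zero = f.
Proof. by apply: blinP => x /=; rewrite plus_zero_r. Qed.
Lemma bl_plusN f : bl_plus f (bl_opp f) = bl_zero.
Proof.
apply: blinP => x /=.
by rewrite (_ : -1 = opp (one : R_Ring)) ?scal_opp_one ?plus_opp_r.
Qed.

Definition bl_AbelianMonoid_mixin : AbelianMonoid.mixin_of (blin U W) :=
  AbelianMonoid.Mixin _ _ _ bl_plusC bl_plusA bl_plus0.
Canonical bl_AbelianMonoid : AbelianMonoid :=
  AbelianMonoid.Pack (blin U W) bl_AbelianMonoid_mixin (blin U W).
Definition bl_AbelianGroup_mixin : AbelianGroup.mixin_of bl_AbelianMonoid :=
  AbelianGroup.Mixin bl_AbelianMonoid bl_opp bl_plusN.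
Canonical bl_AbelianGroup : AbelianGroup :=
  AbelianGroup.Pack (blin U W)
    (AbelianGroup.Class _ _ bl_AbelianGroup_mixin) (blin U W).

Lemma bl_scalA (x y : R_Ring) f : bl_scal x (bl_scal y f) = bl_scal (mult x y) f.
Proof. by apply: blinP => z /=; rewrite scal_assoc. Qed.
Lemma bl_scal1 f : bl_scal (one : R_Ring) f = f.
Proof. by apply: blinP => z /=; apply: scal_one. Qed.
Lemma bl_scalDr (x : R_Ring) f g :
  bl_scal x (bl_plus f g) = bl_plus (bl_scal x f) (bl_scal x g).
Proof. by apply: blinP => z /=; rewrite scal_distr_l. Qed.
Lemma bl_scalDl (x y : R_Ring) f :
  bl_scal (plus x y) f = bl_plus (bl_scal x f) (bl_scal y f).
Proof. by apply: blinP => z /=; rewrite scal_distr_r. Qed.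

Definition bl_ModuleSpace_mixin : ModuleSpace.mixin_of R_Ring bl_AbelianGroup :=
  ModuleSpace.Mixin R_Ring bl_AbelianGroup bl_scal
    bl_scalA bl_scal1 bl_scalDr bl_scalDl.
Canonical bl_ModuleSpace : ModuleSpace R_Ring :=
  ModuleSpace.Pack R_Ring (blin U W)
    (ModuleSpace.Class _ _ _ bl_ModuleSpace_mixin) (blin U W).

Lemma bl_norm_triangle f g : bl_norm (plus f g) <= bl_norm f + bl_norm g.
Proof.
have [[f0 hf] _] := bl_normP f; have [[g0 hg] _] := bl_normP g.
apply: (proj2 (bl_normP (plus f g))); split; first lra.
move=> x; apply: Rle_trans (norm_triangle _ _) _.
by have := hf x; have := hg x; lra.
Qed.
Lemma bl_norm_scal (l : R) f : bl_norm (scal l f) <= Rabs l * bl_norm f.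
Proof.
have [[f0 hf] _] := bl_normP f.
apply: (proj2 (bl_normP (scal l f))); split.
  by apply: Rmult_le_pos => //; apply: Rabs_pos.
move=> x; apply: Rle_trans (norm_scal _ _) _; rewrite Rmult_assoc.
by apply: Rmult_le_compat_l (hf x); apply: Rabs_pos.
Qed.
Lemma bl_norm_eq0 f : bl_norm f = 0 -> f = zero.
Proof.
have [[_ hf] _] := bl_normP f => f0.
apply: blinP => x /=; apply: norm_eq_zero.
by have := hf x; have := norm_ge_0 (f x); rewrite f0; lra.
Qed.

Canonical bl_UniformSpace : UniformSpace :=
  UniformSpace.Pack (blin U W)
    (norm_uniform_mixin bl_norm_triangle bl_norm_scal) (blin U W).
Canonical bl_NormedModuleAux : NormedModuleAux R_AbsRing :=
  NormedModuleAux.Pack R_AbsRing (blin U W)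
    (NormedModuleAux.Class _ _ (ModuleSpace.class _ bl_ModuleSpace)
       (UniformSpace.class bl_UniformSpace)) (blin U W).

Lemma bl_norm_compat1 f g (eps : R) :
  bl_norm (minus g f) < eps -> ball (f : bl_NormedModuleAux) eps g.
Proof. by []. Qed.
Lemma bl_norm_compat2 f g (eps : posreal) :
  ball (f : bl_NormedModuleAux) eps g -> bl_norm (minus g f) < 1 * eps.
Proof. by rewrite Rmult_1_l. Qed.

Definition bl_NormedModule_mixin :
    NormedModule.mixin_of R_AbsRing bl_NormedModuleAux :=
  NormedModule.Mixin R_AbsRing bl_NormedModuleAux bl_norm 1
    bl_norm_triangle bl_norm_scal bl_norm_compat1 bl_norm_compat2 bl_norm_eq0.
Canonical bl_NormedModule : NormedModule R_AbsRing :=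
  NormedModule.Pack R_AbsRing (blin U W)
    (NormedModule.Class _ _ _ bl_NormedModule_mixin) (blin U W).
End BoundedLinearNorm.

Definition reflexive_space (V : NormedModule R_AbsRing) : Prop :=
  forall Phi : blin (bl_NormedModule V R_NormedModule) R_NormedModule,
  exists v : V, forall phi : blin V R_NormedModule, Phi phi = phi v.

(* Multiplication table e_A e_B = cl_sign A B e_(A (+) B), with (+) the symmetric
   difference: sorting e_A e_B costs one sign for each pair i in A, j in B with
   j < i, and each common index contributes e_i^2 = -1. *)
Definition symdiff (n : nat) (A B : {set 'I_n}) : {set 'I_n} :=
  (A :\: B) :|: (B :\: A).
Definition cl_sign (n : nat) (A B : {set 'I_n}) : R :=
  (-1) ^ #|[set p in setX A B | leq p.2 p.1]|.

Notation clifford n := (clmod n R).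

Definition cl_lmul (n : nat) (V : NormedModule R_AbsRing)
    (a : clifford n) (v : clmod n V) : clmod n V :=
  [ffun C => \big[plus/zero]_(p : {set 'I_n} * {set 'I_n} | symdiff p.1 p.2 == C)
     scal (cl_sign p.1 p.2 * a p.1) (v p.2)].
Definition cl_rmul (n : nat) (V : NormedModule R_AbsRing)
    (v : clmod n V) (a : clifford n) : clmod n V :=
  [ffun C => \big[plus/zero]_(p : {set 'I_n} * {set 'I_n} | symdiff p.1 p.2 == C)
     scal (cl_sign p.1 p.2 * a p.2) (v p.1)].

Notation cl_mul a b := (cl_lmul a b : clifford _).

Definition cl_unit (n : nat) (A : {set 'I_n}) : clifford n :=
  [ffun B => if B == A then 1 else 0].
Definition cl_real (n : nat) (x : R) : clifford n := scal x (cl_unit set0).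
Arguments cl_real n x : clear implicits.

Lemma cl_mul_unit (n : nat) (A B : {set 'I_n}) :
  cl_mul (cl_unit A) (cl_unit B) = scal (cl_sign A B) (cl_unit (symdiff A B)).
Proof.
apply/ffunP => C; rewrite !ffunE /scal /= /mult /=.
have z (p : {set 'I_n} * {set 'I_n}) : p != (A, B) ->
    cl_sign p.1 p.2 * (cl_unit A p.1 : R) * cl_unit B p.2 = zero.
  case: p => X Y; rewrite xpair_eqE negb_and !ffunE /=.
  by case: eqP => [->|]; case: eqP => [->|] //= *; rewrite /zero /=; ring.
case: (symdiff A B =P C) => [<-|ne].
- rewrite (bigD1 (A, B)) ?eqxx //= big1 => [|p /andP [_ /z //]].
  by rewrite plus_zero_r !ffunE !eqxx /mult /=; ring.
- rewrite big1 => [|p /eqP hp].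
    by rewrite eq_sym (introF eqP ne) Rmult_0_r.
  by apply: z; apply/eqP => pAB; apply: ne; rewrite -hp pAB.
Qed.

Lemma cl_unit_sq (n : nat) (i : 'I_n) :
  cl_mul (cl_unit [set i]) (cl_unit [set i]) = cl_real n (-1).
Proof.
rewrite cl_mul_unit; congr scal; last by rewrite /symdiff setDv setU0.
rewrite /cl_sign (_ : [set p in _ | _] = [set (i, i)]) ?cards1 ?pow_1 //.
apply/setP => -[a b]; rewrite !inE xpair_eqE /=.
by case: eqP => [->|] //=; case: eqP => [->|]; rewrite ?leqnn ?andbF.
Qed.

Lemma cl_unit_anticomm (n : nat) (i j : 'I_n) : i != j ->
  cl_mul (cl_unit [set i]) (cl_unit [set j]) =
  opp (cl_mul (cl_unit [set j]) (cl_unit [set i])).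
Proof.
move=> ij; rewrite !cl_mul_unit /symdiff setUC -scal_opp_l; congr scal.
rewrite /cl_sign.
have E (a b : 'I_n) : [set p in setX [set a] [set b] | leq p.2 p.1] =
    if leq b a then [set (a, b)] else set0.
  apply/setP => -[x y]; case: ifP => h; rewrite !inE ?xpair_eqE /=;
  by case: eqP => [->|] //=; case: eqP => [->|] //=; rewrite h.
rewrite !E /opp /=; move: ij; rewrite -val_eqE /=.
by case: ltngtP => //= _ _; rewrite cards1 cards0 /=; ring.
Qed.

(* e_A = e_(i_1) ... e_(i_r) for A = {i_1 < ... < i_r} *)
Lemma cl_unit_min (n : nat) (i : 'I_n) (A : {set 'I_n}) :
  (forall j, j \in A -> ltn i j) ->
  cl_mul (cl_unit [set i]) (cl_unit A) = cl_unit (i |: A).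
Proof.
move=> hA; have iA : i \notin A by apply/negP => /hA; rewrite /= ltnn.
rewrite cl_mul_unit /cl_sign (_ : [set p in _ | _] = set0).
  rewrite cards0 scal_one /symdiff; congr cl_unit.
  apply/setP => x; rewrite !inE; case: (x =P i) => [->|_] /=.
    by rewrite (negbTE iA).
  by rewrite andbF.
apply/setP => -[a b]; rewrite !inE /=; case: eqP => [->|] //=.
by case: (boolP (b \in A)) => //= /hA; rewrite /= ltnNge => /negbTE ->.
Qed.

Section Paravectors.
Context (n : nat).
Implicit Types (s J : clifford n) (U : clifford n -> Prop).

Definition paravector s : Prop := forall A : {set 'I_n}, ltn 1%nat #|A| -> s A = 0.
(* conjugation and inverse of paravectors only: s^-1 = conj(s) / |s|^2 *)
Definition para_conj s : clifford n := [ffun A => if A == set0 then s A else - s A].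
Definition para_inv s : clifford n := scal (/ (norm s) ^ 2) (para_conj s).

Definition imag_unit J : Prop := paravector J /\ J set0 = 0 /\ norm J = 1.
Definition slice_pt (x y : R) J : clifford n := plus (cl_real n x) (scal y J).
(* r e^(J phi) *)
Definition polar (r phi : R) J : clifford n := slice_pt (r * cos phi) (r * sin phi) J.

Definition angle_set (omega phi : R) : Prop :=
  - omega < phi < omega \/ PI - omega < phi < PI + omega.
Definition double_sector (omega : R) s : Prop :=
  exists r J phi, 0 < r /\ imag_unit J /\ angle_set omega phi /\ s = polar r phi J.

Definition adherence U s : Prop :=
  forall eps : posreal, exists t, U t /\ ball s eps t.

Definition C1_on (D : R * R -> Prop) (g gx gy : R -> R -> clifford n) : Prop :=
  forall x y, D (x, y) ->
    is_derive (fun t => g t y) x (gx x y) /\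
    is_derive (fun t => g x t) y (gy x y) /\
    continuous (fun p : R * R => gx p.1 p.2) (x, y) /\
    continuous (fun p : R * R => gy p.1 p.2) (x, y).

Definition slice_dom U (p : R * R) : Prop :=
  forall J, imag_unit J -> U (slice_pt p.1 p.2 J).

(* A function U -> R_n is a function on R_n of which only the values on U matter. *)
Definition SH_R U (f : clifford n -> clifford n) : Prop :=
  exists f0 f0x f0y f1 f1x f1y : R -> R -> clifford n,
    C1_on (slice_dom U) f0 f0x f0y /\ C1_on (slice_dom U) f1 f1x f1y /\
    forall x y, slice_dom U (x, y) ->
      (forall J, imag_unit J ->
         f (slice_pt x y J) = plus (f0 x y) (cl_mul (f1 x y) J)) /\
      f0 x (- y) = f0 x y /\ f1 x (- y) = opp (f1 x y) /\
      f0x x y = f1y x y /\ f0y x y = opp (f1x x y).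

Definition SH_R0 (theta : R) (f : clifford n -> clifford n) : Prop :=
  SH_R (double_sector theta) f /\
  (exists M, forall s, double_sector theta s -> norm (f s) <= M) /\
  (forall J phi, imag_unit J -> angle_set theta phi ->
     ex_RInt_gen (fun r => norm (f (polar r phi J)) / r)
       (at_right 0) (Rbar_locally p_infty)).

Fixpoint cl_pow s (m : nat) : clifford n :=
  if m is m'.+1 then cl_mul s (cl_pow s m') else cl_real n 1.

Definition regularizer (m : nat) s : clifford n :=
  cl_mul (cl_pow s m) (para_inv (cl_pow (plus (cl_real n 1) (cl_pow s 2)) m)).
End Paravectors.

Notation bounded_map n VR := (blin (cm_NormedModule n VR) (cm_NormedModule n VR)).

Section Operators.
Context (n : nat) (VR : NormedModule R_AbsRing).
Let V := clmod n VR.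

(* Operators are identified with their graphs: T v w means v \in dom(T), Tv = w. *)
Definition operator : Type := V -> V -> Prop.
Implicit Types (S T P : operator) (s J : clifford n).

Record right_linear_op T : Prop := RightLinearOp {
  op_functional : forall v w w', T v w -> T v w' -> w = w';
  op_zero : T zero zero;
  op_plus : forall v v' w w', T v w -> T v' w' -> T (plus v v') (plus w w');
  op_rmul : forall v w (a : clifford n), T v w -> T (cl_rmul v a) (cl_rmul w a)
}.
Definition closed_op T : Prop :=
  right_linear_op T /\ closed (fun p : V * V => T p.1 p.2).
Definition injective_op T : Prop := forall v v' w, T v w -> T v' w -> v = v'.
Definition op_incl S T : Prop := forall v w, S v w -> T v w.
Definition closable_op T : Prop := exists S, closed_op S /\ op_incl T S.
Definition is_closure_op T S : Prop :=
  closed_op S /\ op_incl T S /\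
  forall S', closed_op S' -> op_incl T S' -> op_incl S S'.

Definition op_comp S T : operator := fun v w => exists u, T v u /\ S u w.
Definition op_add S T : operator :=
  fun v w => exists a b, S v a /\ T v b /\ w = plus a b.
Definition op_sub S T : operator :=
  fun v w => exists a b, S v a /\ T v b /\ w = minus a b.
Definition op_inv T : operator := fun v w => T w v.
Definition op_cl (a : clifford n) : operator := fun v w => w = cl_lmul a v.
Definition op_fun (F : V -> V) : operator := fun v w => w = F v.

Definition right_linear (F : V -> V) : Prop :=
  (forall v w, F (plus v w) = plus (F v) (F w)) /\
  (forall v a, F (cl_rmul v a) = cl_rmul (F v) a).
(* P \in B(V), given by the everywhere defined bounded map F *)
Definition is_bounded_op P (F : bounded_map n VR) : Prop :=
  right_linear F /\ forall v w, P v w <-> w = F v.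

Definition Qop s T : operator :=
  op_add (op_sub (op_comp T T) (op_comp (op_cl (cl_real n (2 * s set0))) T))
         (op_cl (cl_real n ((norm s) ^ 2))).
Definition S_resolvent_set T s : Prop :=
  paravector s /\ exists F, is_bounded_op (op_inv (Qop s T)) F.
Definition S_spectrum T s : Prop := paravector s /\ ~ S_resolvent_set T s.
Definition SL_inv s T : operator :=
  op_sub (op_comp (op_inv (Qop s T)) (op_cl (para_conj s)))
         (op_comp T (op_inv (Qop s T))).
Definition SR_inv s T : operator :=
  op_comp (op_sub (op_cl (para_conj s)) T) (op_inv (Qop s T)).

Definition bisectorial (omega : R) T : Prop :=
  (forall s, S_spectrum T s -> adherence (double_sector omega) s) /\
  forall phi, omega < phi < PI / 2 ->
    exists C, 0 <= C /\
      forall s, paravector s -> ~ double_sector phi s -> s <> zero ->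
        exists F, is_bounded_op (SL_inv s T) F /\ norm F <= C / norm s.

(* F = \int_0^oo f(s) ds_J S_R^-1(s,T) along s = r e^(J alpha), where
   ds_J = ds/J = e^(J alpha) (-J) dr; convergence is in operator norm. *)
Definition ray_integral T (f : clifford n -> clifford n) J (alpha : R)
    (F : bounded_map n VR) : Prop :=
  exists G : R -> bounded_map n VR,
    (forall r, 0 < r ->
       is_bounded_op
         (op_comp (op_cl (f (polar r alpha J)))
            (op_comp (op_cl (cl_mul (polar 1 alpha J) (opp J)))
               (SR_inv (polar r alpha J) T)))
         (G r)) /\
    is_RInt_gen G (at_right 0) (Rbar_locally p_infty) F.

(* F = f(T).  The positively oriented boundary of D_phi \cap C_J consists of the
   rays at angles -phi and pi - phi, run outwards, and those at angles phi and
   pi + phi, run inwards. *)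
Definition is_omega_calculus (omega theta : R) T (f : clifford n -> clifford n)
    (F : bounded_map n VR) : Prop :=
  right_linear F /\
  forall phi J, omega < phi < theta -> imag_unit J ->
    exists F1 F2 F3 F4,
      ray_integral T f J (- phi) F1 /\ ray_integral T f J phi F2 /\
      ray_integral T f J (PI - phi) F3 /\ ray_integral T f J (PI + phi) F4 /\
      F = scal (/ (2 * PI)) (plus (minus F1 F2) (minus F3 F4)).
End Operators.

(* Main.v *)
(** The bisectorial bound makes [Q_z^-1 = A z] and [T Q_z^-1 = B z] bounded families on
    the double sector off the real axis, and along a plane [C_J] the contributions of
    conjugate rays combine into scalar integrals of [Im (F(z) <psi, R(z) v> dz)], where
    [F] is the complex stem function of [f] and [R(z) = conj z * A z - B z].  So [f(T)] is
    determined by pairing with functionals [psi], and the scalar integrals can be moved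
    by Cauchy's theorem.

    Multiplicativity only has to be known for [e = z / (1 + z^2)] and
    [E = T (1 + T^2)^-1]: the resolvent identity
    [(1 + z^2) R(z) E = z R(z) - (Q_i^-1 - z E)] gives [(f e)(T) = f(T) E], because
    the extra terms have no singularity in the sector; the residue at [i], an arctangent
    integral, gives [e(T) = E].  Hence [e_m(T) = E^m] and [(f e_m)(T) = f(T) E^m].

    [E] is injective with [T].  Its range is dense by reflexivity: if [phi] vanishes on
    the range of [E], then a weak limit of [t^2 Q_it^-1 u] as [t -> 0] shows that [phi]
    vanishes on the range of [Q_i^-1], and one as [t -> oo] then shows [phi = 0].
    So [f(T)], being bounded, is the closure of its restriction to the range of [E^m]. *)

(* Left multiplication by values of [f] does not commute with [T], so the calculus is not
   multiplicative in general. The product with [e] works because [e] maps each plane [C_J] into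
   itself: its values commute with [J], the stem functions multiply as complex functions, and [f(T)]
   stays to the left of [E^m].

   The analytic obstacle is that [z F(z) R(z)] is only bounded, so arcs at 0 and at infinity do not
   vanish and the contour between two rays cannot be closed directly. A factor [cutoff N] forces
   decay for fixed [N] and is removed afterwards by letting [N] grow.

   [Q_z^-1] is extracted from [S_L] at [z] and at its conjugate by dividing by [2 Im z], so
   resolvents are constructed only off the real axis. Rays that carry a resolvent therefore move
   inside the upper half plane. The resolvent-free correction terms in [(f e)(T)] are instead moved
   onto the real axis, where conjugation symmetry makes the integrand real and its imaginary part
   zero. For [e(T)] the ray at [ph] is moved to [PI - ph] after the pole at [i] has been split off
   explicitly. *)
From mathcomp Require Import all_boot.
From mathcomp Require boolp classical_sets.
From Stdlib Require Import Reals Lra FunctionalExtensionality ProofIrrelevance.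
From Stdlib Require ClassicalEpsilon Classical_Prop.
From Coquelicot Require Import Coquelicot.
Require Import Defs.

Set Implicit Arguments.
Unset Strict Implicit.
Unset Printing Implicit Defensive.
Open Scope R_scope.

(** * The Hahn-Banach theorem *)

Section HahnBanach.
Context (E : ModuleSpace R_Ring).
Implicit Types (x y : E) (p : E -> R).

(** Homogeneity is only asked as an inequality for [0 < t], the easier form to check for an infimum;
    using it with [/ t] as well gives equality. *)
Definition sublinear p : Prop :=
  (forall x y, p (plus x y) <= p x + p y) /\
  (forall t x, 0 < t -> p (scal t x) <= t * p x).

Lemma sublinear_0 p : sublinear p -> p zero = 0.
Proof.
move=> [h1 h2].
have a := h2 2 zero ltac:(lra); have b := h2 (/2) zero ltac:(lra).
rewrite !scal_zero_r in a b; lra.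
Qed.

Lemma sublinear_scal p t x : sublinear p -> 0 <= t -> p (scal t x) = t * p x.
Proof.
move=> hp [t0|<-]; last by rewrite (@scal_zero_l R_Ring) (sublinear_0 hp); ring.
apply: Rle_antisym; first exact: (proj2 hp).
have h := proj2 hp (/ t) (scal t x) (Rinv_0_lt_compat _ t0).
rewrite scal_assoc /mult /= Rinv_l ?(@scal_one R_Ring) in h; last lra.
apply: (Rmult_le_reg_l (/ t)); first exact: Rinv_0_lt_compat.
rewrite -Rmult_assoc Rinv_l; lra.
Qed.

Lemma sublinear_ge p x : sublinear p -> - p (opp x) <= p x.
Proof.
move=> hp; have := proj1 hp x (opp x); rewrite plus_opp_r (sublinear_0 hp); lra.
Qed.

Lemma infimum (S : R -> Prop) (l : R) : (exists s, S s) -> (forall s, S s -> l <= s) ->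
  exists m, (forall s, S s -> m <= s) /\ (forall m', (forall s, S s -> m' <= s) -> m' <= m).
Proof.
move=> [s0 hs0] hl.
have [||m [hm1 hm2]] := completeness (fun r => S (- r)).
- by exists (- l) => r /hl; lra.
- by exists (- s0); rewrite Ropp_involutive.
exists (- m); split=> [s hs|m' hm'].
  by have := hm1 (- s); rewrite Ropp_involutive => /(_ hs); lra.
suff : m <= - m' by lra.
by apply: hm2 => r /hm'; lra.
Qed.

(* The largest sublinear [q <= p] with [q (- v) <= - p v]. *)
Lemma sublinear_descent p v : sublinear p ->
  exists q, sublinear q /\ (forall x, q x <= p x) /\ q (opp v) <= - p v.
Proof.
move=> hp.
(* [q x] is the infimum over [t >= 0] of [p (x + t v) - t * p v]: [t = 0] gives [q <= p], and
   [x = - v] with [t = 1] gives the bound at [- v]. It is finite because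
   [t * p v <= p (x + t v) + p (- x)]. *)
pose S x r := exists t, 0 <= t /\ r = p (plus x (scal t v)) - t * p v.
have hS x : exists m, (forall s, S x s -> m <= s) /\
    (forall m', (forall s, S x s -> m' <= s) -> m' <= m).
  apply: (@infimum _ (- p (opp x))).
    by exists (p (plus x (scal 0 v)) - 0 * p v), 0; split=> //; lra.
  move=> s [t [t0 ->]].
  have := proj1 hp (plus x (scal t v)) (opp x).
  rewrite (plus_comm _ (opp x)) plus_assoc plus_opp_l plus_zero_l.
  by rewrite (sublinear_scal _ hp t0); lra.
have [q hq] : exists q, forall x, (forall s, S x s -> q x <= s) /\
    (forall m', (forall s, S x s -> m' <= s) -> m' <= q x).
  exact: (ClassicalEpsilon.choice _ hS).
have qS x t : 0 <= t -> q x <= p (plus x (scal t v)) - t * p v.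
  by move=> t0; apply: (proj1 (hq x)); exists t.
exists q; split; [split|split].
- move=> x y; suff h : forall t, 0 <= t ->
      q (plus x y) - (p (plus x (scal t v)) - t * p v) <= q y.
    suff : q (plus x y) - q y <= q x by lra.
    by apply: (proj2 (hq x)) => _ [t [t0 ->]]; have := h t t0; lra.
  move=> t t0; apply: (proj2 (hq y)) => _ [s [s0 ->]].
  have := qS (plus x y) (t + s) ltac:(lra).
  have := proj1 hp (plus x (scal t v)) (plus y (scal s v)).
  have -> : plus (plus x (scal t v)) (plus y (scal s v)) =
            plus (plus x y) (scal (t + s) v).
    rewrite (@scal_distr_r R_Ring) -!plus_assoc; congr plus.
    by rewrite !plus_assoc; congr plus; apply: plus_comm.
  lra.
- move=> t x t0; suff : / t * q (scal t x) <= q x.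
    move=> /(Rmult_le_compat_l t _ _ (Rlt_le _ _ t0)).
    by rewrite -Rmult_assoc Rinv_r; lra.
  apply: (proj2 (hq x)) => _ [s [s0 ->]].
  have := qS (scal t x) (t * s) ltac:(apply: Rmult_le_pos; lra).
  rewrite (_ : plus _ _ = scal t (plus x (scal s v))); last first.
    by rewrite scal_distr_l scal_assoc.
  rewrite (sublinear_scal _ hp (Rlt_le _ _ t0)) => h.
  apply: (Rmult_le_reg_l t) => //; rewrite -Rmult_assoc Rinv_r; lra.
- move=> x; have := qS x 0 (Rle_refl _).
  by rewrite (@scal_zero_l R_Ring) plus_zero_r; lra.
- have := qS (opp v) 1 ltac:(lra).
  by rewrite (@scal_one R_Ring) plus_opp_l (sublinear_0 hp); lra.
Qed.

(** Zorn's lemma for the reversed pointwise order. A nonempty chain is bounded by its pointwise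
    infimum, which is finite since every member satisfies [q x >= - p (- x)]. *)
Lemma sublinear_minimal p : sublinear p ->
  exists q, sublinear q /\ (forall x, q x <= p x) /\
    forall q', sublinear q' -> (forall x, q' x <= q x) -> forall x, q' x = q x.
Proof.
move=> hp.
pose X := {q : E -> R | sublinear q /\ forall x, q x <= p x}.
pose le (q r : X) : bool := boolp.asbool (forall x, sval r x <= sval q x).
have leP (q r : X) : le q r -> forall x, sval r x <= sval q x by move/boolp.asboolP.
have [q|q r s /leP h1 /leP h2|q r /leP h1 /leP h2|C hC|q hq] := @classical_sets.Zorn X le.
- by apply/boolp.asboolP => x; apply: Rle_refl.
- by apply/boolp.asboolP => x; apply: Rle_trans (h2 x) (h1 x).
- case: q r h1 h2 => [q hq] [r hr] /= h1 h2.
  have e : q = r.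
    by apply: functional_extensionality => x; apply: Rle_antisym.
  by subst r; rewrite (proof_irrelevance _ hq hr).
- case: (Classical_Prop.classic (exists q, C q)) => [[q0 Cq0]|no]; last first.
    have h0 : sublinear p /\ forall x, p x <= p x by split=> // x; apply: Rle_refl.
    by exists (exist _ p h0) => s Cs; case: no; exists s.
  have hS x : exists m, (forall s, (exists q, C q /\ s = sval q x) -> m <= s) /\
      (forall m', (forall s, (exists q, C q /\ s = sval q x) -> m' <= s) -> m' <= m).
    apply: (@infimum _ (- p (opp x))); first by exists (sval q0 x), q0.
    move=> _ [q [Cq ->]]; have [h1 h2] := svalP q.
    by have := sublinear_ge x h1; have := h2 (opp x); lra.
  have [m hm] := ClassicalEpsilon.choice _ hS.
  have mC x q : C q -> m x <= sval q x by move=> Cq; apply: (proj1 (hm x)); exists q.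
  have hmX : sublinear m /\ forall x, m x <= p x.
    split; first split.
    + move=> x y; suff h : forall q, C q -> m (plus x y) - sval q x <= m y.
        suff : m (plus x y) - m y <= m x by lra.
        by apply: (proj2 (hm x)) => _ [q [Cq ->]]; have := h q Cq; lra.
      move=> q Cq; apply: (proj2 (hm y)) => _ [r [Cr ->]].
      suff : m (plus x y) <= sval q x + sval r y by lra.
      (* The smaller of the two members of the chain, evaluated at both [x] and [y], bounds the
         infimum at the sum. *)
      case: (hC q r Cq Cr) => /leP h.
      * apply: Rle_trans (mC _ _ Cr) _.
        by have := proj1 (proj1 (svalP r)) x y; have := h x; lra.
      * apply: Rle_trans (mC _ _ Cq) _.
        by have := proj1 (proj1 (svalP q)) x y; have := h y; lra.
    + move=> t x t0; suff : / t * m (scal t x) <= m x.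
        move=> /(Rmult_le_compat_l t _ _ (Rlt_le _ _ t0)).
        by rewrite -Rmult_assoc Rinv_r; lra.
      apply: (proj2 (hm x)) => _ [q [Cq ->]].
      have := mC (scal t x) q Cq; rewrite (sublinear_scal _ (proj1 (svalP q))); last lra.
      by move=> h; apply: (Rmult_le_reg_l t) => //; rewrite -Rmult_assoc Rinv_r; lra.
    + by move=> x; apply: Rle_trans (mC x _ Cq0) (proj2 (svalP q0) x).
  exists (exist _ m hmX) => s Cs; apply/boolp.asboolP => x; exact: mC.
exists (sval q); have [h1 h2] := svalP q; split=> //; split=> // q' hq' h x.
have hX : sublinear q' /\ forall x, q' x <= p x.
  by split=> // y; apply: Rle_trans (h y) (h2 y).
have := hq (exist _ q' hX); rewrite /le => /(_ _) <- //.
by apply/boolp.asboolP.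
Qed.

(** A minimal sublinear functional is odd, hence linear: descending from it at [x] cannot lower it,
    so its value at [- x] is at most minus its value at [x]. A first descent at [v] secures the
    value [p v]. *)
Theorem hahn_banach p v : sublinear p ->
  exists l : E -> R, (forall x y, l (plus x y) = l x + l y) /\
    (forall t x, l (scal t x) = t * l x) /\
    (forall x, l x <= p x) /\ l v = p v.
Proof.
move=> hp; have [q [hq [qp qv]]] := sublinear_descent v hp.
have [l [hl [lq lmin]]] := sublinear_minimal hq.
have lopp x : l (opp x) = - l x.
  have [r [hr [rl rx]]] := sublinear_descent x hl.
  by have := sublinear_ge x hl; rewrite (lmin _ hr rl) in rx; lra.
exists l; split; [|split; [|split]].
- move=> x y; apply: Rle_antisym; first exact: (proj1 hl).
  have := proj1 hl (opp x) (opp y); rewrite -(@opp_plus E) !lopp => h.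
  by apply: Ropp_le_cancel; rewrite Ropp_plus_distr.
- move=> t x; case: (Rle_dec 0 t) => t0; first exact: sublinear_scal.
  have -> : scal t x = opp (scal (- t) x).
    by rewrite -(@scal_opp_l R_Ring) /opp /= Ropp_involutive.
  by rewrite lopp (sublinear_scal _ hl); lra.
- by move=> x; apply: Rle_trans (lq x) (qp x).
- apply: Rle_antisym; first exact: Rle_trans (lq v) (qp v).
  by have := lq (opp v); rewrite lopp; lra.
Qed.
End HahnBanach.

(** * Separating functionals on normed spaces *)

Section Dual.
Context (E : NormedModule R_AbsRing).

(* The sublinear functional is the distance to [M]. *)
Lemma functional_separation (M : E -> Prop) (x : E) (d : R) :
  M zero -> (forall y z, M y -> M z -> M (plus y z)) ->
  (forall (t : R) y, M y -> M (scal t y)) ->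
  0 < d -> (forall y, M y -> d <= norm (minus x y)) ->
  exists phi : blin E R_NormedModule, (forall y, M y -> phi y = 0) /\ 0 < phi x.
Proof.
move=> M0 MD MZ d0 hd.
have hS (z : E) : exists m, (forall s, (exists y, M y /\ s = norm (minus z y)) -> m <= s) /\
    (forall m', (forall s, (exists y, M y /\ s = norm (minus z y)) -> m' <= s) -> m' <= m).
  apply: (@infimum _ 0); first by exists (norm (minus z zero)), zero.
  by move=> _ [y [_ ->]]; apply: norm_ge_0.
have [p hp] := ClassicalEpsilon.choice _ hS.
have pM (z y : E) : M y -> p z <= norm (minus z y) by move=> My; apply: (proj1 (hp z)); exists y.
have pD (a b : E) : p (plus a b) <= p a + p b.
  suff h : forall y, M y -> p (plus a b) - norm (minus a y) <= p b.
    suff : p (plus a b) - p b <= p a by lra.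
    by apply: (proj2 (hp a)) => _ [y [My ->]]; have := h y My; lra.
  move=> y My; apply: (proj2 (hp b)) => _ [z [Mz ->]].
  have := pM (plus a b) _ (MD _ _ My Mz).
  have := norm_triangle (minus a y) (minus b z).
  have -> : plus (minus a y) (minus b z) = minus (plus a b) (plus y z).
    rewrite /minus opp_plus -!plus_assoc; congr plus.
    by rewrite !plus_assoc; congr plus; apply: plus_comm.
  lra.
have pZ (t : R) (a : E) : 0 < t -> p (scal t a) <= t * p a.
  move=> t0; suff : / t * p (scal t a) <= p a.
    move=> /(Rmult_le_compat_l t _ _ (Rlt_le _ _ t0)).
    by rewrite -Rmult_assoc Rinv_r; lra.
  apply: (proj2 (hp a)) => _ [y [My ->]].
  have := pM (scal t a) _ (MZ t y My).
  rewrite -(@scal_minus_distr_l R_Ring).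
  have := norm_scal t (minus a y); rewrite /abs /= Rabs_pos_eq; last lra.
  move=> h1 h2; apply: (Rmult_le_reg_l t) => //; rewrite -Rmult_assoc Rinv_r; last lra.
  by rewrite Rmult_1_l; apply: Rle_trans h2 h1.
have sp : sublinear p by split; [apply: pD | apply: pZ].
have [l [lD [lZ [lp lx]]]] := hahn_banach x sp.
have lN (z : E) : l (opp z) = - l z by rewrite -(@scal_opp_one R_Ring) lZ /opp /one /=; ring.
have pn (z : E) : p z <= norm z by have := pM z _ M0; rewrite minus_zero_r.
have ll : is_linear (l : E -> R_NormedModule).
  split=> //; exists 1; split; first lra.
  move=> z; rewrite Rmult_1_l; change (Rabs (l z) <= norm z); apply: Rabs_le.
  have := lp z; have := lp (opp z); have := pn z; have := pn (opp z).
  rewrite lN norm_opp; lra.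
exists (Blin ll); split=> /= [y My|]; last first.
  rewrite lx; apply: Rlt_le_trans d0 _.
  by apply: (proj2 (hp x)) => _ [y [My ->]]; apply: hd.
have h (z : E) : M z -> l z <= 0.
  by move=> Mz; have := lp z; have := pM z z Mz; rewrite minus_eq_zero norm_zero; lra.
have := h y My; have := h _ (MZ (-1) y My); rewrite lZ; lra.
Qed.

Lemma functional_eq0 (x : E) : (forall phi : blin E R_NormedModule, phi x = 0) -> x = zero.
Proof.
move=> hx; apply: norm_eq_zero; case: (Rle_lt_or_eq_dec _ _ (norm_ge_0 x)) => // x0.
have [|||||phi [_]] := @functional_separation (eq zero) x (norm x); rewrite ?hx //.
- by move=> y z <- <-; rewrite plus_zero_r.
- by move=> t y <-; rewrite scal_zero_r.
- by move=> y <-; rewrite minus_zero_r; apply: Rle_refl.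
- lra.
Qed.
End Dual.

Section Blin.
Context (U W : NormedModule R_AbsRing).

Lemma bl_norm_apply (f : blin U W) x : norm (f x) <= norm f * norm x.
Proof. by case: (bl_normP f) => -[_ h] _; apply: h. Qed.

Lemma bl_norm_le (f : blin U W) M : 0 <= M ->
  (forall x, norm (f x) <= M * norm x) -> norm f <= M.
Proof. by move=> M0 h; apply: (proj2 (bl_normP f)). Qed.

Lemma blD (f : blin U W) x y : f (plus x y) = plus (f x) (f y).
Proof. exact: linear_plus (blin_linear f) x y. Qed.
Lemma blZ (f : blin U W) (k : R) x : f (scal k x) = scal k (f x).
Proof. exact: linear_scal (blin_linear f) k x. Qed.
Lemma bl0 (f : blin U W) : f zero = zero.
Proof. exact: linear_zero (blin_linear f). Qed.
Lemma blN (f : blin U W) x : f (opp x) = opp (f x).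
Proof. by rewrite -(@scal_opp_one R_Ring) blZ (@scal_opp_one R_Ring). Qed.
Lemma blB (f : blin U W) x y : f (minus x y) = minus (f x) (f y).
Proof. by rewrite /minus blD blN. Qed.
Lemma bl_plusE (f g : blin U W) x : (plus f g : blin U W) x = plus (f x) (g x).
Proof. by []. Qed.
Lemma bl_scalE (k : R) (f : blin U W) x : (scal k f : blin U W) x = scal k (f x).
Proof. by []. Qed.
Lemma bl_oppE (f : blin U W) x : (opp f : blin U W) x = opp (f x).
Proof.
by rewrite -[RHS](@scal_opp_one R_Ring); change (scal (-1) (f x) = scal (opp (one : R_Ring)) (f x)).
Qed.
Lemma bl_minusE (f g : blin U W) x : (minus f g : blin U W) x = minus (f x) (g x).
Proof. by rewrite /minus bl_plusE bl_oppE. Qed.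
Lemma bl_sum (I : Type) (r : seq I) (P : pred I) (g : I -> U) (f : blin U W) :
  f (\big[plus/zero]_(i <- r | P i) g i) = \big[plus/zero]_(i <- r | P i) f (g i).
Proof. by apply: big_morph; [apply: blD | apply: bl0]. Qed.
End Blin.

Lemma dual_eq (E : NormedModule R_AbsRing) (x y : E) :
  (forall phi : blin E R_NormedModule, phi x = phi y) -> x = y.
Proof.
move=> h; rewrite -[x](plus_zero_r) -(plus_opp_l y) plus_assoc -/(minus x y).
rewrite (functional_eq0 (x := minus x y)) ?plus_zero_l // => phi.
by rewrite blB h minus_eq_zero.
Qed.

(** Functionals separate points, so a linear identity between vectors follows from the same identity
    between their images, which is a polynomial identity over the reals. *)
Ltac vec0 := let phi := fresh "phi" in
  apply: dual_eq => phi; rewrite /minus ?(blD, blN, blZ, bl0);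
  rewrite /plus /opp /scal /zero /= /mult /=; apply: Rminus_diag_uniq.
Ltac vec := vec0; ring.
Ltac vecf := vec0; field.

Section Completeness.

Section LimitMixin.
Context (E : NormedModule R_AbsRing).

Lemma filter_norm_lt (F : (E -> Prop) -> Prop) (l : E) : Filter F ->
  (forall eps : posreal, F (ball l eps)) ->
  forall eps, 0 < eps -> F (fun x => norm (minus x l) < eps).
Proof.
move=> FF hF eps e0.
have k0 := @norm_factor_gt_0 _ E.
have d0 : 0 < eps / @norm_factor _ E by apply: Rdiv_lt_0_compat.
apply: filter_imp (hF (mkposreal _ d0)) => x /norm_compat2 /=.
by rewrite (_ : norm_factor * _ = eps) //; field; lra.
Qed.

Context (limits : forall F : (E -> Prop) -> Prop, ProperFilter F -> cauchy F ->
           exists l : E, forall eps : posreal, F (ball l eps)).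

(** A limit operator has to be total on filters; the choice is arbitrary where no limit exists. *)
Definition filter_limit (F : (E -> Prop) -> Prop) : E :=
  ClassicalEpsilon.epsilon (inhabits zero) (fun l : E => forall eps : posreal, F (ball l eps)).

Lemma filter_limitP (F : (E -> Prop) -> Prop) : ProperFilter F -> cauchy F ->
  forall eps : posreal, F (ball (filter_limit F) eps).
Proof. by move=> h1 h2; apply: (ClassicalEpsilon.epsilon_spec (inhabits zero)) (limits h1 h2). Qed.

Lemma filter_limit_close (F1 F2 : (E -> Prop) -> Prop) :
  filter_le F1 F2 -> filter_le F2 F1 -> close (filter_limit F1) (filter_limit F2).
Proof.
move=> h1 h2; have -> : F1 = F2.
  apply: functional_extensionality => P; apply: boolp.propext.
  by split; [apply: h2 | apply: h1].
by move=> eps; apply: ball_center.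
Qed.

Definition limits_CompleteSpace_mixin : CompleteSpace.mixin_of E :=
  CompleteSpace.Mixin E filter_limit filter_limitP filter_limit_close.
End LimitMixin.

Lemma sumR_ge0 (I : Type) (r : seq I) (g : I -> R) :
  (forall i, 0 <= g i) -> 0 <= \big[Rplus/0]_(i <- r) g i.
Proof. by move=> h; apply: big_ind => [|x y hx hy|i _]; [lra | lra | apply: h]. Qed.

Lemma sumR_le (I : Type) (r : seq I) (g h : I -> R) :
  (forall i, g i <= h i) -> \big[Rplus/0]_(i <- r) g i <= \big[Rplus/0]_(i <- r) h i.
Proof.
move=> le; elim: r => [|i r IH]; rewrite ?big_nil ?big_cons; first lra.
by have := le i; lra.
Qed.

Lemma sumR_member (I : eqType) (r : seq I) (g : I -> R) i :
  (forall i, 0 <= g i) -> i \in r -> g i <= \big[Rplus/0]_(i <- r) g i.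
Proof.
move=> h; elim: r => // j r IH; rewrite in_cons big_cons => /orP [/eqP ->|/IH].
  by have := sumR_ge0 r h; lra.
by have := h j; lra.
Qed.

Lemma sumR_mulr (I : Type) (r : seq I) (g : I -> R) c :
  \big[Rplus/0]_(i <- r) (g i * c) = (\big[Rplus/0]_(i <- r) g i) * c.
Proof. by elim: r => [|i r IH]; rewrite ?big_nil ?big_cons ?IH; ring. Qed.

(** * Completeness of Clifford modules *)

Section CliffordModule.
Context (n : nat) (V : NormedModule R_AbsRing).
Implicit Types u v : clmod n V.

Lemma cm_norm_component u A : norm (u A) <= norm u.
Proof.
rewrite -(sqrt_Rsqr (norm (u A))); last exact: norm_ge_0.
apply: sqrt_le_1_alt; rewrite /Rsqr.
have := @sumR_member _ (index_enum {set 'I_n}) (fun A => norm (u A) ^ 2) A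
  (fun i => pow2_ge_0 _) (mem_index_enum A).
by rewrite /= Rmult_1_r.
Qed.

Lemma cm_norm_le_sum u : norm u <= \big[Rplus/0]_(A : {set 'I_n}) norm (u A).
Proof.
change (cm_norm u <= \big[Rplus/0]_(A : {set 'I_n}) norm (u A)); rewrite /cm_norm.
rewrite -[X in _ <= X]sqrt_Rsqr; last by apply: sumR_ge0 => A; apply: norm_ge_0.
apply: sqrt_le_1_alt.
elim: (index_enum _) => [|A r IH]; rewrite ?big_nil ?big_cons /Rsqr; first lra.
have h : 0 <= \big[Rplus/0]_(A <- r) norm (u A) by apply: sumR_ge0 => B; apply: norm_ge_0.
move: h (norm_ge_0 (u A)) IH; rewrite /Rsqr.
move: (norm (u A)) (\big[Rplus/0]_(A <- r) norm (u A)) (\big[Rplus/0]_(A <- r) norm (u A) ^ 2).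
by move=> a b c; nra.
Qed.
End CliffordModule.

Lemma filter_all (T : Type) (F : (T -> Prop) -> Prop) (I : finType) (P : I -> T -> Prop) :
  Filter F -> (forall i, F (P i)) -> F (fun x => forall i, P i x).
Proof.
move=> FF h; have k (r : seq I) : F (fun x => forall i, i \in r -> P i x).
  elim: r => [|j r IH]; first by apply: filter_forall.
  apply: filter_imp (filter_and _ _ (h j) IH) => x [h1 h2] i.
  by rewrite in_cons => /orP [/eqP ->|/h2].
by apply: filter_imp (k (index_enum I)) => x hx i; apply: hx; apply: mem_index_enum.
Qed.

Lemma sumR_const (I : Type) (r : seq I) c : \big[Rplus/0]_(i <- r) c = INR (size r) * c.
Proof.
elim: r => [|i r IH]; first by rewrite big_nil /=; ring.
by rewrite big_cons IH (_ : size (i :: r) = (size r).+1) // S_INR; ring.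
Qed.

(** Each component of the filter is Cauchy. The norm is at most the sum of the component norms, so
    [eps / (N + 1)] in each of the [N] components suffices. *)
Lemma cm_limits (n : nat) (V : CompleteNormedModule R_AbsRing)
    (F : (clmod n V -> Prop) -> Prop) : ProperFilter F ->
  cauchy (F : (cm_NormedModule n V -> Prop) -> Prop) ->
  exists l : cm_NormedModule n V, forall eps : posreal, F (ball l eps).
Proof.
move=> PF cF.
pose FA (A : {set 'I_n}) (P : V -> Prop) := F (fun u => P (u A)).
have PFA A : ProperFilter (FA A).
  split; first by move=> P /(@filter_ex _ F PF) [u hu]; exists (u A).
  split; first exact: filter_forall.
  - by move=> P Q; apply: filter_and.
  - by move=> P Q PQ; apply: filter_imp => u; apply: PQ.
have cFA A : cauchy (FA A).
  move=> eps; have [u hu] := cF eps; exists (u A).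
  change (F (fun v => ball (u A) eps (v A))); apply: filter_imp hu => v hv.
  apply: norm_compat1; have := cm_norm_component (minus v u : clmod n V) A.
  rewrite /minus /plus /opp /= !ffunE => h; exact: Rle_lt_trans h hv.
pose l : clmod n V := [ffun A => lim (FA A)].
exists l => eps; set N := INR (size (index_enum {set 'I_n})).
have N0 : 0 <= N := pos_INR _.
have d0 : 0 < eps / (N + 1) by apply: Rdiv_lt_0_compat; [apply: cond_pos | lra].
have h A : F (fun u => norm (minus (u A) (lim (FA A))) < eps / (N + 1)).
  exact: (filter_norm_lt _ (fun e => complete_cauchy _ (PFA A) (cFA A) e) d0).
apply: filter_imp (filter_all _ h) => u hu.
apply: Rle_lt_trans (cm_norm_le_sum _) _.
apply: (Rle_lt_trans _ (N * (eps / (N + 1)))).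
  rewrite -sumR_const; apply: sumR_le => A.
  by apply: Rlt_le; have := hu A; rewrite /minus /plus /opp /= !ffunE.
have e0 := cond_pos eps; apply: (Rmult_lt_reg_r (N + 1)); first lra.
rewrite (_ : N * _ * _ = N * eps); [nra | field; lra].
Qed.

Canonical cm_CompleteNormedModule (n : nat) (V : CompleteNormedModule R_AbsRing) :
    CompleteNormedModule R_AbsRing :=
  CompleteNormedModule.Pack R_AbsRing (clmod n V)
    (CompleteNormedModule.Class _ _ (NormedModule.class _ (cm_NormedModule n V))
       (limits_CompleteSpace_mixin (@cm_limits n V))) (clmod n V).

Lemma complete_limits (W : CompleteNormedModule R_AbsRing) (G : (W -> Prop) -> Prop) :
  ProperFilter G -> cauchy G -> exists l : W, forall eps : posreal, G (ball l eps).
Proof. by move=> PG cG; exists (lim G); apply: complete_cauchy. Qed.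

(** The limit is taken pointwise. It is bounded because the filter contains a ball of radius 1
    around a fixed operator, and convergence is in norm because the Cauchy estimate is uniform in
    [x]. *)
Lemma bl_limits (U W : NormedModule R_AbsRing)
    (limW : forall G : (W -> Prop) -> Prop, ProperFilter G -> cauchy G ->
      exists l : W, forall eps : posreal, G (ball l eps))
    (F : (blin U W -> Prop) -> Prop) : ProperFilter F ->
  cauchy (F : (bl_NormedModule U W -> Prop) -> Prop) ->
  exists l : bl_NormedModule U W, forall eps : posreal, F (ball l eps).
Proof.
move=> PF cF.
pose Fx (x : U) (P : W -> Prop) := F (fun f => P (f x)).
have PFx x : ProperFilter (Fx x).
  split; first by move=> P /(@filter_ex _ F PF) [u hu]; exists (u x).
  split; first exact: filter_forall.
  - by move=> P Q; apply: filter_and.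
  - by move=> P Q PQ; apply: filter_imp => u; apply: PQ.
have cN (e : R) : 0 < e -> exists f0 : blin U W, F (fun f => norm (minus f f0) < e).
  by move=> e0; have [f0 h] := cF (mkposreal e e0); exists f0.
have cFx x : cauchy (Fx x).
  move=> eps; have nx := norm_ge_0 x.
  have d0 : 0 < eps / (norm x + 1) by apply: Rdiv_lt_0_compat; [apply: cond_pos | lra].
  have [f0 hf] := cN _ d0; exists (f0 x).
  change (F (fun f => ball (f0 x) eps (f x))); apply: filter_imp hf => f hf.
  apply: norm_compat1; apply: Rle_lt_trans (_ : norm ((minus f f0 : blin U W) x) < _).
    by rewrite bl_minusE; apply: Rle_refl.
  apply: Rle_lt_trans (bl_norm_apply _ _) _.
  have e0 := cond_pos eps; have := norm_ge_0 (minus f f0).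
  move: hf => /(Rmult_lt_compat_r (norm x + 1) _ _ ltac:(lra)).
  rewrite (_ : eps / _ * _ = eps); [nra | field; lra].
have [l hl'] := ClassicalEpsilon.choice _ (fun x => limW _ (PFx x) (cFx x)).
have hl x e : 0 < e -> F (fun f => norm (minus (f x) (l x)) < e).
  by move=> e0; apply: (filter_norm_lt _ (hl' x) e0).
have small (w : W) : (forall e, 0 < e -> norm w < e) -> w = zero.
  move=> h; apply: norm_eq_zero; have := norm_ge_0 w => -[w0|//].
  by have := h _ w0; lra.
have lim_eq (a b : W) : (forall e, 0 < e -> norm (minus a b) < e) -> a = b.
  move=> /small h; have -> : a = plus (minus a b) b by vec.
  by rewrite h plus_zero_l.
have lD x y : l (plus x y) = plus (l x) (l y).
  apply: lim_eq => e e0; have e3 : 0 < e / 3 by lra.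
  have [f [[h1 h2] h3]] := filter_ex _ (filter_and _ _ (filter_and _ _ (hl x _ e3) (hl y _ e3)) (hl (plus x y) _ e3)).
  have -> : minus (l (plus x y)) (plus (l x) (l y)) =
    plus (plus (minus (f x) (l x) : W) (minus (f y) (l y) : W)) (opp (minus (f (plus x y)) (l (plus x y)) : W)).
    rewrite blD; vec.
  apply: Rle_lt_trans (norm_triangle _ _) _; rewrite norm_opp.
  have := norm_triangle (minus (f x) (l x) : W) (minus (f y) (l y) : W); lra.
have lZ (k : R) x : l (scal k x) = scal k (l x).
  apply: lim_eq => e e0; have k0 := Rabs_pos k.
  have e1 : 0 < e / (Rabs k + 1) by apply: Rdiv_lt_0_compat; lra.
  have e2 : 0 < e / (Rabs k + 1) / 1 by lra.
  have ee : (Rabs k + 1) * (e / (Rabs k + 1)) = e by field; lra.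
  have [f [h1 h2]] := filter_ex _ (filter_and _ _ (hl x _ e1) (hl (scal k x) _ e1)).
  have -> : minus (l (scal k x)) (scal k (l x)) =
    plus (scal k (minus (f x) (l x) : W)) (opp (minus (f (scal k x)) (l (scal k x)) : W)).
    rewrite blZ; vec.
  apply: Rle_lt_trans (norm_triangle _ _) _; rewrite norm_opp.
  have h3 : norm (scal k (minus (f x) (l x) : W)) <= Rabs k * norm (minus (f x) (l x) : W).
    exact: norm_scal.
  have := norm_ge_0 (minus (f x) (l x) : W); nra.
have lB (f0 : blin U W) (e : R) x : 0 < e -> F (fun f => norm (minus f f0) < e) ->
    norm (minus (l x) (f0 x) : W) <= e * norm x.
  move=> e0 h; apply: le_epsilon => d d0.
  have [f [h1 h2]] := filter_ex _ (filter_and _ _ h (hl x _ d0)).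
  have -> : minus (l x) (f0 x) =
    plus (minus (f x) (f0 x) : W) (opp (minus (f x) (l x) : W)) by vec.
  apply: Rle_trans (norm_triangle _ _) _; rewrite norm_opp.
  have := bl_norm_apply (minus f f0) x; rewrite bl_minusE.
  have := norm_ge_0 x; nra.
have ll : is_linear l.
  split=> //; have [f0 h0] := cN 1 Rlt_0_1.
  have n0 := norm_ge_0 f0; exists (norm f0 + 1); split; first lra.
  move=> x; have := lB _ _ x Rlt_0_1 h0; have := bl_norm_apply f0 x.
  have := norm_triangle (minus (l x) (f0 x) : W) (f0 x).
  have -> : plus (minus (l x) (f0 x) : W) (f0 x) = l x by vec.
  lra.
exists (Blin ll) => eps; have e0 := cond_pos eps.
have [f0 h0] := cN (eps / 4) ltac:(lra).
apply: filter_imp (h0) => f h1.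
suff h2 : norm (minus f (Blin ll)) <= eps / 2 by apply: norm_compat1; apply: Rle_lt_trans h2 _; lra.
apply: bl_norm_le => [|x]; first lra.
have := lB _ (eps / 4) x ltac:(lra) h0; have := bl_norm_apply (minus f f0) x; rewrite !bl_minusE /=.
have := norm_triangle (minus (f x) (f0 x) : W) (opp (minus (l x) (f0 x) : W)).
have -> : plus (minus (f x) (f0 x) : W) (opp (minus (l x) (f0 x) : W)) = minus (f x) (l x) by vec.
rewrite norm_opp; have := norm_ge_0 x; nra.
Qed.

Canonical bl_CompleteNormedModule (U : NormedModule R_AbsRing)
    (W : CompleteNormedModule R_AbsRing) : CompleteNormedModule R_AbsRing :=
  CompleteNormedModule.Pack R_AbsRing (blin U W)
    (CompleteNormedModule.Class _ _ (NormedModule.class _ (bl_NormedModule U W))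
       (limits_CompleteSpace_mixin (@bl_limits U W (@complete_limits W)))) (blin U W).
End Completeness.

(** * Improper integrals *)

Notation improper G l := (is_RInt_gen G (at_right 0) (Rbar_locally p_infty) l).

Section Improper.
Context (E : NormedModule R_AbsRing).
Implicit Types (G : R -> E) (l : E).

(** A single [d] controls both ends of the ray: the rectangles [a < d], [/ d < b] are cofinal in the
    product filter. *)
Lemma improperP G l : improper G l <-> forall eps : posreal, exists d : R, 0 < d /\
  forall a b, 0 < a < d -> / d < b -> exists y, is_RInt G a b y /\ ball l eps y.
Proof.
rewrite /is_RInt_gen filterlimi_locally; split=> h eps.
- have [Q P [e he] [M hM] hQP] := h eps.
  exists (Rmin e (/ (Rmax M 0 + 1))).
  have M0 := Rmax_r M 0; have M1 := Rmax_l M 0.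
  have i0 : 0 < / (Rmax M 0 + 1) by apply: Rinv_0_lt_compat; lra.
  have d0 : 0 < Rmin e (/ (Rmax M 0 + 1)) by apply: Rmin_pos => //; apply: cond_pos.
  split=> // a b ha hb; apply: (hQP a b).
  + apply: he; last by lra.
    rewrite /ball /= /AbsRing_ball /abs /minus /plus /opp /= Rabs_pos_eq; last lra.
    by have := Rmin_l e (/ (Rmax M 0 + 1)); lra.
  + apply: hM; have := Rinv_le_contravar _ _ d0 (Rmin_r e (/ (Rmax M 0 + 1))).
    by rewrite Rinv_inv; lra.
- have [d [d0 hd]] := h eps.
  exists (fun a => 0 < a < d) (fun b => / d < b); last by move=> a b; apply: hd.
  + exists (mkposreal d d0) => y; rewrite /ball /= /AbsRing_ball /abs /minus /plus /opp /=.
    by move=> h1 h2; rewrite Rabs_pos_eq in h1; lra.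
  + by exists (/ d).
Qed.

Lemma improper_ext G G' l : (forall r, 0 < r -> G r = G' r) -> improper G l -> improper G' l.
Proof.
move=> e; apply: is_RInt_gen_ext.
exists (fun a => 0 < a) (fun b => 0 < b).
- by exists (mkposreal 1 Rlt_0_1).
- by exists 0.
by move=> a b a0 b0 x /= [h1 _]; apply: e; apply: Rlt_trans h1; apply: Rmin_pos.
Qed.

Lemma is_RInt_eq G a b l l' : is_RInt G a b l -> is_RInt G a b l' -> l = l'.
Proof. by move=> h h'; exact: (@filterlim_locally_unique _ _ _ _ _ _ _ _ h h'). Qed.

Lemma improper_unique G l l' : improper G l -> improper G l' -> l = l'.
Proof.
move=> h h'; apply: (filterlimi_locally_unique _ _ _ _ h h').
exists (fun _ => True) (fun _ => True); [exact: filter_true | exact: filter_true |].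
by move=> a b _ _ y1 y2 /=; apply: is_RInt_eq.
Qed.

Lemma improper_plus G G' l l' : improper G l -> improper G' l' ->
  improper (fun r => plus (G r) (G' r)) (plus l l').
Proof. exact: is_RInt_gen_plus. Qed.
Lemma improper_minus G G' l l' : improper G l -> improper G' l' ->
  improper (fun r => minus (G r) (G' r)) (minus l l').
Proof. exact: is_RInt_gen_minus. Qed.
Lemma improper_scal (k : R) G l : improper G l ->
  improper (fun r => scal k (G r)) (scal k l).
Proof. exact: is_RInt_gen_scal. Qed.
End Improper.
Arguments improper_scal [E] k [G l] _.

Lemma improper_zero (E : NormedModule R_AbsRing) : improper (fun _ => zero : E) zero.
Proof.
apply/improperP => eps; exists 1; split; first lra.
move=> a b _ _; exists (zero : E); split; last exact: ball_center.
by have := is_RInt_const a b (zero : E); rewrite scal_zero_r.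
Qed.

(** Bounded linear maps commute with Riemann sums and, being continuous, with their limits. For
    functionals this reduces operator integrals to scalar ones. *)
Lemma is_RInt_blin (E W : NormedModule R_AbsRing) (phi : blin E W) (G : R -> E) a b l :
  is_RInt G a b l -> is_RInt (fun r => phi (G r)) a b (phi l).
Proof.
rewrite /is_RInt => h.
have hc : filterlim phi (locally l) (locally (phi l)).
  exact: (linear_cont _ _ (blin_linear phi)).
apply: filterlim_ext (filterlim_comp _ _ _ _ _ _ _ _ h hc) => ptd.
rewrite blZ; congr scal.
elim/(@SF_cons_ind R): ptd => [x0|p s IH]; first by rewrite /Riemann_sum /= bl0.
by rewrite !Riemann_sum_cons blD blZ IH.
Qed.

Lemma improper_blin (E W : NormedModule R_AbsRing) (phi : blin E W) (G : R -> E) l :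
  improper G l -> improper (fun r => phi (G r)) (phi l).
Proof.
move=> /improperP h; apply/improperP => eps.
have n0 := norm_ge_0 phi.
have e0 : 0 < eps / (norm phi + 1) by apply: Rdiv_lt_0_compat; [apply: cond_pos | lra].
have k0 := @norm_factor_gt_0 _ E.
have e1 : 0 < eps / (norm phi + 1) / @norm_factor _ E by apply: Rdiv_lt_0_compat.
have [d [d0 hd]] := h (mkposreal _ e1); exists d; split=> // a b ha hb.
have [y [h1 h2]] := hd a b ha hb; exists (phi y); split; first exact: is_RInt_blin.
apply: norm_compat1; rewrite -blB; apply: Rle_lt_trans (bl_norm_apply _ _) _.
have := norm_compat2 _ _ _ h2; rewrite /= (_ : norm_factor * _ = eps / (norm phi + 1)); last by field; lra.
move=> h3; have n1 := norm_ge_0 (minus y l).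
move: h3 => /(Rmult_lt_compat_r (norm phi + 1) _ _ ltac:(lra)).
rewrite (_ : eps / _ * _ = eps); [nra | field; lra].
Qed.

Arguments improper_blin [E W] phi [G l] _.

Lemma ball_R (x y e : R) : ball x e y <-> Rabs (y - x) < e.
Proof. by []. Qed.

(** Cauchy's criterion: moving an end point changes the integral of [G] by at most the integral of
    [g] over the gap, and that is small near both ends. *)
Lemma improper_dominated (E : CompleteNormedModule R_AbsRing) (G : R -> E) (g : R -> R) lg :
  (forall r, 0 < r -> continuous G r) -> (forall r, 0 < r -> norm (G r) <= g r) ->
  improper g lg -> exists l, improper G l.
Proof.
move=> cG Gg /improperP hg; apply/filterlimi_locally_cauchy.
  exists (fun a => 0 < a) (fun b => 0 < b).
  - by exists (mkposreal 1 Rlt_0_1).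
  - by exists 0.
  move=> a b a0 b0 /=; split; last by move=> y1 y2; apply: is_RInt_eq.
  apply: ex_RInt_continuous => z [z1 _]; apply: cG; apply: Rlt_le_trans z1.
  exact: Rmin_pos.
have exG a b : 0 < a -> 0 < b -> exists l, is_RInt G a b l.
  move=> a0 b0; apply: ex_RInt_continuous => z [z1 _]; apply: cG; apply: Rlt_le_trans z1.
  exact: Rmin_pos.
have exG' a b y : 0 < a <= b -> is_RInt g a b y -> exists l, is_RInt G a b l /\ norm l <= y.
  move=> [a0 ab] hy; have [l hl] := exG a b a0 (Rlt_le_trans _ _ _ a0 ab).
  exists l; split=> //; apply: (norm_RInt_le G g a b l y ab _ hl hy) => x hx; apply: Gg; lra.
(* Two integrals of [g] within [eps / 8] of the limit differ by less than [eps / 4]; the gaps at the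
   two ends then add up to at most [eps / 2]. *)
move=> eps; have e4 : 0 < eps / 8 by have := cond_pos eps; lra.
have [d [d0 hd]] := hg (mkposreal _ e4).
have left a a' b : 0 < a <= a' -> a' < d -> / d < b ->
    exists l, is_RInt G a a' l /\ norm l <= eps / 4.
  move=> ha ha' hb; have [y [h1 /ball_R h2]] := hd a b ltac:(lra) hb.
  have [y' [h1' /ball_R h2']] := hd a' b ltac:(lra) hb.
  have h3 : is_RInt g a a' (y - y').
    have := is_RInt_Chasles _ _ _ _ _ _ h1 (is_RInt_swap _ _ _ _ h1').
    by rewrite /plus /opp /=.
  have [l [l1 l2]] := exG' _ _ _ ha h3; exists l; split=> //.
  by move: h2 h2' => /Rabs_def2 /= h2 /Rabs_def2 /= h2'; lra.
have right a b b' : 0 < a < d -> / d < b <= b' -> b <= b' ->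
    exists l, is_RInt G b b' l /\ norm l <= eps / 4.
  move=> ha ha' hb; have [y [h1 /ball_R h2]] := hd a b ltac:(lra) ltac:(lra).
  have [y' [h1' /ball_R h2']] := hd a b' ltac:(lra) ltac:(lra).
  have h3 : is_RInt g b b' (y' - y).
    have := is_RInt_Chasles _ _ _ _ _ _ (is_RInt_swap _ _ _ _ h1) h1'.
    by rewrite /plus /opp /= Rplus_comm.
  have b0 : 0 < b by have := Rinv_0_lt_compat _ d0; lra.
  have [l [l1 l2]] := exG' _ _ _ (conj b0 hb) h3; exists l; split=> //.
  by move: h2 h2' => /Rabs_def2 /= h2 /Rabs_def2 /= h2'; lra.
have left' a a' b : 0 < a < d -> 0 < a' < d -> / d < b ->
    exists l, is_RInt G a a' l /\ norm l <= eps / 4.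
  move=> ha ha' hb; case: (Rle_dec a a') => h; first by apply: (left a a' b); lra.
  have [l [l1 l2]] := left a' a b ltac:(lra) ltac:(lra) hb.
  by exists (opp l); split; [apply: is_RInt_swap | rewrite norm_opp].
have right' a b b' : 0 < a < d -> / d < b -> / d < b' ->
    exists l, is_RInt G b b' l /\ norm l <= eps / 4.
  move=> ha hb hb'; case: (Rle_dec b b') => h; first by apply: (right a b b'); lra.
  have [l [l1 l2]] := right a b' b ha ltac:(lra) ltac:(lra).
  by exists (opp l); split; [apply: is_RInt_swap | rewrite norm_opp].
exists (fun ab => 0 < ab.1 < d /\ / d < ab.2); split.
  exists (fun a => 0 < a < d) (fun b => / d < b); last by [].
  + exists (mkposreal d d0) => y; rewrite /ball /= /AbsRing_ball /abs /minus /plus /opp /=.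
    by move=> h1 h2; rewrite Rabs_pos_eq in h1; lra.
  + by exists (/ d).
move=> [a b] [a' b'] /= [ha hb] [ha' hb'] y y' hy hy'.
have [l1 [k1 n1]] := left' a' a b ha' ha hb.
have [l2 [k2 n2]] := right' a b b' ha hb hb'.
have k := is_RInt_Chasles _ _ _ _ _ _ (is_RInt_Chasles _ _ _ _ _ _ k1 hy) k2.
have e := is_RInt_eq hy' k.
apply: norm_compat1; rewrite e.
have -> : minus (plus (plus l1 y) l2) y = plus l1 l2 by vec.
apply: Rle_lt_trans (norm_triangle _ _) _.
apply: (Rle_lt_trans _ (eps / 4 + eps / 4)); last by have := cond_pos eps; lra.
exact: Rplus_le_compat.
Qed.

(** * Cauchy's theorem between rays *)

Section ComplexDerivative.
Implicit Types (F G : C -> C) (z w l : C) (D : C -> Prop).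

Definition ccont F z : Prop :=
  continuous (fun w : R * R => (F w).1) z /\ continuous (fun w : R * R => (F w).2) z.

(* Caratheodory's form of complex differentiability. *)
Definition cderiv F z l : Prop := exists Phi : C -> C,
  ccont Phi z /\ Phi z = l /\
  locally (z : R * R) (fun w => F w = (F z + Phi w * (w - z))%C).

(** Continuity of the derivative is built in because [polar_cauchy] differentiates under the
    integral sign. *)
Definition holo D F : Prop := exists F', forall z, D z -> cderiv F z (F' z) /\ ccont F' z.

Lemma ccont_const l z : ccont (fun _ => l) z.
Proof. by split; apply: continuous_const. Qed.

Lemma ccont_id z : ccont (fun w => w) z.
Proof. by case: z => x y; split; [apply: continuous_fst | apply: continuous_snd]. Qed.

Lemma ccont_plus F G z : ccont F z -> ccont G z -> ccont (fun w => (F w + G w)%C) z.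
Proof.
move=> [f1 f2] [g1 g2]; split => /=.
- exact: (continuous_plus (fun w : R * R => (F w).1) (fun w => (G w).1)).
- exact: (continuous_plus (fun w : R * R => (F w).2) (fun w => (G w).2)).
Qed.

Lemma ccont_mult F G z : ccont F z -> ccont G z -> ccont (fun w => (F w * G w)%C) z.
Proof.
move=> [f1 f2] [g1 g2]; split => /=.
- apply: (continuous_minus (fun w : R * R => (F w).1 * (G w).1) (fun w => (F w).2 * (G w).2)).
  + exact: (continuous_mult (fun w : R * R => (F w).1) (fun w => (G w).1)).
  + exact: (continuous_mult (fun w : R * R => (F w).2) (fun w => (G w).2)).
- apply: (continuous_plus (fun w : R * R => (F w).1 * (G w).2) (fun w => (F w).2 * (G w).1)).
  + exact: (continuous_mult (fun w : R * R => (F w).1) (fun w => (G w).2)).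
  + exact: (continuous_mult (fun w : R * R => (F w).2) (fun w => (G w).1)).
Qed.

Lemma ccont_opp F z : ccont F z -> ccont (fun w => (- F w)%C) z.
Proof. by move=> [f1 f2]; split; apply: (continuous_opp (V := R_NormedModule)). Qed.

Lemma C_sq_pos z : z <> 0%C -> 0 < z.1 ^ 2 + z.2 ^ 2.
Proof.
case: z => x y /= h; case: (Req_dec x 0) => hx; last by nra.
by case: (Req_dec y 0) => hy; [case: h; rewrite hx hy | nra].
Qed.

Lemma continuous_inv (g : R * R -> R) p : continuous g p -> g p <> 0 ->
  continuous (fun q => / g q) p.
Proof. by move=> h1 h2; apply: (continuous_comp g Rinv) => //; apply: continuous_Rinv. Qed.

Lemma ccont_inv F z : ccont F z -> F z <> 0%C -> ccont (fun w => (/ F w)%C) z.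
Proof.
move=> [f1 f2] h.
have hn : continuous (fun w : R * R => / ((F w).1 ^ 2 + (F w).2 ^ 2)) z.
  apply: (continuous_inv (g := fun w : R * R => (F w).1 ^ 2 + (F w).2 ^ 2)); last first.
    by have := C_sq_pos h; lra.
  apply: (continuous_plus (fun w : R * R => (F w).1 ^ 2) (fun w => (F w).2 ^ 2)).
  + rewrite /=; apply: (continuous_mult (fun w : R * R => (F w).1) (fun w => (F w).1 * 1)) => //.
    by apply: (continuous_mult (fun w : R * R => (F w).1) (fun w => 1)) => //; apply: continuous_const.
  + rewrite /=; apply: (continuous_mult (fun w : R * R => (F w).2) (fun w => (F w).2 * 1)) => //.
    by apply: (continuous_mult (fun w : R * R => (F w).2) (fun w => 1)) => //; apply: continuous_const.
split.
- exact: (continuous_mult (fun w : R * R => (F w).1) (fun w => / ((F w).1 ^ 2 + (F w).2 ^ 2))).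
- apply: (continuous_mult (fun w : R * R => - (F w).2) (fun w => / ((F w).1 ^ 2 + (F w).2 ^ 2))) => //.
  exact: (continuous_opp (V := R_NormedModule)).
Qed.

Lemma ccont_ext_loc F G z : locally (z : R * R) (fun w => F w = G w) -> ccont F z -> ccont G z.
Proof.
move=> h [f1 f2]; split.
- by apply: continuous_ext_loc f1; apply: filter_imp h => w ->.
- by apply: continuous_ext_loc f2; apply: filter_imp h => w ->.
Qed.

Lemma cderiv_ccont F z l : cderiv F z l -> ccont F z.
Proof.
move=> [Phi [c [_ h]]].
apply: (@ccont_ext_loc (fun w => (F z + Phi w * (w - z))%C)).
  by apply: filter_imp h => w ->.
apply: ccont_plus; first exact: ccont_const.
apply: ccont_mult => //; apply: (ccont_plus (F := fun w => w)); first exact: ccont_id.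
exact: ccont_const.
Qed.

Lemma cderiv_const l z : cderiv (fun _ => l) z 0%C.
Proof.
exists (fun _ => 0%C); split; first exact: ccont_const.
by split=> //; apply: filter_forall => w; ring.
Qed.

Lemma cderiv_id z : cderiv (fun w => w) z 1%C.
Proof.
exists (fun _ => 1%C); split; first exact: ccont_const.
by split=> //; apply: filter_forall => w; ring.
Qed.

Lemma cderiv_plus F G z l l' : cderiv F z l -> cderiv G z l' ->
  cderiv (fun w => (F w + G w)%C) z (l + l')%C.
Proof.
move=> [P [cP [<- hP]]] [Q [cQ [<- hQ]]]; exists (fun w => (P w + Q w)%C).
split; first exact: ccont_plus.
by split=> //; apply: filter_imp (filter_and _ _ hP hQ) => w [-> ->]; ring.
Qed.

Lemma cderiv_mult F G z l l' : cderiv F z l -> cderiv G z l' ->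
  cderiv (fun w => (F w * G w)%C) z (l * G z + F z * l')%C.
Proof.
move=> hF hG; have cG := cderiv_ccont hG.
case: hF hG => [P [cP [<- hP]]] [Q [cQ [<- hQ]]].
exists (fun w => (P w * G w + F z * Q w)%C); split.
  by apply: ccont_plus; apply: ccont_mult => //; apply: ccont_const.
split=> //; apply: filter_imp (filter_and _ _ hP hQ) => w [-> ->]; ring.
Qed.

Lemma locally_neq0 F z : ccont F z -> F z <> 0%C -> locally (z : R * R) (fun w => F w <> 0%C).
Proof.
move=> [f1 f2] h; have h1 : F z <> 0%C := h.
case: (Req_dec (F z).1 0) => e1; last first.
  have /filterlim_locally := f1.
  move=> /(_ (mkposreal _ (Rabs_pos_lt _ e1))); apply: filter_imp => w /ball_R /= hw Fw.
  by move: hw; rewrite Fw /= Rminus_0_l Rabs_Ropp; lra.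
case: (Req_dec (F z).2 0) => e2; last first.
  have /filterlim_locally := f2.
  move=> /(_ (mkposreal _ (Rabs_pos_lt _ e2))); apply: filter_imp => w /ball_R /= hw Fw.
  by move: hw; rewrite Fw /= Rminus_0_l Rabs_Ropp; lra.
by case: h; rewrite [F z]surjective_pairing e1 e2.
Qed.

Lemma cderiv_inv F z l : cderiv F z l -> F z <> 0%C ->
  cderiv (fun w => (/ F w)%C) z (- l / (F z * F z))%C.
Proof.
move=> hF h0; have cF := cderiv_ccont hF; have nz := locally_neq0 cF h0.
case: hF => [P [cP [<- hP]]].
exists (fun w => (- P w * / (F w * F z))%C); split.
  apply: ccont_mult; first exact: ccont_opp.
  apply: ccont_inv; first by apply: ccont_mult => //; apply: ccont_const.
  exact: Cmult_neq_0.
split=> //; apply: filter_imp (filter_and _ _ hP nz) => w [e nw].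
have -> : (- P w * / (F w * F z) * (w - z))%C = (- (P w * (w - z)) / (F w * F z))%C.
  by rewrite /Cdiv; ring.
have -> : (P w * (w - z))%C = (F w - F z)%C by rewrite e; ring.
by field; split.
Qed.

Lemma holo_const D l : holo D (fun _ => l).
Proof. by exists (fun _ => 0%C) => z _; split; [apply: cderiv_const | apply: ccont_const]. Qed.
Lemma holo_id D : holo D (fun z => z).
Proof. by exists (fun _ => 1%C) => z _; split; [apply: cderiv_id | apply: ccont_const]. Qed.
Lemma holo_plus D F G : holo D F -> holo D G -> holo D (fun z => (F z + G z)%C).
Proof.
move=> [F' hF] [G' hG]; exists (fun z => (F' z + G' z)%C) => z Dz.
have [f1 f2] := hF z Dz; have [g1 g2] := hG z Dz.
by split; [apply: cderiv_plus | apply: ccont_plus].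
Qed.
Lemma holo_mult D F G : holo D F -> holo D G -> holo D (fun z => (F z * G z)%C).
Proof.
move=> [F' hF] [G' hG]; exists (fun z => (F' z * G z + F z * G' z)%C) => z Dz.
have [f1 f2] := hF z Dz; have [g1 g2] := hG z Dz; split; first exact: cderiv_mult.
by apply: ccont_plus; apply: ccont_mult => //; apply: cderiv_ccont; [apply: g1 | apply: f1].
Qed.
Lemma holo_inv D F : holo D F -> (forall z, D z -> F z <> 0%C) -> holo D (fun z => (/ F z)%C).
Proof.
move=> [F' hF] h0; exists (fun z => (- F' z / (F z * F z))%C) => z Dz.
have [f1 f2] := hF z Dz; have cF := cderiv_ccont f1.
split; first exact: cderiv_inv (h0 z Dz).
apply: ccont_mult; first exact: ccont_opp.
by apply: ccont_inv; [apply: ccont_mult | apply: Cmult_neq_0; apply: h0].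
Qed.
Lemma holo_opp D F : holo D F -> holo D (fun z => (- F z)%C).
Proof.
move=> h; have := holo_mult (holo_const D (-(1))%C) h.
by congr holo; apply: functional_extensionality => z; ring.
Qed.
Lemma holo_minus D F G : holo D F -> holo D G -> holo D (fun z => (F z - G z)%C).
Proof. by move=> hF hG; apply: holo_plus hF (holo_opp hG). Qed.
Lemma holo_div D F G : holo D F -> holo D G -> (forall z, D z -> G z <> 0%C) ->
  holo D (fun z => (F z / G z)%C).
Proof. by move=> hF hG h0; apply: holo_mult hF (holo_inv hG h0). Qed.
Lemma holo_sub D D' F : (forall z, D' z -> D z) -> holo D F -> holo D' F.
Proof. by move=> h [F' hF]; exists F' => z /h /hF. Qed.
Lemma holo_ccont D F z : holo D F -> D z -> ccont F z.
Proof. by move=> [F' hF] /hF [/cderiv_ccont]. Qed.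

Lemma is_derive_cast (g : R -> R) x (a b : R) : is_derive g x a -> a = b -> is_derive g x b.
Proof. by move=> h <-. Qed.

Lemma is_derive_Rmult (f g : R -> R) x (a b : R) : is_derive f x a -> is_derive g x b ->
  is_derive (fun t => f t * g t) x (a * g x + f x * b).
Proof. by move=> hf hg; apply: (is_derive_mult f g) => // *; apply: Rmult_comm. Qed.

Lemma is_derive_Rplus (f g : R -> R) x (a b : R) : is_derive f x a -> is_derive g x b ->
  is_derive (fun t => f t + g t) x (a + b).
Proof. exact: (@is_derive_plus _ R_NormedModule). Qed.

Lemma is_derive_Rminus (f g : R -> R) x (a b : R) : is_derive f x a -> is_derive g x b ->
  is_derive (fun t => f t - g t) x (a - b).
Proof. exact: (@is_derive_minus _ R_NormedModule). Qed.

(** A product rule with one factor merely continuous, possible because the other vanishes at the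
    point. It fits the factor [Phi] of [cderiv], which need not be differentiable. *)
Lemma is_derive_vanishing (p g : R -> R) x (a : R) : continuous p x -> is_derive g x a ->
  g x = 0 -> is_derive (fun t => p t * g t) x (p x * a).
Proof.
move=> cp /is_derive_Reals dg g0; apply/is_derive_Reals => eps eps0.
(* With [q] bounded by [Rabs a + 1], the two error terms are at most [eps / (2 M)] times
   [Rabs a + 1] and [Rabs (p x)], so they add up to [eps / 2]. *)
set M := Rabs a + 1 + Rabs (p x).
have M0 : 1 <= M by have := Rabs_pos a; have := Rabs_pos (p x); rewrite /M; lra.
have e1 : 0 < eps / (2 * M) by apply: Rdiv_lt_0_compat; lra.
have e2 : 0 < Rmin 1 (eps / (2 * M)) by apply: Rmin_pos; lra.
have /filterlim_locally /(_ (mkposreal _ e1)) [d1 h1] := cp.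
have [d2 h2] := dg _ e2.
exists (mkposreal _ (Rmin_stable_in_posreal d1 d2)) => h hn hd /=.
have hd1 : Rabs h < d1 by apply: Rlt_le_trans hd (Rmin_l _ _).
have hd2 : Rabs h < d2 by apply: Rlt_le_trans hd (Rmin_r _ _).
have {}h2 := h2 h hn hd2; have {}h1 : Rabs (p (x + h) - p x) < eps / (2 * M).
  by apply: h1; apply/ball_R; rewrite (_ : x + h - x = h) //; ring.
rewrite g0 Rmult_0_r !Rminus_0_r in h2 *.
set q := g (x + h) / h in h2.
have -> : p (x + h) * g (x + h) / h - p x * a = (p (x + h) - p x) * q + p x * (q - a).
  by rewrite /q /Rdiv; ring.
clearbody q.
have hq : Rabs q < Rabs a + 1.
  have -> : q = a + (q - a) by ring.
  apply: Rle_lt_trans (Rabs_triang _ _) _.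
  by apply: Rplus_lt_compat_l; apply: Rlt_le_trans h2 (Rmin_l _ _).
have h3 : Rabs (q - a) < eps / (2 * M) by apply: Rlt_le_trans h2 (Rmin_r _ _).
apply: Rle_lt_trans (Rabs_triang _ _) _; rewrite !Rabs_mult.
have k1 : Rabs (p (x + h) - p x) * Rabs q <= eps / (2 * M) * (Rabs a + 1).
  by apply: Rmult_le_compat; try exact: Rabs_pos; apply: Rlt_le.
have k2 : Rabs (p x) * Rabs (q - a) <= Rabs (p x) * (eps / (2 * M)).
  by apply: Rmult_le_compat_l; [apply: Rabs_pos | apply: Rlt_le].
apply: Rle_lt_trans (Rplus_le_compat _ _ _ _ k1 k2) _.
have -> : eps / (2 * M) * (Rabs a + 1) + Rabs (p x) * (eps / (2 * M)) = eps / 2.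
  by rewrite (_ : Rabs a + 1 = M - Rabs (p x)); [field; lra | rewrite /M; ring].
by lra.
Qed.

(** The increment of [F] along the path is a continuous factor times the increment of the path, so
    each product of real components falls under [is_derive_vanishing]. *)
Lemma cderiv_path F l (g1 g2 : R -> R) t (a b : R) : cderiv F (g1 t, g2 t) l ->
  is_derive g1 t a -> is_derive g2 t b ->
  is_derive (fun s => (F (g1 s, g2 s)).1) t (l.1 * a - l.2 * b) /\
  is_derive (fun s => (F (g1 s, g2 s)).2) t (l.1 * b + l.2 * a).
Proof.
move=> [Phi [[c1 c2] [<- h]]] d1 d2.
have cg1 : continuous g1 t by apply: ex_derive_continuous; exists a.
have cg2 : continuous g2 t by apply: ex_derive_continuous; exists b.
have cc (k : R * R -> R) : continuous k (g1 t, g2 t) -> continuous (fun s => k (g1 s, g2 s)) t.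
  by move=> ck; apply: (continuous_comp_2 g1 g2 (fun x y => k (x, y))) => //;
     apply: continuous_ext ck => -[].
have hl : locally t (fun s => F (g1 s, g2 s) =
    (F (g1 t, g2 t) + Phi (g1 s, g2 s) * ((g1 s, g2 s) - (g1 t, g2 t)))%C).
  have [d hd] := h.
  have /filterlim_locally /(_ d) k1 := cg1; have /filterlim_locally /(_ d) k2 := cg2.
  by apply: filter_imp (filter_and _ _ k1 k2) => s [s1 s2]; apply: hd; split.
have e1 : is_derive (fun s => g1 s - g1 t) t a.
  by apply: is_derive_cast (is_derive_Rminus d1 (is_derive_const (g1 t) t)) _; rewrite /zero /=; ring.
have e2 : is_derive (fun s => g2 s - g2 t) t b.
  by apply: is_derive_cast (is_derive_Rminus d2 (is_derive_const (g2 t) t)) _; rewrite /zero /=; ring.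
have z1 : g1 t - g1 t = 0 by ring.
have z2 : g2 t - g2 t = 0 by ring.
have p11 := is_derive_vanishing (cc _ c1) e1 z1.
have p12 := is_derive_vanishing (cc _ c1) e2 z2.
have p21 := is_derive_vanishing (cc _ c2) e1 z1.
have p22 := is_derive_vanishing (cc _ c2) e2 z2.
split.
- apply: (is_derive_ext_loc (fun s => (F (g1 t, g2 t)).1 +
     ((Phi (g1 s, g2 s)).1 * (g1 s - g1 t) - (Phi (g1 s, g2 s)).2 * (g2 s - g2 t)))).
    by apply: filter_imp hl => s -> /=; ring.
  apply: is_derive_cast (is_derive_Rplus (is_derive_const _ t) (is_derive_Rminus p11 p22)) _.
  by rewrite /zero /=; ring.
- apply: (is_derive_ext_loc (fun s => (F (g1 t, g2 t)).2 +
     ((Phi (g1 s, g2 s)).1 * (g2 s - g2 t) + (Phi (g1 s, g2 s)).2 * (g1 s - g1 t)))).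
    by apply: filter_imp hl => s -> /=; ring.
  apply: is_derive_cast (is_derive_Rplus (is_derive_const _ t) (is_derive_Rplus p12 p21)) _.
  by rewrite /zero /=; ring.
Qed.

End ComplexDerivative.

Definition cis (al : R) : C := (cos al, sin al).
Definition pt (r al : R) : C := (r * cos al, r * sin al).

Lemma sqrt_unique (x y : R) : 0 <= y -> y * y = x -> sqrt x = y.
Proof. by move=> y0 <-; apply: sqrt_square. Qed.

Lemma Cmod_pt r al : 0 <= r -> Cmod (pt r al) = r.
Proof.
move=> r0; apply: sqrt_unique => //=; have := sin2_cos2 al; rewrite /Rsqr => h.
transitivity (r * r * (sin al * sin al + cos al * cos al)); [by rewrite h; ring | ring].
Qed.

Lemma Cmod_cis al : Cmod (cis al) = 1.
Proof. by have := @Cmod_pt 1 al Rle_0_1; rewrite /pt !Rmult_1_l. Qed.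

Section PolarCauchy.
Context (F F' : C -> C).

(** In polar coordinates [dz = e^(i al) (dr + i r d al)], so the imaginary part of [F dz] is
    [ray_im dr + ray_re d al]. Closedness of this form is the equality of the [al]-derivative of
    [ray_im] and the [r]-derivative of [ray_re]; both are [ray_d]. *)
Definition ray_im (al r : R) : R := (F (pt r al) * cis al)%C.2.
Definition ray_re (al r : R) : R := r * (F (pt r al) * cis al)%C.1.
Definition ray_d (al r : R) : R :=
  (F (pt r al)).1 * cos al - (F (pt r al)).2 * sin al +
  r * ((F' (pt r al)).1 * (cos al * cos al - sin al * sin al) -
       (F' (pt r al)).2 * (2 * cos al * sin al)).

Lemma ray_im_derive al r : cderiv F (pt r al) (F' (pt r al)) ->
  is_derive (fun a => ray_im a r) al (ray_d al r).
Proof.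
move=> h.
have dc : is_derive (fun a => r * cos a) al (- r * sin al) by auto_derive => //; ring.
have ds : is_derive (fun a => r * sin a) al (r * cos al) by auto_derive => //; ring.
have [h1 h2] := cderiv_path h dc ds.
have c1 : is_derive cos al (- sin al) by auto_derive => //; ring.
have s1 : is_derive sin al (cos al) by auto_derive => //; ring.
apply: (is_derive_cast (is_derive_Rplus (is_derive_Rmult h1 s1) (is_derive_Rmult h2 c1))).
by rewrite /ray_d /pt; ring.
Qed.

Lemma ray_re_derive al r : cderiv F (pt r al) (F' (pt r al)) ->
  is_derive (ray_re al) r (ray_d al r).
Proof.
move=> h.
have dc : is_derive (fun t => t * cos al) r (cos al) by auto_derive => //; ring.
have ds : is_derive (fun t => t * sin al) r (sin al) by auto_derive => //; ring.
have [h1 h2] := cderiv_path h dc ds.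
have c0 (k : R) : is_derive (fun _ => k) r 0 by exact: is_derive_const.
have i1 : is_derive (fun t => t) r 1 by exact: is_derive_id.
apply: (is_derive_cast (is_derive_Rmult i1
  (is_derive_Rminus (is_derive_Rmult h1 (c0 (cos al))) (is_derive_Rmult h2 (c0 (sin al)))))).
by rewrite /ray_d /pt; ring.
Qed.

Lemma continuity_2d_polar (g : R * R -> R) al r : continuous g (pt r al) ->
  continuity_2d_pt (fun a t => g (pt t a)) al r.
Proof.
move=> h; apply/continuity_2d_pt_filterlim.
have cd (k : R -> R) x : (forall y, ex_derive k y) -> continuous k x.
  by move=> hk; apply: ex_derive_continuous; apply: hk.
have f1 : continuous (fun p : R * R => p.1) (al, r) := continuous_fst _ _.
have f2 : continuous (fun p : R * R => p.2) (al, r) := continuous_snd _ _.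
have fc : continuous (fun p : R * R => p.2 * cos p.1) (al, r).
  apply: (continuous_mult (fun p : R * R => p.2) (fun p => cos p.1)) => //.
  by apply: (continuous_comp (fun p : R * R => p.1) cos) => //; apply: continuous_cos.
have fs : continuous (fun p : R * R => p.2 * sin p.1) (al, r).
  apply: (continuous_mult (fun p : R * R => p.2) (fun p => sin p.1)) => //.
  by apply: (continuous_comp (fun p : R * R => p.1) sin) => //; apply: continuous_sin.
apply: (continuous_comp_2 _ _ (fun x y => g (x, y)) _ fc fs).
by apply: continuous_ext h => -[].
Qed.

Lemma continuity_2d_ray_d al r : ccont F (pt r al) -> ccont F' (pt r al) ->
  continuity_2d_pt ray_d al r.
Proof.
move=> [/continuity_2d_polar a1 /continuity_2d_polar a2]
       [/continuity_2d_polar b1 /continuity_2d_polar b2].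
have c : continuity_2d_pt (fun a _ => cos a) al r.
  apply: (continuity_1d_2d_pt_comp cos) (continuity_2d_pt_id1 _ _); apply: continuity_cos.
have s : continuity_2d_pt (fun a _ => sin a) al r.
  apply: (continuity_1d_2d_pt_comp sin) (continuity_2d_pt_id1 _ _); apply: continuity_sin.
have i : continuity_2d_pt (fun _ t => t) al r := continuity_2d_pt_id2 _ _.
have two : continuity_2d_pt (fun _ _ => 2) al r := continuity_2d_pt_const _ _ _.
rewrite /ray_d.
by repeat first [assumption | apply: continuity_2d_pt_minus | apply: continuity_2d_pt_plus |
  apply: continuity_2d_pt_mult].
Qed.

(** Differentiating under the integral sign and integrating [ray_d] in [r], the angle derivative of
    the ray integral is the difference of [ray_re] at [b] and [a]. These boundary values are the
    arcs; the mean value theorem bounds the change by [K] times the angle. The wider interval from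
    [be1] to [be2] leaves room for the derivatives at the extreme angles. *)
Lemma polar_cauchy (a b al1 al2 be1 be2 K : R) : 0 < a <= b ->
  be1 < al1 -> al1 <= al2 -> al2 < be2 ->
  (forall r al, 0 < r -> be1 < al < be2 ->
     cderiv F (pt r al) (F' (pt r al)) /\ ccont F' (pt r al)) ->
  (forall al, al1 <= al <= al2 -> Rabs (ray_re al b) + Rabs (ray_re al a) <= K) ->
  Rabs (RInt (ray_im al2) a b - RInt (ray_im al1) a b) <= K * (al2 - al1).
Proof.
move=> [a0 ab] h1 h12 h2 hF hK.
have nb al : be1 < al < be2 -> locally al (fun x => be1 < x < be2).
  move=> [k1 k2]; have e0 : 0 < Rmin (al - be1) (be2 - al) by apply: Rmin_pos; lra.
  exists (mkposreal _ e0) => y /ball_R /= /Rabs_def2 [].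
  by have := Rmin_l (al - be1) (be2 - al); have := Rmin_r (al - be1) (be2 - al); lra.
have pos t : Rmin a b <= t <= Rmax a b -> 0 < t by rewrite Rmin_left; lra.
have cr al r : 0 < r -> be1 < al < be2 -> continuous (ray_d al) r.
  move=> r0 hal; have [k1 k2] := hF r al r0 hal.
  have /continuity_2d_pt_filterlim h := continuity_2d_ray_d (cderiv_ccont k1) k2.
  apply: (continuous_comp_2 (fun _ => al) (fun t => t) ray_d _ (continuous_const _ _) (continuous_id _)); exact: h.
have ci al r : 0 < r -> be1 < al < be2 -> continuous (ray_im al) r.
  move=> r0 hal; have [/cderiv_ccont [c1 c2] k2] := hF r al r0 hal.
  have p1 : continuous (fun t => (F (pt t al)).1) r.
    have /continuity_2d_pt_filterlim h := continuity_2d_polar c1.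
    apply: (continuous_comp_2 (fun _ => al) (fun t => t) (fun a t => (F (pt t a)).1) _ (continuous_const _ _) (continuous_id _)); exact: h.
  have p2 : continuous (fun t => (F (pt t al)).2) r.
    have /continuity_2d_pt_filterlim h := continuity_2d_polar c2.
    apply: (continuous_comp_2 (fun _ => al) (fun t => t) (fun a t => (F (pt t a)).2) _ (continuous_const _ _) (continuous_id _)); exact: h.
  apply: (continuous_plus (fun t => (F (pt t al)).1 * sin al) (fun t => (F (pt t al)).2 * cos al)).
    by apply: (continuous_mult (fun t => (F (pt t al)).1) (fun t => sin al)) => //; apply: continuous_const.
  by apply: (continuous_mult (fun t => (F (pt t al)).2) (fun t => cos al)) => //; apply: continuous_const.
have der al : be1 < al < be2 ->
    is_derive (fun x => RInt (ray_im x) a b) al (ray_re al b - ray_re al a).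
  move=> hal.
  have e : RInt (fun t => Derive (fun x => ray_im x t) al) a b = ray_re al b - ray_re al a.
    apply: is_RInt_unique.
    apply: (is_RInt_ext (ray_d al)).
      move=> t [t1 t2]; symmetry; apply: is_derive_unique; apply: ray_im_derive.
      by apply: (proj1 (hF _ _ _ hal)); apply: pos; lra.
    apply: (is_RInt_derive (ray_re al)) => t /pos t0; last exact: cr.
    by apply: ray_re_derive; apply: (proj1 (hF _ _ _ hal)).
  rewrite -e; apply: (@is_derive_RInt_param (fun x t => ray_im x t)).
  - apply: filter_imp (nb al hal) => x hx t /pos t0.
    by eexists; apply: ray_im_derive; apply: (proj1 (hF _ _ t0 hx)).
  - move=> t /pos t0; have [k1 k2] := hF t al t0 hal.
    apply: continuity_2d_pt_ext_loc (continuity_2d_ray_d (cderiv_ccont k1) k2).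
    have [d hd] := nb al hal.
    exists (mkposreal _ (Rmin_stable_in_posreal d (mkposreal t t0))) => u v hu hv.
    symmetry; apply: is_derive_unique; apply: ray_im_derive; apply: (proj1 (hF _ _ _ _)).
      have : Rabs (v - t) < t by apply: Rlt_le_trans hv (Rmin_r _ _).
      by move/Rabs_def2; lra.
    by apply: hd; apply/ball_R; apply: Rlt_le_trans hu (Rmin_l _ _).
  - apply: filter_imp (nb al hal) => x hx; apply: ex_RInt_continuous => t /pos t0.
    exact: ci.
have [x|x|c [hc ->]] := @MVT_gen (fun x => RInt (ray_im x) a b) al1 al2
    (fun al => ray_re al b - ray_re al a).
- by rewrite Rmin_left // Rmax_right // => hx; apply: der; lra.
- rewrite Rmin_left // Rmax_right // => hx.
  apply/continuity_pt_filterlim.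
  have c : continuous (fun y => RInt (ray_im y) a b) x.
    by apply: ex_derive_continuous; eexists; apply: der; lra.
  exact: c.
rewrite Rmin_left // Rmax_right // in hc.
rewrite Rabs_mult (Rabs_pos_eq (al2 - al1)); last lra.
apply: Rmult_le_compat_r; first lra.
apply: Rle_trans (hK c hc); rewrite -(Rabs_Ropp (ray_re c a)); exact: Rabs_triang.
Qed.
End PolarCauchy.

Definition sector (be1 be2 : R) (z : C) : Prop :=
  exists r al, 0 < r /\ be1 < al < be2 /\ z = pt r al.

Lemma ccont_ray (F : C -> C) al r : ccont F (pt r al) ->
  continuous (fun t => (F (pt t al)).1) r /\ continuous (fun t => (F (pt t al)).2) r.
Proof.
move=> [/continuity_2d_polar c1 /continuity_2d_polar c2]; split.
- have /continuity_2d_pt_filterlim h := c1.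
  by apply: (continuous_comp_2 (fun _ => al) (fun t => t) (fun a t => (F (pt t a)).1)
    _ (continuous_const _ _) (continuous_id _)); exact: h.
- have /continuity_2d_pt_filterlim h := c2.
  by apply: (continuous_comp_2 (fun _ => al) (fun t => t) (fun a t => (F (pt t a)).2)
    _ (continuous_const _ _) (continuous_id _)); exact: h.
Qed.

Lemma ccont_ray_im (F : C -> C) al r : ccont F (pt r al) -> continuous (ray_im F al) r.
Proof.
move=> /ccont_ray [c1 c2].
apply: (continuous_plus (fun t => (F (pt t al)).1 * sin al) (fun t => (F (pt t al)).2 * cos al)).
  by apply: (continuous_mult (fun t => (F (pt t al)).1) (fun t => sin al)) => //; apply: continuous_const.
by apply: (continuous_mult (fun t => (F (pt t al)).2) (fun t => cos al)) => //; apply: continuous_const.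
Qed.

Lemma im_le_Cmod (z : C) : Rabs z.2 <= Cmod z.
Proof. by apply: Rle_trans (Rmax_Cmod z); apply: Rmax_r. Qed.
Lemma fst_le_Cmod (z : C) : Rabs z.1 <= Cmod z.
Proof. by apply: Rle_trans (Rmax_Cmod z); apply: Rmax_l. Qed.

Lemma ray_im_le F al r : Rabs (ray_im F al r) <= Cmod (F (pt r al)).
Proof.
by apply: Rle_trans (im_le_Cmod _) _; rewrite Cmod_mult Cmod_cis Rmult_1_r; apply: Rle_refl.
Qed.

(* A regularising factor: bounded by 1 on the upper half plane, tending to 1 as
   [N] grows, and decaying at both 0 and infinity for each fixed [N]. *)
Definition cutoff (N : R) (z : C) : C :=
  ((RtoC N * Ci / (z + RtoC N * Ci)) * (z / (z + RtoC (/ N) * Ci)))%C.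

Section Cutoff.
Context (N : R) (N0 : 0 < N).

Lemma Cmod_up (z : C) t : 0 < t -> 0 <= z.2 ->
  Cmod z <= Cmod (z + RtoC t * Ci)%C /\ t <= Cmod (z + RtoC t * Ci)%C.
Proof.
case: z => x y /= t0 y0; split.
- by apply: sqrt_le_1_alt => /=; nra.
- rewrite -{1}(sqrt_square t); last lra.
  by apply: sqrt_le_1_alt => /=; nra.
Qed.

Lemma Cneq0_mod (z : C) : 0 < Cmod z -> z <> 0%C.
Proof. by move=> h e; rewrite e Cmod_0 in h; lra. Qed.

Lemma Rdiv_le_1 x y : 0 < y -> x <= y -> x / y <= 1.
Proof.
move=> y0 xy; apply: (Rmult_le_reg_r y) => //; rewrite /Rdiv Rmult_assoc Rinv_l; lra.
Qed.

(** In the upper half plane [z + t i] has modulus at least [Cmod z] and at least [t]. Hence both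
    factors are at most 1; the first gives [N / Cmod z], the second [N * Cmod z]. *)
Lemma cutoff_bounds (z : C) : 0 <= z.2 -> z <> 0%C ->
  Cmod (cutoff N z) <= 1 /\ Cmod (cutoff N z) <= N * Cmod z /\
  Cmod (cutoff N z) <= N / Cmod z /\
  Cmod (cutoff N z - 1)%C <= Cmod z / N + / (N * Cmod z).
Proof.
move=> z2 /Cmod_gt_0 z0.
have i0 : 0 < / N by apply: Rinv_0_lt_compat.
have [p1 p2] := Cmod_up N0 z2; have [q1 q2] := Cmod_up i0 z2.
have np : (z + RtoC N * Ci)%C <> 0%C by apply: Cneq0_mod; lra.
have nq : (z + RtoC (/ N) * Ci)%C <> 0%C by apply: Cneq0_mod; lra.
have mN : Cmod (RtoC N * Ci)%C = N by rewrite Cmod_mult Cmod_Ci Cmod_R Rabs_pos_eq; lra.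
have mi : Cmod (RtoC (/ N) * Ci)%C = / N by rewrite Cmod_mult Cmod_Ci Cmod_R Rabs_pos_eq; lra.
have e : Cmod (cutoff N z) =
    (N / Cmod (z + RtoC N * Ci)%C) * (Cmod z / Cmod (z + RtoC (/ N) * Ci)%C).
  by rewrite /cutoff Cmod_mult !Cmod_div // mN.
(* With factors [a] and [b], this is [a b - 1 = - (1 - a) - a (1 - b)]. *)
have e1 : (cutoff N z - 1)%C = (- (z / (z + RtoC N * Ci)) +
   - (RtoC N * Ci / (z + RtoC N * Ci)) * (RtoC (/ N) * Ci / (z + RtoC (/ N) * Ci)))%C.
  by rewrite /cutoff; field; split.
have e2 : Cmod (cutoff N z - 1)%C <= Cmod z / Cmod (z + RtoC N * Ci)%C +
   (N / Cmod (z + RtoC N * Ci)%C) * (/ N / Cmod (z + RtoC (/ N) * Ci)%C).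
  rewrite e1; apply: Rle_trans (Cmod_triangle _ _) _.
  by rewrite Cmod_mult !Cmod_opp !Cmod_div // mN mi; apply: Rle_refl.
move: e e2 => -> /Rle_trans e2.
set P := Cmod (z + RtoC N * Ci)%C in p1 p2 e2 *.
set Q := Cmod (z + RtoC (/ N) * Ci)%C in q1 q2 e2 *.
set r := Cmod z in z0 p1 q1 e2 *.
have a1 : N / P <= 1 by apply: Rdiv_le_1; lra.
have a2 : r / Q <= 1 by apply: Rdiv_le_1; lra.
have iP : / P <= / N by apply: Rinv_le_contravar.
have iQ : / Q <= N by rewrite -(Rinv_inv N); apply: Rinv_le_contravar.
have iP' : / P <= / r by apply: Rinv_le_contravar.
have iQ' : / Q <= / r by apply: Rinv_le_contravar.
have P0 : 0 < / P by apply: Rinv_0_lt_compat; lra.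
have Q0 : 0 < / Q by apply: Rinv_0_lt_compat; lra.
have b1 : 0 <= N / P by apply: Rmult_le_pos; lra.
have b2 : 0 <= r / Q by apply: Rmult_le_pos; lra.
split; first by nra.
split.
  apply: (Rle_trans _ (1 * (r * N))); last by lra.
  by apply: Rmult_le_compat => //; apply: Rmult_le_compat_l; lra.
split.
  apply: (Rle_trans _ (N / r * 1)); last by lra.
  by apply: Rmult_le_compat => //; apply: Rmult_le_compat_l; lra.
apply: e2; apply: Rplus_le_compat; first by apply: Rmult_le_compat_l; lra.
rewrite Rinv_mult -[X in _ <= X]Rmult_1_l.
apply: Rmult_le_compat => //; first by apply: Rmult_le_pos; lra.
by apply: Rmult_le_compat_l; lra.
Qed.

(** The poles of [cutoff] lie on the negative imaginary axis, which the angles strictly between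
    [- PI / 2] and [3 PI / 2] avoid. *)
Lemma sector_up be1 be2 z t : - (PI / 2) <= be1 -> be2 <= 3 * (PI / 2) -> 0 < t ->
  sector be1 be2 z -> (z + RtoC t * Ci)%C <> 0%C.
Proof.
move=> h1 h2 t0 [r [al [r0 [hal ->]]]] [].
rewrite !Rmult_0_l !Rmult_0_r Rminus_0_r Rplus_0_r Rmult_1_r => e1 e2.
have {e1} c0 : cos al = 0 by apply: (Rmult_eq_reg_l r); lra.
case: (Rlt_le_dec al (PI / 2)) => k1.
  by have := cos_gt_0 al ltac:(lra) k1; lra.
case: (Req_dec al (PI / 2)) => k2; first by rewrite k2 sin_PI2 in e2; lra.
by have := cos_lt_0 al ltac:(lra) ltac:(lra); lra.
Qed.

Lemma holo_cutoff be1 be2 : - (PI / 2) <= be1 -> be2 <= 3 * (PI / 2) ->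
  holo (sector be1 be2) (cutoff N).
Proof.
move=> h1 h2; have i0 : 0 < / N by apply: Rinv_0_lt_compat.
apply: holo_mult; apply: holo_div; try exact: holo_const; try exact: holo_id.
- by apply: holo_plus; [apply: holo_id | apply: holo_const].
- by move=> z; apply: sector_up.
- by apply: holo_plus; [apply: holo_id | apply: holo_const].
- by move=> z; apply: sector_up.
Qed.
End Cutoff.

Lemma pt_neq0 r al : 0 < r -> pt r al <> 0%C.
Proof. by move=> r0; apply: Cneq0_mod; rewrite Cmod_pt; lra. Qed.

(* The integral of [F * cutoff N] over [a, b] approximates that of [F] over the
   whole ray: split at [a0 < b0] carrying almost all the mass of [|F|]. *)
Lemma cutoff_approx (F : C -> C) al l L eps : 0 <= al <= PI -> 0 < eps ->
  (forall r, 0 < r -> ccont F (pt r al)) ->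
  (forall N r, 0 < N -> 0 < r -> ccont (cutoff N) (pt r al)) ->
  improper (fun r => Cmod (F (pt r al))) L -> improper (ray_im F al) l ->
  exists N0, 0 < N0 /\ forall N, N0 <= N -> exists d, 0 < d /\ forall a b, 0 < a < d -> / d < b ->
    Rabs (RInt (ray_im (fun z => F z * cutoff N z)%C al) a b - l) <= eps.
Proof.
move=> hal eps0 cF cC /improperP hL /improperP hl.
have e8 : 0 < eps / 8 by lra.
have [d0 [d00 hd0]] : exists d, 0 < d <= 1 /\ forall a b, 0 < a < d -> / d < b ->
    exists y, is_RInt (fun r => Cmod (F (pt r al))) a b y /\ Rabs (y - L) < eps / 8.
  have [d0 [d00 hd0]] := hL (mkposreal _ e8).
  have m0 : 0 < Rmin d0 1 by apply: Rmin_pos; lra.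
  have := Rmin_l d0 1; have := Rmin_r d0 1 => m1 m2.
  exists (Rmin d0 1); split=> // a b ha hb.
  have := Rinv_le_contravar _ _ m0 m2 => m3.
  by have [y [k1 /ball_R k2]] := hd0 a b ltac:(lra) ltac:(lra); exists y.
have [d1 [d10 hd1]] := hl (mkposreal _ e8).
have id0 := Rinv_0_lt_compat _ (proj1 d00).
have id1 : 1 <= / d0 by rewrite -{1}Rinv_1; apply: Rinv_le_contravar; lra.
set a0 := d0 / 2; set b0 := 2 / d0.
have ha0 : 0 < a0 < d0 by rewrite /a0; lra.
have hb0 : / d0 < b0 by rewrite /b0 /Rdiv; lra.
have [y0 [hy0 by0]] := hd0 a0 b0 ha0 hb0.
have y00 : 0 < Rabs y0 + 1 by have := Rabs_pos y0; lra.
have eb : / a0 = b0 by rewrite /a0 /b0; field; lra.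
(* On [[a0, b0]], where [/ a0 = b0], the last bound of [cutoff_bounds] is at most [2 b0 / N]. This
   [N0] makes that times the mass [y0] at most [eps / 8]. *)
set N0 := 2 * b0 * (Rabs y0 + 1) / (eps / 8).
have N00 : 0 < N0.
  by apply: Rdiv_lt_0_compat => //; apply: Rmult_lt_0_compat; lra.
exists N0; split=> // N hN; have Np : 0 < N by lra.
have iN := Rinv_0_lt_compat _ Np.
set d := Rmin a0 d1.
have dp : 0 < d by apply: Rmin_pos; lra.
have da : d <= a0 by apply: Rmin_l.
have dd1 : d <= d1 by apply: Rmin_r.
exists d; split=> // a b ha hb.
have hb1 : / d1 <= / d by apply: Rinv_le_contravar.
have hba : b0 <= / d by rewrite -eb; apply: Rinv_le_contravar; lra.
have ab : a0 <= b0 by lra.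
have [y [hy hyL]] := hd0 a b ltac:(lra) ltac:(lra).
have [x [hx /ball_R /= hxl]] := hd1 a b ltac:(lra) ltac:(lra).
set g := fun r => Cmod (F (pt r al)) in hy0 hy.
set G := ray_im (fun z => F z * cutoff N z)%C al.
pose D r := G r - ray_im F al r.
have cG r : 0 < r -> continuous G r.
  by move=> r0; apply: ccont_ray_im; apply: ccont_mult; [apply: cF | apply: cC].
have cD r : 0 < r -> continuous D r.
  by move=> r0; apply: (continuous_minus G (ray_im F al)); [apply: cG | apply: ccont_ray_im; apply: cF].
have exI (k : R -> R) u v : (forall r, 0 < r -> continuous k r) -> 0 < u -> u <= v -> ex_RInt k u v.
  move=> ck u0 uv; apply: ex_RInt_continuous => t [t1 _]; apply: ck.
  by rewrite Rmin_left in t1; lra.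
have [G1 hG1] : ex_RInt g a a0.
  by apply: (ex_RInt_Chasles_1 _ _ _ b); [lra | exists y].
have [G3 hG3] : ex_RInt g b0 b.
  by apply: (ex_RInt_Chasles_2 _ a); [lra | exists y].
(* [y] and [y0] are both within [eps / 8] of [L], so [G1 + G3 < eps / 4]. The tails carry little
   mass, and the crude bound 2 on the modulus of [cutoff N - 1] suffices there. *)
have eG : y = G1 + y0 + G3.
  exact: (is_RInt_eq hy (is_RInt_Chasles _ _ _ _ _ _ (is_RInt_Chasles _ _ _ _ _ _ hG1 hy0) hG3)).
have [D1 hD1] := exI D a a0 cD ltac:(lra) ltac:(lra).
have [D2 hD2] := exI D a0 b0 cD ltac:(lra) ltac:(lra).
have [D3 hD3] := exI D b0 b cD ltac:(lra) ltac:(lra).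
have hD := is_RInt_Chasles _ _ _ _ _ _ (is_RInt_Chasles _ _ _ _ _ _ hD1 hD2) hD3.
have hGD : is_RInt G a b (x + (D1 + D2 + D3)).
  apply: (is_RInt_ext (fun r => plus (ray_im F al r) (D r))).
    by move=> r _; rewrite /D /plus /=; ring.
  exact: is_RInt_plus.
rewrite (is_RInt_unique _ _ _ _ hGD).
have g0 r : 0 <= g r by apply: Cmod_ge_0.
have Dk r : 0 < r -> Rabs (D r) <= g r * Cmod (cutoff N (pt r al) - 1)%C.
  move=> r0; rewrite /D /G /g -Cmod_mult.
  apply: Rle_trans (ray_im_le (fun z => F z * (cutoff N z - 1))%C al r).
  by rewrite /ray_im /=; apply: Req_le; congr Rabs; ring.
have cb r (r0 : 0 < r) : 0 <= (pt r al).2.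
  by apply: Rmult_le_pos; [lra | apply: sin_ge_0; lra].
have D2g r : 0 < r -> Rabs (D r) <= 2 * g r.
  move=> r0; apply: Rle_trans (Dk r r0) _; rewrite Rmult_comm.
  apply: Rmult_le_compat_r => //.
  have [k _] := cutoff_bounds Np (cb r r0) (@pt_neq0 r al r0).
  apply: Rle_trans (Cmod_triangle _ _) _; rewrite Cmod_opp Cmod_1; lra.
have hk : 2 * b0 / N * (Rabs y0 + 1) <= eps / 8.
  have : N0 * (eps / 8) <= N * (eps / 8) by apply: Rmult_le_compat_r; lra.
  rewrite /N0 {1}/Rdiv Rmult_assoc Rinv_l; last lra.
  move=> h; apply: (Rmult_le_reg_l N) => //.
  rewrite (_ : N * (2 * b0 / N * (Rabs y0 + 1)) = 2 * b0 * (Rabs y0 + 1)); last by field; lra.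
  lra.
have Dm r : a0 <= r <= b0 -> Rabs (D r) <= 2 * b0 / N * g r.
  move=> hr; have r0 : 0 < r by lra.
  apply: Rle_trans (Dk r r0) _; rewrite Rmult_comm; apply: Rmult_le_compat_r => //.
  have [_ [_ [_ k]]] := cutoff_bounds Np (cb r r0) (@pt_neq0 r al r0).
  apply: Rle_trans k _; rewrite Cmod_pt; last lra.
  rewrite Rinv_mult; have : / r <= b0 by rewrite -eb; apply: Rinv_le_contravar; lra.
  have : 0 < / r by apply: Rinv_0_lt_compat.
  rewrite /Rdiv; nra.
have n1 : Rabs D1 <= 2 * G1.
  apply: (norm_RInt_le D (fun r => 2 * g r) a a0 D1 (2 * G1)) => //; first lra.
    by move=> r hr; apply: D2g; lra.
  exact: (is_RInt_scal g).
have n3 : Rabs D3 <= 2 * G3.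
  apply: (norm_RInt_le D (fun r => 2 * g r) b0 b D3 (2 * G3)) => //; first lra.
    by move=> r hr; apply: D2g; lra.
  exact: (is_RInt_scal g).
have n2 : Rabs D2 <= 2 * b0 / N * y0.
  apply: (norm_RInt_le D (fun r => 2 * b0 / N * g r) a0 b0 D2 (2 * b0 / N * y0)) => //.
  exact: (is_RInt_scal g).
have n2' : Rabs D2 <= eps / 8.
  apply: Rle_trans n2 (Rle_trans _ _ _ _ hk); apply: Rmult_le_compat_l.
    by apply: Rmult_le_pos; lra.
  by have := Rle_abs y0; lra.
move: by0 hyL hxl => /Rabs_def2 ? /Rabs_def2 ? /Rabs_def2 ?.
have := Rle_abs D1; have := Rle_abs (- D1); have := Rle_abs D2; have := Rle_abs (- D2).
have := Rle_abs D3; have := Rle_abs (- D3); rewrite !Rabs_Ropp => *.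
by apply: Rabs_le; lra.
Qed.

Lemma NNPP_Req0 x : (forall eps, 0 < eps -> Rabs x <= 3 * eps) -> x = 0.
Proof.
move=> h; case: (Req_dec x 0) => // /Rabs_pos_lt x0.
by have := h (Rabs x / 4) ltac:(lra); lra.
Qed.

(** Since [r * Cmod F] is only bounded, arcs do not vanish by themselves. For fixed [N] the factor
    [cutoff N] makes the arcs at radii [a] and [/ a] of size [O(N a)]; [cutoff_approx] compares the
    two ray integrals with those of [F] once [N] is large. *)
Lemma ray_shift (F : C -> C) be1 be2 al1 al2 M L1 L2 l1 l2 :
  - (PI / 2) <= be1 -> be2 <= 3 * (PI / 2) ->
  be1 < al1 -> 0 <= al1 -> al1 <= al2 -> al2 <= PI -> al2 < be2 ->
  holo (sector be1 be2) F ->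
  (forall r al, 0 < r -> al1 <= al <= al2 -> r * Cmod (F (pt r al)) <= M) ->
  improper (fun r => Cmod (F (pt r al1))) L1 -> improper (fun r => Cmod (F (pt r al2))) L2 ->
  improper (ray_im F al1) l1 -> improper (ray_im F al2) l2 -> l1 = l2.
Proof.
move=> hb1 hb2 h1 h01 h12 h2P h2 hF hM hL1 hL2 hl1 hl2.
have PI0 := PI_RGT_0.
have hs r al : 0 < r -> be1 < al < be2 -> sector be1 be2 (pt r al).
  by move=> r0 hal; exists r, al.
have cF al r : be1 < al < be2 -> 0 < r -> ccont F (pt r al).
  by move=> hal r0; apply: (holo_ccont hF); apply: hs.
have cC al N r : be1 < al < be2 -> 0 < N -> 0 < r -> ccont (cutoff N) (pt r al).
  by move=> hal N0 r0; apply: (holo_ccont (holo_cutoff N0 hb1 hb2)); apply: hs.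
have M0 : 0 <= M.
  apply: Rle_trans (hM 1 al1 _ _); try lra.
  by rewrite Rmult_1_l; apply: Cmod_ge_0.
apply: Rminus_diag_uniq; apply: NNPP_Req0 => eps eps0.
have [N1 [N10 k1]] := @cutoff_approx F al1 l1 L1 eps ltac:(lra) eps0 (fun r => cF al1 r ltac:(lra))
  (fun N r => cC al1 N r ltac:(lra)) hL1 hl1.
have [N2 [N20 k2]] := @cutoff_approx F al2 l2 L2 eps ltac:(lra) eps0 (fun r => cF al2 r ltac:(lra))
  (fun N r => cC al2 N r ltac:(lra)) hL2 hl2.
set N := N1 + N2; have N0 : 0 < N by rewrite /N; lra.
have [d1 [d10 {}k1]] := k1 N ltac:(rewrite /N; lra).
have [d2 [d20 {}k2]] := k2 N ltac:(rewrite /N; lra).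
(* Chosen so that [d <= eps / K] makes the arc contribution [2 N M d PI] at most [eps]; the [+ 1]
   keeps [K] positive. *)
set K := 2 * N * M * PI + 1.
have K1 : 0 <= N * M * PI by apply: Rmult_le_pos; [apply: Rmult_le_pos; lra | lra].
have K0 : 0 < K by rewrite /K; lra.
have eK : 0 < eps / K by apply: Rdiv_lt_0_compat.
set d := Rmin 1 (Rmin (eps / K) (Rmin d1 d2)).
have d0 : 0 < d by apply: Rmin_pos; [lra | apply: Rmin_pos; [lra | apply: Rmin_pos; lra]].
have q0 : d <= 1 by apply: Rmin_l.
have q1 : d <= eps / K by apply: Rle_trans (Rmin_r _ _) (Rmin_l _ _).
have q2 : d <= d1 by apply: Rle_trans (Rmin_r _ _) (Rle_trans _ _ _ (Rmin_r _ _) (Rmin_l _ _)).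
have q3 : d <= d2 by apply: Rle_trans (Rmin_r _ _) (Rle_trans _ _ _ (Rmin_r _ _) (Rmin_r _ _)).
(* Now [/ b = a], so the bound [N * Cmod z] on the inner arc and [N / Cmod z] on the outer arc are
   both [N * a]. *)
set a := d / 2; set b := 2 / d.
have i1 : / d1 <= / d by apply: Rinv_le_contravar.
have i2 : / d2 <= / d by apply: Rinv_le_contravar.
have id : 1 <= / d by rewrite -{1}Rinv_1; apply: Rinv_le_contravar.
have bd : / d < b by rewrite /b /Rdiv; lra.
have {}k1 := k1 a b ltac:(rewrite /a; lra) ltac:(lra).
have {}k2 := k2 a b ltac:(rewrite /a; lra) ltac:(lra).
have a0 : 0 < a by rewrite /a; lra.
have iba : / b = a by rewrite /a /b; field; lra.
have [F' hF'] := holo_mult hF (holo_cutoff N0 hb1 hb2).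
have pc := @polar_cauchy (fun z => F z * cutoff N z)%C F' a b al1 al2 be1 be2 (2 * N * M * a).
have {}pc : Rabs (RInt (ray_im (fun z => F z * cutoff N z)%C al2) a b -
    RInt (ray_im (fun z => F z * cutoff N z)%C al1) a b) <= 2 * N * M * a * (al2 - al1).
  apply: pc => //; [split=> //; rewrite /a; lra | |].
    by move=> r al r0 hal; apply: hF'; apply: hs.
  move=> al hal.
  have bnd r : 0 < r -> Rabs (ray_re (fun z => F z * cutoff N z)%C al r) <=
      M * Cmod (cutoff N (pt r al)).
    move=> r0; rewrite /ray_re Rabs_mult (Rabs_pos_eq r); last lra.
    apply: (Rle_trans _ (r * (Cmod (F (pt r al)) * Cmod (cutoff N (pt r al))))).
      apply: Rmult_le_compat_l; first lra.
      apply: Rle_trans (fst_le_Cmod _) _.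
      by rewrite !Cmod_mult Cmod_cis Rmult_1_r; apply: Rle_refl.
    rewrite -Rmult_assoc; apply: Rmult_le_compat_r; [exact: Cmod_ge_0 | exact: hM].
  have up r : 0 < r -> 0 <= (pt r al).2.
    by move=> r0; apply: Rmult_le_pos; [lra | apply: sin_ge_0; lra].
  have ba0 : 0 < b by lra.
  have [_ [ca _]] := cutoff_bounds N0 (up a a0) (@pt_neq0 a al a0).
  have [_ [_ [cb _]]] := cutoff_bounds N0 (up b ba0) (@pt_neq0 b al ba0).
  rewrite Cmod_pt in ca; last lra.
  rewrite Cmod_pt in cb; last lra.
  rewrite /Rdiv iba in cb.
  have := Rmult_le_compat_l M _ _ M0 ca; have := Rmult_le_compat_l M _ _ M0 cb.
  have := bnd a a0; have := bnd b ba0; lra.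
have pc2 : 2 * N * M * a * (al2 - al1) <= eps.
  apply: (Rle_trans _ (2 * N * M * d * PI)).
    have h : 0 <= 2 * N * M by apply: Rmult_le_pos; lra.
    rewrite !Rmult_assoc; do 3! (apply: Rmult_le_compat_l; first lra).
    by apply: Rmult_le_compat; rewrite /a; lra.
  have : d * K <= eps.
    by apply: (Rle_trans _ (eps / K * K)); [apply: Rmult_le_compat_r; lra | apply: Req_le; field; lra].
  rewrite /K; lra.
apply: (Rle_trans _ (3 * eps)); last lra.
apply: Rabs_le; move: k1 k2 (Rle_trans _ _ _ pc pc2).
by move=> /Rabs_le_between ? /Rabs_le_between ? /Rabs_le_between ?; lra.
Qed.

(** * Clifford multiplication *)

Section Signs.
Context (n : nat).
Implicit Types A B C : {set 'I_n}.

Lemma in_symdiff i A B : (i \in symdiff A B) = (i \in A) (+) (i \in B).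
Proof. by rewrite !inE; case: (i \in A); case: (i \in B). Qed.

Lemma symdiffC A B : symdiff A B = symdiff B A.
Proof. by apply/setP => i; rewrite !in_symdiff addbC. Qed.
Lemma symdiffK A B : symdiff A (symdiff A B) = B.
Proof. by apply/setP => i; rewrite !in_symdiff addbA addbb. Qed.
Lemma symdiff0 A : symdiff A set0 = A.
Proof. by apply/setP => i; rewrite !in_symdiff inE addbF. Qed.
Lemma symdiffv A : symdiff A A = set0.
Proof. by apply/setP => i; rewrite in_symdiff inE addbb. Qed.
Lemma symdiff_inj A : injective (symdiff A).
Proof. exact: can_inj (symdiffK A). Qed.
Lemma symdiff_eq A B C : (symdiff A B == C) = (B == symdiff A C).
Proof. by apply/eqP/eqP => [<-|->]; rewrite symdiffK. Qed.

Lemma sgn_sq k : (-1) ^ k * (-1) ^ k = 1.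
Proof. by rewrite -Rpow_mult_distr (_ : -1 * -1 = 1) ?pow1 //; ring. Qed.

(** The cardinal of a symmetric difference has the parity of the sum of the cardinals, since the
    intersection is counted twice. *)
Lemma sgn_card (T : finType) (X Y Z : {set T}) :
  (forall x, (x \in Z) = (x \in X) (+) (x \in Y)) ->
  (-1) ^ #|Z| = (-1) ^ #|X| * (-1) ^ #|Y|.
Proof.
move=> h.
have eX : #|X| = addn #|X :\: Y| #|X :&: Y| by rewrite -(cardsID Y X) addnC.
have eY : #|Y| = addn #|Y :\: X| #|X :&: Y| by rewrite -(cardsID X Y) addnC setIC.
have eZ : #|Z| = addn #|X :\: Y| #|Y :\: X|.
  have -> : Z = (X :\: Y) :|: (Y :\: X).
    by apply/setP => x; rewrite h !inE; case: (x \in X); case: (x \in Y).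
  rewrite cardsU (_ : _ :&: _ = set0) ?cards0 ?subn0 //.
  by apply/setP => x; rewrite !inE; case: (x \in X); case: (x \in Y).
have pD a b : (-1) ^ (addn a b) = (-1) ^ a * (-1) ^ b by exact: pow_add.
rewrite eX eY eZ !pD.
have := sgn_sq #|X :&: Y|; set u := _ ^ #|X :&: Y|; set v := _ ^ _; set w := _ ^ _ => hu.
by transitivity (v * w * (u * u)); [rewrite hu; ring | ring].
Qed.

(** The pairs counted for [symdiff B C] form the symmetric difference of those counted for [B] and
    for [C]. With the mirror statement below, [cl_sign] is bimultiplicative. *)
Lemma cl_signDr A B C : cl_sign A (symdiff B C) = cl_sign A B * cl_sign A C.
Proof.
apply: sgn_card => -[i j]; rewrite !inE /= -in_setD -in_setD -in_setU -/(symdiff B C).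
by rewrite in_symdiff; case: (i \in A); case: (j \in B); case: (j \in C); case: leq.
Qed.
Lemma cl_signDl A B C : cl_sign (symdiff A B) C = cl_sign A C * cl_sign B C.
Proof.
apply: sgn_card => -[i j]; rewrite !inE /= -in_setD -in_setD -in_setU -/(symdiff A B).
by rewrite in_symdiff; case: (i \in A); case: (i \in B); case: (j \in C); case: leq.
Qed.
Lemma cl_sign0l A : cl_sign set0 A = 1.
Proof.
rewrite /cl_sign (_ : [set p in _ | _] = set0) ?cards0 //.
by apply/setP => -[i j]; rewrite !inE.
Qed.
Lemma cl_sign1 (i j : 'I_n) : cl_sign [set i] [set j] = if leq j i then -1 else 1.
Proof.
rewrite /cl_sign; case: ifP => h.
- rewrite (_ : [set p in _ | _] = [set (i, j)]) ?cards1 ?pow_1 //.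
  apply/setP => -[a b]; rewrite !inE xpair_eqE /=.
  by case: eqP => [->|] //=; case: eqP => [->|] //=; rewrite h.
- rewrite (_ : [set p in _ | _] = set0) ?cards0 //.
  apply/setP => -[a b]; rewrite !inE /=.
  by case: eqP => [->|] //=; case: eqP => [->|] //=; rewrite h.
Qed.
Lemma cl_sign_abs A B : Rabs (cl_sign A B) = 1.
Proof. by rewrite /cl_sign -RPow_abs Rabs_Ropp Rabs_R1 pow1. Qed.
End Signs.

Ltac rring := apply: Rminus_diag_uniq; ring.

Ltac symd := apply/setP => ?; rewrite !in_symdiff; repeat case: (_ \in _) => //.

Section Components.
Context (n : nat) (V : NormedModule R_AbsRing).
Implicit Types (a b : clifford n) (u v w : clmod n V) (A B C : {set 'I_n}).

Lemma scal_sum (I : Type) (r : seq I) (P : pred I) (k : R) (F : I -> V) :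
  scal k (\big[plus/zero]_(i <- r | P i) F i) = \big[plus/zero]_(i <- r | P i) scal k (F i).
Proof. by apply: big_morph => [x y|]; [apply: scal_distr_l | apply: scal_zero_r]. Qed.

Lemma sum_scal (I : Type) (r : seq I) (P : pred I) (F : I -> R) (x : V) :
  scal (\big[Rplus/0]_(i <- r | P i) F i) x = \big[plus/zero]_(i <- r | P i) scal (F i) x.
Proof. by apply: (big_morph (fun k : R => scal k x)) => [k l|]; [apply: (@scal_distr_r R_Ring) | apply: (@scal_zero_l R_Ring)]. Qed.

Lemma cl_lmulE a v C : (cl_lmul a v : clmod n V) C =
  \big[plus/zero]_(A : {set 'I_n}) scal (cl_sign A (symdiff A C) * a A) (v (symdiff A C)).
Proof.
rewrite ffunE -(pair_big_dep xpredT (fun A B => symdiff A B == C)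
  (fun A B => scal (cl_sign A B * a A) (v B))) /=.
apply: eq_bigr => A _; rewrite (big_pred1 (symdiff A C)) // => B.
by rewrite /= symdiff_eq.
Qed.

Lemma cl_rmulE v a C : (cl_rmul v a : clmod n V) C =
  \big[plus/zero]_(B : {set 'I_n}) scal (cl_sign (symdiff B C) B * a B) (v (symdiff B C)).
Proof.
rewrite ffunE -(pair_big_dep xpredT (fun A B => symdiff A B == C)
  (fun A B => scal (cl_sign A B * a B) (v A))) /= (exchange_big_dep xpredT) //=.
apply: eq_bigr => B _; rewrite (big_pred1 (symdiff B C)) // => A.
by rewrite /= symdiffC symdiff_eq.
Qed.

End Components.

Section Bimodule.
Context (n : nat) (V : NormedModule R_AbsRing).
Implicit Types (a b : clifford n) (u v w : clmod n V) (A B C : {set 'I_n}).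

(** Reindexing by the symmetric difference reduces associativity to a cocycle identity between
    signs, which bimultiplicativity turns into a ring identity. *)
Lemma cl_lmulA a b v : cl_lmul a (cl_lmul b v) = cl_lmul (cl_mul a b) v.
Proof.
apply/ffunP => C; rewrite !cl_lmulE.
transitivity (\big[plus/zero]_A \big[plus/zero]_D
    scal (cl_sign D (symdiff D C) * (cl_sign A (symdiff A D) * a A * b (symdiff A D)))
      (v (symdiff D C))).
  apply: eq_bigr => A _; rewrite cl_lmulE scal_sum [RHS](reindex_inj (@symdiff_inj n A)).
  apply: eq_bigr => B _; rewrite scal_assoc symdiffK /mult /=.
  have -> : symdiff B (symdiff A C) = symdiff (symdiff A B) C.
    by symd.
  congr scal; set E := symdiff (symdiff A B) C.
  have -> : symdiff A C = symdiff B E by rewrite /E; symd.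
  rewrite cl_signDr cl_signDl; rring.
rewrite exchange_big; apply: eq_bigr => D _ /=; rewrite (@cl_lmulE n R_NormedModule) -sum_scal.
congr scal; elim: (index_enum _) => [|A r IH]; first by rewrite !big_nil /zero /=; rring.
by rewrite !big_cons IH /plus /scal /= /mult /=; rring.
Qed.

Lemma cl_lrmul a v b : cl_rmul (cl_lmul a v) b = cl_lmul a (cl_rmul v b).
Proof.
apply/ffunP => C; rewrite cl_rmulE cl_lmulE.
transitivity (\big[plus/zero]_B \big[plus/zero]_A
   scal (cl_sign (symdiff B C) B * b B * (cl_sign A (symdiff A (symdiff B C)) * a A))
     (v (symdiff A (symdiff B C)))).
  apply: eq_bigr => B _; rewrite cl_lmulE scal_sum; apply: eq_bigr => A _.
  by rewrite scal_assoc.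
rewrite exchange_big; apply: eq_bigr => A _ /=; rewrite cl_rmulE scal_sum.
apply: eq_bigr => B _; rewrite scal_assoc /mult /=.
have -> : symdiff A (symdiff B C) = symdiff B (symdiff A C) by symd.
congr scal; set E := symdiff B (symdiff A C).
have e1 : symdiff B C = symdiff A E by rewrite /E; symd.
have e2 : symdiff A C = symdiff B E by rewrite /E; symd.
clearbody E; rewrite e1 e2 cl_signDr cl_signDl; rring.
Qed.

Lemma cl_lmulD a u v : cl_lmul a (plus u v) = plus (cl_lmul a u) (cl_lmul a v).
Proof.
apply/ffunP => C; rewrite [RHS]ffunE !cl_lmulE -big_split; apply: eq_bigr => A _.
by rewrite ffunE scal_distr_l.
Qed.
Lemma cl_lmulZ a (k : R) v : cl_lmul a (scal k v) = scal k (cl_lmul a v).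
Proof.
apply/ffunP => C; rewrite [RHS]ffunE !cl_lmulE scal_sum; apply: eq_bigr => A _.
by rewrite ffunE !scal_assoc /mult /= Rmult_comm.
Qed.
Lemma cl_lmulDl a b v : cl_lmul (plus a b) v = plus (cl_lmul a v) (cl_lmul b v).
Proof.
apply/ffunP => C; rewrite [RHS]ffunE !cl_lmulE -big_split; apply: eq_bigr => A _.
rewrite ffunE (_ : _ * plus (a A) (b A) =
    plus (cl_sign A (symdiff A C) * a A) (cl_sign A (symdiff A C) * b A)).
  by rewrite (@scal_distr_r R_Ring).
by rewrite /plus /=; rring.
Qed.
Lemma cl_lmulZl (k : R) a v : cl_lmul (scal k a) v = scal k (cl_lmul a v).
Proof.
apply/ffunP => C; rewrite [RHS]ffunE !cl_lmulE scal_sum; apply: eq_bigr => A _.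
by rewrite ffunE scal_assoc; congr scal; rewrite /scal /= /mult /=; rring.
Qed.
Lemma cl_rmulD u v a : cl_rmul (plus u v) a = plus (cl_rmul u a) (cl_rmul v a).
Proof.
apply/ffunP => C; rewrite [RHS]ffunE !cl_rmulE -big_split; apply: eq_bigr => A _.
by rewrite ffunE scal_distr_l.
Qed.
Lemma cl_rmulZ (k : R) v a : cl_rmul (scal k v) a = scal k (cl_rmul v a).
Proof.
apply/ffunP => C; rewrite [RHS]ffunE !cl_rmulE scal_sum; apply: eq_bigr => A _.
by rewrite ffunE !scal_assoc /mult /= Rmult_comm.
Qed.

Lemma cl_lmul_unit0 v : cl_lmul (cl_unit set0) v = v.
Proof.
apply/ffunP => C; rewrite cl_lmulE (bigD1 set0) //= big1 => [|A /negbTE A0].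
  rewrite plus_zero_r cl_sign0l symdiffC symdiff0 ffunE eqxx.
  by rewrite Rmult_1_r (@scal_one R_Ring).
by rewrite ffunE A0 Rmult_0_r (@scal_zero_l R_Ring).
Qed.

Lemma cl_lmul_real x v : cl_lmul (cl_real n x) v = scal x v.
Proof. by rewrite cl_lmulZl cl_lmul_unit0. Qed.

Definition card_index : R := INR (size (index_enum {set 'I_n})).

Lemma norm_sum (I : Type) (r : seq I) (F : I -> V) :
  norm (\big[plus/zero]_(i <- r) F i) <= \big[Rplus/0]_(i <- r) norm (F i).
Proof.
elim: r => [|i r IH]; first by rewrite !big_nil norm_zero; apply: Rle_refl.
by rewrite !big_cons; apply: Rle_trans (norm_triangle _ _) _; lra.
Qed.

Lemma mul_component_le (k : R) (a : clifford n) A B C v : Rabs k = 1 ->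
  norm (scal (k * a A) (v B)) <= norm a * norm v.
Proof.
move=> k1; apply: Rle_trans (norm_scal _ _) _.
apply: Rmult_le_compat; [exact: Rabs_pos | exact: norm_ge_0 | | exact: cm_norm_component].
by rewrite /abs /= Rabs_mult k1 Rmult_1_l; apply: (cm_norm_component (V := R_NormedModule) a A).
Qed.

Lemma cl_lmul_le a v : norm (cl_lmul a v) <= card_index * card_index * norm a * norm v.
Proof.
apply: Rle_trans (cm_norm_le_sum _) _.
apply: (Rle_trans _ (\big[Rplus/0]_(C : {set 'I_n}) (card_index * (norm a * norm v)))).
  apply: sumR_le => C; rewrite cl_lmulE; apply: Rle_trans (norm_sum _ _) _.
  rewrite /card_index -sumR_const; apply: sumR_le => A.
  by apply: mul_component_le => //; apply: cl_sign_abs.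
rewrite sumR_const; change (INR _) with card_index; apply: Req_le; ring.
Qed.
Lemma cl_rmul_le a v : norm (cl_rmul v a) <= card_index * card_index * norm a * norm v.
Proof.
apply: Rle_trans (cm_norm_le_sum _) _.
apply: (Rle_trans _ (\big[Rplus/0]_(C : {set 'I_n}) (card_index * (norm a * norm v)))).
  apply: sumR_le => C; rewrite cl_rmulE; apply: Rle_trans (norm_sum _ _) _.
  rewrite /card_index -sumR_const; apply: sumR_le => A.
  by apply: mul_component_le => //; apply: cl_sign_abs.
rewrite sumR_const; change (INR _) with card_index; apply: Req_le; ring.
Qed.

Lemma cl_lmul_linear a : is_linear (fun v : cm_NormedModule n V => cl_lmul a v : cm_NormedModule n V).
Proof.
split; [exact: cl_lmulD | exact: cl_lmulZ |].
have h : 0 <= card_index * card_index * norm a.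
  by apply: Rmult_le_pos; [have := pos_INR (size (index_enum {set 'I_n})); rewrite /card_index; nra | apply: norm_ge_0].
exists (card_index * card_index * norm a + 1); split; first lra.
by move=> v; apply: Rle_trans (cl_lmul_le a v) _; have := norm_ge_0 (v : cm_NormedModule n V); nra.
Qed.
Lemma cl_rmul_linear a : is_linear (fun v : cm_NormedModule n V => cl_rmul v a : cm_NormedModule n V).
Proof.
split; [by move=> *; exact: cl_rmulD | by move=> *; exact: cl_rmulZ |].
have h : 0 <= card_index * card_index * norm a.
  by apply: Rmult_le_pos; [have := pos_INR (size (index_enum {set 'I_n})); rewrite /card_index; nra | apply: norm_ge_0].
exists (card_index * card_index * norm a + 1); split; first lra.
by move=> v; apply: Rle_trans (cl_rmul_le a v) _; have := norm_ge_0 (v : cm_NormedModule n V); nra.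
Qed.

Definition bl_lmul a : bounded_map n V := Blin (cl_lmul_linear a).
Definition bl_rmul a : bounded_map n V := Blin (cl_rmul_linear a).
End Bimodule.

Section ImaginaryUnits.
Context (n : nat).
Implicit Types (J : clifford n) (A B C : {set 'I_n}).

Lemma sumR_eq_plus (I : Type) (r : seq I) (F : I -> R) :
  \big[Rplus/0]_(i <- r) F i = \big[@plus R_AbelianMonoid/zero]_(i <- r) F i.
Proof. by []. Qed.

Lemma cl_norm_sq (a : clifford n) : (norm a) ^ 2 = \big[Rplus/0]_(A : {set 'I_n}) (a A) ^ 2.
Proof.
have h0 : 0 <= \big[Rplus/0]_(A : {set 'I_n}) norm (a A) ^ 2.
  by apply: sumR_ge0 => A; apply: pow2_ge_0.
have -> : norm a = sqrt (\big[Rplus/0]_(A : {set 'I_n}) norm (a A) ^ 2) by [].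
rewrite pow2_sqrt //.
elim: (index_enum _) => [|A r IH]; rewrite ?big_nil // !big_cons IH; congr Rplus.
by rewrite /norm /= /abs /= !Rmult_1_r -Rabs_mult Rabs_pos_eq //; apply: Rle_0_sqr.
Qed.

(** The diagonal terms give [- (norm J) ^ 2]. In a component [C] other than the empty set, passing
    from [A] to [symdiff C A] exchanges two distinct units, which anticommute, so the sum equals its
    own opposite. *)
Lemma imag_unit_sq J : imag_unit J -> cl_mul J J = cl_real n (-1).
Proof.
move=> [pJ [J0 nJ]]; apply/ffunP => C; rewrite (cl_lmulE (V := R_NormedModule)).
have Jset A : J A <> 0 -> exists i, A = [set i].
  move=> hA; apply/cards1P; apply/eqP.
  case e : #|A| => [|[|k]] //; last by case: hA; apply: pJ; rewrite e.
  by case: hA; move/eqP: e; rewrite cards_eq0 => /eqP ->.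
have signA A : J A <> 0 -> cl_sign A A = -1.
  by move=> /Jset [i ->]; rewrite cl_sign1 leqnn.
rewrite ffunE ffunE; case: eqP => [->|/eqP C0].
- rewrite /scal /= /mult /=.
  transitivity (\big[Rplus/0]_(A : {set 'I_n}) ((J A) ^ 2 * (-1))).
    apply: eq_bigr => A _; rewrite symdiff0.
    case: (Req_dec (J A) 0) => [->|/signA ->]; rewrite /scal /= /mult /=; rring.
  by rewrite sumR_mulr -cl_norm_sq nJ; rring.
- rewrite /scal /= /mult /= Rmult_0_r.
  set S := \big[_/_]_A _.
  suff : S = - S by move=> e; have : S = 0 by lra.
  rewrite {1}/S (reindex_inj (@symdiff_inj n C)) /=.
  have opp_sum (F : {set 'I_n} -> R) (r : seq {set 'I_n}) :
      - (\big[Rplus/0]_(A <- r) F A) = \big[Rplus/0]_(A <- r) (- F A).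
    by elim: r => [|A r IH]; rewrite ?big_nil ?big_cons -?IH; rring.
  rewrite /S [X in - X]sumR_eq_plus opp_sum.
  apply: eq_bigr => A _.
  have -> : symdiff (symdiff C A) C = A by symd.
  rewrite (symdiffC C A).
  case: (Req_dec (J A) 0) => [->|/Jset [i Ai]]; first by rewrite /scal /= /mult /=; rring.
  case: (Req_dec (J (symdiff A C)) 0) => [->|/Jset [j Bj]]; first by rewrite /scal /= /mult /=; rring.
  rewrite Bj Ai !cl_sign1; have ij : i <> j.
    by move=> e; move: C0; rewrite -(symdiffK A C) Bj Ai e symdiffv eqxx.
  rewrite /scal /= /mult /=.
  have : (i : nat) <> j by move=> /val_inj.
  by case: (ltngtP i j) => // _ _; rring.
Qed.
End ImaginaryUnits.

(** * Stem functions *)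

Lemma cm_plusE n (V : NormedModule R_AbsRing) (u v : clmod n V) A :
  (plus u v : clmod n V) A = plus (u A) (v A).
Proof. by rewrite ffunE. Qed.
Lemma cm_scalE n (V : NormedModule R_AbsRing) (k : R) (u : clmod n V) A :
  (scal k u : clmod n V) A = scal k (u A).
Proof. by rewrite ffunE. Qed.

Section Slices.
Context (n : nat).
Implicit Types (J s : clifford n) (z w : C).

Definition slice z J : clifford n := slice_pt z.1 z.2 J.

Lemma sliceE z J A : slice z J A = (if A == set0 then z.1 else 0) + z.2 * J A.
Proof.
rewrite /slice /slice_pt !ffunE /plus /scal /= /mult /=; congr Rplus.
by case: eqP => _; ring.
Qed.

Lemma cl_sign0r (A : {set 'I_n}) : cl_sign A set0 = 1.
Proof.
rewrite /cl_sign (_ : [set p in _ | _] = set0) ?cards0 //.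
by apply/setP => -[i j]; rewrite !inE andbF.
Qed.

Lemma slice_set0 z J : imag_unit J -> slice z J set0 = z.1.
Proof. by move=> [_ [J0 _]]; rewrite sliceE eqxx J0; ring. Qed.

Lemma imag_unit_opp J : imag_unit J -> imag_unit (opp J).
Proof.
move=> [pJ [J0 nJ]]; split; [|split].
- by move=> A hA; rewrite ffunE pJ // /opp /= Ropp_0.
- by rewrite ffunE J0 /opp /= Ropp_0.
- by rewrite norm_opp.
Qed.

(** The hypothesis [1 <= n] enters through the existence of a plane [C_J]. *)
Lemma imag_unit_exists : (1 <= n)%nat -> exists J : clifford n, imag_unit J.
Proof.
case: n => // m _; pose i : 'I_m.+1 := ord0; exists (cl_unit [set i]).
have h A : A != [set i] -> (cl_unit [set i] : clifford m.+1) A = 0.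
  by rewrite ffunE => /negbTE ->.
split; [|split].
- by move=> A hA; apply: h; apply/eqP => e; rewrite e cards1 in hA.
- by apply: h; apply/eqP => /setP /(_ i); rewrite !inE eqxx.
- rewrite -(sqrt_pow2 (norm _)); last exact: norm_ge_0.
  rewrite cl_norm_sq (_ : \big[Rplus/0]_A _ = 1) ?sqrt_1 //.
  have key (r : seq {set 'I_m.+1}) : uniq r ->
      \big[Rplus/0]_(A <- r) (cl_unit [set i] A : R) ^ 2 = if [set i] \in r then 1 else 0.
    elim: r => [|B r IH] /=; first by rewrite big_nil.
    move=> /andP [Br ur]; rewrite big_cons IH // in_cons ffunE.
    rewrite (eq_sym [set i] B); case: eqP => [Be|_] /=; last by case: (_ \in r); rring.
    by rewrite -Be (negbTE Br); rring.
  by rewrite key ?index_enum_uniq // mem_index_enum.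
Qed.

Lemma slice_paravector z J : imag_unit J -> paravector (slice z J).
Proof.
move=> [pJ _] A hA; rewrite sliceE pJ //; case: eqP => [e|_]; last by ring.
by rewrite e cards0 in hA.
Qed.

Lemma sumR_plus (I : Type) (r : seq I) (F G : I -> R) :
  \big[Rplus/0]_(i <- r) (F i + G i) = \big[Rplus/0]_(i <- r) F i + \big[Rplus/0]_(i <- r) G i.
Proof. by elim: r => [|i r IH]; rewrite ?big_nil ?big_cons ?IH; ring. Qed.

Lemma slice_norm_sq z J : imag_unit J -> (norm (slice z J)) ^ 2 = z.1 ^ 2 + z.2 ^ 2.
Proof.
move=> [_ [J0 nJ]]; rewrite cl_norm_sq.
have := cl_norm_sq J; rewrite nJ => nJ2.
have key (r : seq {set 'I_n}) : uniq r -> \big[Rplus/0]_(A <- r) (slice z J A) ^ 2 =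
    (if set0 \in r then z.1 ^ 2 else 0) + \big[Rplus/0]_(A <- r) (J A) ^ 2 * z.2 ^ 2.
  elim: r => [|B r IH] /=; first by move=> _; rewrite !big_nil; ring.
  move=> /andP [Br ur]; rewrite !big_cons IH // in_cons sliceE (eq_sym B).
  case: eqP => [e|_] /=; last by ring.
  by rewrite -e in Br *; rewrite (negbTE Br) J0; ring.
rewrite key ?index_enum_uniq // mem_index_enum -nJ2; ring.
Qed.

Lemma slice_norm z J : imag_unit J -> norm (slice z J) = Cmod z.
Proof.
move=> hJ; rewrite -(sqrt_pow2 (norm _)); last exact: norm_ge_0.
by rewrite slice_norm_sq.
Qed.

Lemma slice_conj z J : imag_unit J -> para_conj (slice z J) = slice (Cconj z) J.
Proof.
move=> [_ [J0 _]]; apply/ffunP => A; rewrite ffunE !sliceE /=.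
by case: eqP => [->|_]; rewrite ?J0; ring.
Qed.

Lemma slice_plus z w J : plus (slice z J) (slice w J) = slice (z + w)%C J.
Proof.
by apply/ffunP => A; rewrite ffunE !sliceE /plus /=; case: eqP => _; rring.
Qed.
Lemma slice_scal (k : R) z J : scal k (slice z J) = slice (RtoC k * z)%C J.
Proof.
by apply/ffunP => A; rewrite ffunE !sliceE /scal /= /mult /=; case: eqP => _; rring.
Qed.
Lemma slice_real (x : R) J : cl_real n x = slice (RtoC x) J.
Proof.
apply/ffunP => A; rewrite sliceE !ffunE /scal /= /mult /=; case: eqP => _; rring.
Qed.

Lemma slice_lmul (V : NormedModule R_AbsRing) z J (v : clmod n V) :
  cl_lmul (slice z J) v = plus (scal z.1 v) (scal z.2 (cl_lmul J v)).
Proof. by rewrite /slice /slice_pt cl_lmulDl cl_lmul_real cl_lmulZl. Qed.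

Lemma imag_unit_lmul2 (V : NormedModule R_AbsRing) J (v : clmod n V) :
  imag_unit J -> cl_lmul J (cl_lmul J v) = opp v.
Proof.
move=> hJ; rewrite cl_lmulA imag_unit_sq // cl_lmul_real.
by rewrite -[RHS](@scal_opp_one R_Ring).
Qed.

Lemma cl_mul_unit0r (a : clifford n) : cl_mul a (cl_unit set0) = a.
Proof.
apply/ffunP => C; rewrite (cl_lmulE (V := R_NormedModule)).
rewrite (reindex_inj (can_inj (fun B => symdiffK C B))) (bigD1 set0) //= big1 => [|B /negbTE B0].
  rewrite plus_zero_r symdiff0 symdiffv ffunE eqxx /scal /= /mult /=.
  by rewrite (_ : cl_sign C set0 = 1) ?Rmult_1_l ?Rmult_1_r // cl_sign0r.
have -> : symdiff (symdiff C B) C = B by symd.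
by rewrite ffunE B0 scal_zero_r.
Qed.

(** For fixed [J] the map [slice] embeds the complex numbers as an algebra, so powers, inverses and
    the regularizer on [C_J] become complex arithmetic. *)
Lemma slice_mul z w J : imag_unit J -> cl_mul (slice z J) (slice w J) = slice (z * w)%C J.
Proof.
move=> hJ; have e : cl_lmul J (slice w J) = plus (scal w.1 J) (scal w.2 (cl_real n (-1))) :> clifford n.
  by rewrite /slice /slice_pt cl_lmulD cl_lmulZ (imag_unit_sq hJ) /cl_real cl_lmulZ cl_mul_unit0r.
rewrite (slice_lmul z J (slice w J)) e.
apply/ffunP => A; rewrite sliceE !cm_plusE !cm_scalE sliceE.
rewrite /cl_real ?cm_scalE ?ffunE /plus /scal /= /mult /=; case: eqP => _; rring.
Qed.

Lemma cl_pow_slice z J k : imag_unit J -> cl_pow (slice z J) k = slice (Cpow z k) J.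
Proof.
move=> hJ; elim: k => [|k IH]; first by rewrite /= -(slice_real 1 J).
by rewrite /= IH slice_mul.
Qed.

Lemma para_inv_slice z J : imag_unit J -> para_inv (slice z J) = slice (/ z)%C J.
Proof.
move=> hJ; rewrite /para_inv slice_norm_sq // slice_conj // slice_scal.
by congr slice; rewrite /Cinv /Cconj /Cmult /=; congr pair; rewrite /Rdiv; ring.
Qed.

Definition regz (k : nat) z : C := (Cpow z k / Cpow (1 + z * z) k)%C.

Lemma regularizer_slice k z J : imag_unit J -> regularizer k (slice z J) = slice (regz k z) J.
Proof.
move=> hJ; rewrite /regularizer cl_pow_slice // (slice_real 1 J) cl_pow_slice //.
rewrite slice_plus cl_pow_slice // para_inv_slice // slice_mul //.
by congr slice; rewrite /regz /Cdiv /= Cmult_1_r.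
Qed.

Lemma polar_slice r al J : polar r al J = slice (pt r al) J.
Proof. by []. Qed.
Lemma polar_slice1 al J : polar 1 al J = slice (cis al) J.
Proof. by rewrite polar_slice /pt !Rmult_1_l. Qed.
End Slices.

(* [D_th] and the sector between the rays at [om] and [PI - om], in Cartesian form. *)
Definition Dth (th : R) (z : C) : Prop := (cos th) ^ 2 * (z.1 ^ 2 + z.2 ^ 2) < z.1 ^ 2.
Definition Sig (om : R) (z : C) : Prop :=
  0 < z.2 /\ z.1 ^ 2 < (cos om) ^ 2 * (z.1 ^ 2 + z.2 ^ 2).

Section Regions.
Context (th : R) (hth : 0 < th < PI / 2).

Lemma angle_set_cos al : angle_set th al -> (cos th) ^ 2 < (cos al) ^ 2.
Proof.
have PI0 := PI_RGT_0.
have c0 : 0 < cos th by apply: cos_gt_0; lra.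
have key b : - th < b < th -> (cos th) ^ 2 < (cos b) ^ 2.
  move=> hb; have : cos th < cos b.
    case: (Rle_dec 0 b) => b0; first by apply: cos_decreasing_1; lra.
    by rewrite -(cos_neg b); apply: cos_decreasing_1; lra.
  by move=> h /=; nra.
case=> [/key //|h].
have -> : cos al ^ 2 = cos (al - PI) ^ 2.
  by rewrite {1}(_ : al = (al - PI) + PI) ?neg_cos /=; ring.
by apply: key; lra.
Qed.

Lemma Dth_pt r al : 0 < r -> angle_set th al -> Dth th (pt r al).
Proof.
move=> r0 /angle_set_cos h; rewrite /Dth /=.
have := sin2_cos2 al; rewrite /Rsqr => sc.
have -> : r * cos al * (r * cos al * 1) + r * sin al * (r * sin al * 1) = r * r.
  transitivity (r * r * (sin al * sin al + cos al * cos al)); [ring | by rewrite sc; ring].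
have : 0 < r * r by apply: Rmult_lt_0_compat.
move: h => /=; nra.
Qed.

Lemma Dth_polar z : Dth th z -> exists r al, 0 < r /\ angle_set th al /\ z = pt r al.
Proof.
have PI0 := PI_RGT_0.
have c0 : 0 < cos th by apply: cos_gt_0; lra.
have pos (x y : R) : 0 < x -> (cos th) ^ 2 * (x ^ 2 + y ^ 2) < x ^ 2 ->
    exists r al, 0 < r /\ - th < al < th /\ x = r * cos al /\ y = r * sin al.
  move=> x0 hz; set al := atan (y / x).
  have := atan_bound (y / x); rewrite -/al => -[a1 a2].
  have ca : 0 < cos al by apply: cos_gt_0; lra.
  have ta : sin al = y / x * cos al.
    by have := tan_atan (y / x); rewrite /tan -/al => <-; field; lra.
  exists (x / cos al), al; split; first exact: Rdiv_lt_0_compat.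
  split; last by rewrite ta; split; field; lra.
  have sc : cos al * cos al * (x ^ 2 + y ^ 2) = x ^ 2.
    have := sin2_cos2 al; rewrite /Rsqr ta => sc.
    transitivity (x ^ 2 * (y / x * cos al * (y / x * cos al) + cos al * cos al)).
      by field; lra.
    by rewrite sc; ring.
  have cc : cos th < cos al.
    apply: Rnot_le_lt => h.
    have : cos al * cos al * (x ^ 2 + y ^ 2) <= cos th ^ 2 * (x ^ 2 + y ^ 2).
      by apply: Rmult_le_compat_r; [have := pow2_ge_0 x; have := pow2_ge_0 y; lra | rewrite /=; nra].
    by rewrite sc; lra.
  split.
  - case: (Rlt_dec (- th) al) => // h.
    have : cos (- al) <= cos th by apply: cos_decr_1; lra.
    by rewrite cos_neg; lra.
  - case: (Rlt_dec al th) => // h.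
    have : cos al <= cos th by apply: cos_decr_1; lra.
    by lra.
case: z => x y; rewrite /Dth /= => hz.
case: (Rlt_le_dec 0 x) => x0.
  have [|r [al [r0 [hal [e1 e2]]]]] := pos x y x0; first by rewrite /=; lra.
  by exists r, al; split=> //; split; [left | rewrite /pt -e1 -e2].
have x1 : 0 < - x.
  case: (Req_dec x 0) => e; last lra.
  by rewrite e in hz; have := pow2_ge_0 (cos th); have := pow2_ge_0 y; move=> /=; nra.
have [|r [al [r0 [hal [e1 e2]]]]] := pos (- x) (- y) x1; first by rewrite /=; nra.
exists r, (al + PI); split=> //; split; first by right; lra.
by rewrite /pt neg_cos neg_sin; congr pair; lra.
Qed.

Lemma double_sector_slice (n : nat) z (J : clifford n) : imag_unit J -> Dth th z ->
  double_sector th (slice z J).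
Proof. by move=> hJ /Dth_polar [r [al [r0 [hal ->]]]]; exists r, J, al. Qed.

(** The polar form may use another unit [J'], but [Dth] involves only the norm and the real part,
    and these do not depend on the unit. *)
Lemma slice_double_sector (n : nat) z (J : clifford n) : imag_unit J ->
  double_sector th (slice z J) -> Dth th z.
Proof.
move=> hJ [r [J' [al [r0 [hJ' [hal e]]]]]].
have := Dth_pt r0 hal; rewrite /Dth -(slice_norm_sq z hJ) e polar_slice.
rewrite (slice_norm_sq _ hJ') -(slice_set0 (pt r al) hJ') -polar_slice -e.
by rewrite (slice_set0 z hJ).
Qed.

Lemma locally_Dth z : Dth th z -> locally (z : R * R) (Dth th).
Proof.
move=> hz; rewrite /Dth in hz.
pose k (p : R * R) := p.1 * p.1 - (cos th) ^ 2 * (p.1 * p.1 + p.2 * p.2).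
have c1 : continuous (fun p : R * R => p.1) z by case: (z) => a b; apply: continuous_fst.
have c2 : continuous (fun p : R * R => p.2) z by case: (z) => a b; apply: continuous_snd.
have m1 := continuous_mult _ _ _ c1 c1; have m2 := continuous_mult _ _ _ c2 c2.
have m3 := continuous_plus (V := R_NormedModule) _ _ _ m1 m2.
have m4 := continuous_mult _ _ _ (continuous_const ((cos th) ^ 2) z) m3.
have /filterlim_locally ck : continuous k z.
  exact: (continuous_minus (V := R_NormedModule) _ _ _ m1 m4).
have k0 : 0 < k z by rewrite /k; move: hz => /=; lra.
apply: filter_imp (ck (mkposreal _ k0)) => w /ball_R /= /Rabs_def2 [_ h].
by rewrite /Dth /=; rewrite /k /= in h; lra.
Qed.

Lemma Dth_conj z : Dth th z -> Dth th (Cconj z).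
Proof.
by rewrite /Dth /Cconj /= (_ : - z.2 * (- z.2 * 1) = z.2 * (z.2 * 1)) //; ring.
Qed.
End Regions.

(* The stem function [F = f0 + i f1] of the slice function [f = f0 + f1 J], split
   into its Clifford components [F A : C -> C]. *)
Definition stem_re n (F : {set 'I_n} -> C -> C) (z : C) : clifford n := [ffun A => (F A z).1].
Definition stem_im n (F : {set 'I_n} -> C -> C) (z : C) : clifford n := [ffun A => (F A z).2].

(** [sd_conj] is the even-odd condition on [f0] and [f1]. Integrability is stated through a majorant
    because [F] is controlled only through the values of [f] at [J] and [- J]. *)
Record slice_data n (th : R) (f : clifford n -> clifford n) (F : {set 'I_n} -> C -> C) : Prop :=
  SliceData {
    sd_val : forall z J, Dth th z -> imag_unit J ->
      f (slice z J) = plus (stem_re F z) (cl_mul (stem_im F z) J);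
    sd_holo : forall A, holo (Dth th) (F A);
    sd_conj : forall A z, Dth th z -> F A (Cconj z) = Cconj (F A z);
    sd_bound : exists M, forall A z, Dth th z -> Cmod (F A z) <= M;
    sd_int : forall A al, angle_set th al -> exists g L, improper g L /\
      forall r, 0 < r -> Cmod (F A (pt r al)) / r <= g r }.

Lemma Cmod_le_sum (z : C) : Cmod z <= Rabs z.1 + Rabs z.2.
Proof.
have h1 := Rabs_pos z.1; have h2 := Rabs_pos z.2.
rewrite -(sqrt_square (Rabs z.1 + Rabs z.2)); last lra.
apply: sqrt_le_1_alt; rewrite -(pow2_abs z.1) -(pow2_abs z.2) /=; nra.
Qed.

Lemma ccont_locally_lt (k : R * R -> R) (z : C) eps : continuous k z -> 0 < eps ->
  locally (z : R * R) (fun w => Rabs (k w - k z) < eps).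
Proof.
by move=> /filterlim_locally h e0; apply: filter_imp (h (mkposreal _ e0)) => w /ball_R.
Qed.

Lemma Cminus_neq0 (w z : C) : w <> z -> (w - z)%C <> 0%C.
Proof. by move=> nw e; apply: nw; have -> : w = ((w - z) + z)%C; [ring | rewrite e; ring]. Qed.

(** The partial derivatives give a real differential, which by the Cauchy-Riemann equations is
    multiplication by the complex number [px + i qx]. *)
Lemma holo_of_CR (D : C -> Prop) (p px py q qx qy : R -> R -> R) :
  (forall z, D z -> locally (z : R * R) D) ->
  (forall z, D z -> is_derive (fun t => p t z.2) z.1 (px z.1 z.2) /\
     is_derive (fun t => p z.1 t) z.2 (py z.1 z.2) /\
     continuous (fun w : R * R => px w.1 w.2) z) ->
  (forall z, D z -> is_derive (fun t => q t z.2) z.1 (qx z.1 z.2) /\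
     is_derive (fun t => q z.1 t) z.2 (qy z.1 z.2) /\
     continuous (fun w : R * R => qx w.1 w.2) z) ->
  (forall z, D z -> px z.1 z.2 = qy z.1 z.2 /\ py z.1 z.2 = - qx z.1 z.2) ->
  holo D (fun z => (p z.1 z.2, q z.1 z.2)).
Proof.
move=> oD hp hq CR; exists (fun z => (px z.1 z.2, qx z.1 z.2)) => z Dz; split; last first.
  by split=> /=; [case: (hp z Dz) => _ [_] | case: (hq z Dz) => _ [_]].
have [e1 e2] := CR z Dz; case: z Dz e1 e2 => x y Dz /= e1 e2.
have fp : filterdiff (fun u : R * R => p u.1 u.2) (locally (x, y))
    (fun u => plus (scal u.1 (px x y)) (scal u.2 (py x y))).
  have [_ [h2 h3]] := hp _ Dz; apply: is_derive_filterdiff => //.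
  by apply: filter_imp (oD _ Dz) => u /hp [].
have fq : filterdiff (fun u : R * R => q u.1 u.2) (locally (x, y))
    (fun u => plus (scal u.1 (qx x y)) (scal u.2 (qy x y))).
  have [_ [h2 h3]] := hq _ Dz; apply: is_derive_filterdiff => //.
  by apply: filter_imp (oD _ Dz) => u /hq [].
set z : C := (x, y); set l : C := (px x y, qx x y).
pose F (w : C) : C := (p w.1 w.2, q w.1 w.2).
have dom eps : 0 < eps -> locally (z : R * R)
    (fun w => Cmod (F w - F z - l * (w - z))%C <= eps * Cmod (w - z)%C).
  move=> e0; have e2' : 0 < eps / 2 by lra.
  have fz : is_filter_lim (locally (x, y)) (x, y) by [].
  have := proj2 fp _ fz (mkposreal _ e2'); have := proj2 fq _ fz (mkposreal _ e2').
  move=> h1 h2; apply: filter_imp (filter_and _ _ h1 h2) => -[u v] /= [k1 k2].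
  have nz : @norm _ (prod_NormedModule R_AbsRing R_NormedModule R_NormedModule) (minus (u, v) (x, y))
      = Cmod ((u, v) - z)%C.
    rewrite /norm /= /prod_norm /Cmod /= /norm /= /abs /= /minus /plus /opp /=.
    by congr sqrt; congr Rplus; rewrite !Rmult_1_r -Rabs_mult Rabs_pos_eq //; apply: Rle_0_sqr.
  rewrite nz in k1 k2.
  apply: Rle_trans (Cmod_le_sum _) _.
  have -> : eps * Cmod ((u, v) - z)%C = eps / 2 * Cmod ((u, v) - z)%C + eps / 2 * Cmod ((u, v) - z)%C by field.
  apply: Rplus_le_compat.
  - apply: Rle_trans (k2); apply: Req_le; rewrite /norm /= /abs /= /minus /plus /opp /scal /= /mult /= e2.
    by congr Rabs; ring.
  - apply: Rle_trans (k1); apply: Req_le; rewrite /norm /= /abs /= /minus /plus /opp /scal /= /mult /= -e1.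
    by congr Rabs; ring.
(* The difference quotient, completed at [z] by the expected derivative; the estimate [dom] is
   exactly its continuity there. *)
pose Phi (w : C) : C := if Ceq_dec w z then l else ((F w - F z) / (w - z))%C.
have Phiz : Phi z = l by rewrite /Phi; case: (Ceq_dec z z).
have close eps : 0 < eps -> locally (z : R * R) (fun w => Cmod (Phi w - l)%C <= eps).
  move=> e0; apply: filter_imp (dom eps e0) => w; rewrite /Phi; case: (Ceq_dec w z) => [e|nw] h.
    by rewrite (_ : (l - l)%C = 0%C) ?Cmod_0; [lra | ring].
  have wz := Cminus_neq0 nw.
  have -> : ((F w - F z) / (w - z) - l)%C = ((F w - F z - l * (w - z)) / (w - z))%C by field.
  rewrite Cmod_div //; have w0 : 0 < Cmod (w - z)%C by apply/Cmod_gt_0.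
  apply: (Rmult_le_reg_r (Cmod (w - z)%C)) => //.
  by rewrite /Rdiv Rmult_assoc Rinv_l; lra.
exists Phi; split; last split=> //.
- split; apply/filterlim_locally => eps; have e0 := cond_pos eps; have h0 := close (eps / 2) ltac:(have := cond_pos eps; lra).
  + apply: filter_imp (h0) => w h; apply/ball_R.
    rewrite Phiz; apply: Rle_lt_trans (fst_le_Cmod (Phi w - l)%C) _; lra.
  + apply: filter_imp (h0) => w h; apply/ball_R.
    rewrite Phiz; apply: Rle_lt_trans (im_le_Cmod (Phi w - l)%C) _; lra.
- apply: filter_forall => w; rewrite -/(F w) -/(F z) /Phi; case: (Ceq_dec w z) => [e|nw] /=.
    by rewrite e; ring.
  have wz := Cminus_neq0 nw.
  by field.
Qed.

(** With [a = f(x + J y)] and [b = f(x - J y)], the stem is recovered as [f0 = (a + b) / 2] and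
    [f1 = (b - a) J / 2]. Boundedness and integrability pass from [f] to [F] through these two
    formulas. *)
Lemma SH_R0_slice_data n (th : R) (f : clifford n -> clifford n) : (1 <= n)%nat ->
  0 < th < PI / 2 -> SH_R0 th f -> exists F, slice_data th f F.
Proof.
move=> n1 hth [[f0 [f0x [f0y [f1 [f1x [f1y [h0 [h1 hf]]]]]]]] [[M hM] hI]].
have [J0 hJ0] := imag_unit_exists n1.
have sd (z : C) : Dth th z -> slice_dom (fun s : clifford n => double_sector th s) (z.1, z.2).
  by move=> hz J hJ; apply: double_sector_slice.
pose F (A : {set 'I_n}) (z : C) : C := (f0 z.1 z.2 A, f1 z.1 z.2 A).
have proj A : is_linear (fun u : cm_NormedModule n R_NormedModule => (u A : R_NormedModule)).
  split; [by move=> u v; rewrite cm_plusE | by move=> k u; rewrite cm_scalE |].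
  exists 1; split; first lra.
  by move=> u; rewrite Rmult_1_l; apply: cm_norm_component.
have der A (g : R -> clifford n) t l : is_derive g t l -> is_derive (fun s => g s A) t (l A).
  move=> hg; have h := filterdiff_comp _ _ _ _ hg (filterdiff_linear _ (proj A)).
  by apply: (filterdiff_ext_lin _ _ _ (h _)) => y; rewrite cm_scalE.
have con A (g : R * R -> clifford n) z : continuous g z -> continuous (fun w => g w A) z.
  by move=> cg; apply: (continuous_comp g (fun u : cm_NormedModule n R_NormedModule => (u A : R_NormedModule))) => //;
     apply: linear_cont; apply: proj.
have val z J : Dth th z -> imag_unit J -> f (slice z J) = plus (f0 z.1 z.2) (cl_mul (f1 z.1 z.2) J).
  by move=> hz hJ; have [h _] := hf _ _ (sd z hz); apply: h.
have eF z : stem_re F z = f0 z.1 z.2 /\ stem_im F z = f1 z.1 z.2.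
  by split; apply/ffunP => A; rewrite ffunE.
have bnd : exists K, 0 <= K /\ forall z J A, Dth th z -> imag_unit J ->
    Cmod (F A z) <= K * (norm (f (slice z J)) + norm (f (slice z (opp J)))).
  have ci : 0 <= card_index n := pos_INR _.
  set k := card_index n * card_index n; have k0 : 0 <= k by apply: Rmult_le_pos.
  exists (1 + k); split; first lra.
  move=> z J A hz hJ; have v1 := val z J hz hJ; have v2 := val z (opp J) hz (imag_unit_opp hJ).
  set a := f (slice z J) in v1 *; set b := f (slice z (opp J)) in v2 *.
  have bJ : cl_mul (f1 z.1 z.2) (opp J) = opp (cl_mul (f1 z.1 z.2) J).
    by rewrite -(@scal_opp_one R_Ring) cl_lmulZ (@scal_opp_one R_Ring).
  rewrite bJ in v2.
  have e0 : f0 z.1 z.2 = scal (/2) (plus a b) :> cm_NormedModule n R_NormedModule.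
    rewrite v1 v2; vecf.
  have e1 : f1 z.1 z.2 = scal (/2) (cl_mul (minus b a) J) :> cm_NormedModule n R_NormedModule.
    have -> : minus b a = scal (-2) (cl_mul (f1 z.1 z.2) J) :> cm_NormedModule n R_NormedModule.
      by rewrite v1 v2; vec.
    rewrite cl_lmulZl -(cl_lmulA (f1 z.1 z.2) J J) imag_unit_sq // /cl_real cl_lmulZ cl_mul_unit0r.
    by vecf.
  have na := norm_ge_0 (a : cm_NormedModule n R_NormedModule).
  have nb := norm_ge_0 (b : cm_NormedModule n R_NormedModule).
  have half (u : cm_NormedModule n R_NormedModule) : norm (scal (/2) u) <= /2 * norm u.
    have := norm_scal (/2) u; rewrite {1}/abs /= Rabs_pos_eq; [by [] | lra].
  have n0 : norm (f0 z.1 z.2) <= norm a + norm b.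
    rewrite e0; apply: Rle_trans (half _) _; have h := norm_triangle a b.
    by apply: (Rle_trans _ (/2 * (norm a + norm b))); [apply: Rmult_le_compat_l; [lra | exact: h] | lra].
  have n2 : norm (f1 z.1 z.2) <= k * (norm a + norm b).
    rewrite e1; apply: Rle_trans (half _) _.
    have h := cl_lmul_le (minus b a) (J : clmod n R_NormedModule).
    have nJ : norm J = 1 by case: hJ => _ [].
    rewrite nJ Rmult_1_r in h.
    have h2 : norm (minus b a) <= norm b + norm a by rewrite -(norm_opp a); apply: norm_triangle.
    have h3 := Rmult_le_compat_l k _ _ k0 h2.
    apply: (Rle_trans _ (/2 * (k * (norm b + norm a)))).
      by apply: Rmult_le_compat_l; [lra | apply: Rle_trans h _; exact: h3].
    have : 0 <= k * (norm b + norm a) by apply: Rmult_le_pos; lra.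
    rewrite (Rplus_comm (norm a)); lra.
  apply: Rle_trans (Cmod_le_sum _) _ => /=.
  have c0 := cm_norm_component (f0 z.1 z.2 : clmod n R_NormedModule) A.
  have c1 := cm_norm_component (f1 z.1 z.2 : clmod n R_NormedModule) A.
  rewrite Rmult_plus_distr_r Rmult_1_l.
  by apply: Rplus_le_compat; [apply: Rle_trans c0 n0 | apply: Rle_trans c1 n2].
have [K [K0 hK]] := bnd.
exists F; split.
- by move=> z J hz hJ; rewrite (val z J hz hJ); case: (eF z) => -> ->.
- move=> A; apply: (@holo_of_CR _ (fun x y => f0 x y A) (fun x y => f0x x y A) (fun x y => f0y x y A)
    (fun x y => f1 x y A) (fun x y => f1x x y A) (fun x y => f1y x y A)).
  + exact: locally_Dth.
  + move=> z hz; have [d1 [d2 [c1 _]]] := h0 _ _ (sd z hz).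
    split; [exact: der d1 | split; [exact: der d2 |]].
    by have := con A _ _ c1; rewrite -surjective_pairing.
  + move=> z hz; have [d1 [d2 [c1 _]]] := h1 _ _ (sd z hz).
    split; [exact: der d1 | split; [exact: der d2 |]].
    by have := con A _ _ c1; rewrite -surjective_pairing.
  + move=> z hz; have [_ [_ [_ [-> ->]]]] := hf _ _ (sd z hz).
    by split=> //; rewrite ffunE.
- move=> A z hz; have [_ [e1 [e2 _]]] := hf _ _ (sd z hz).
  by rewrite /F /Cconj /= e1 e2 ffunE.
- exists (K * (M + M)) => A z hz; apply: Rle_trans (hK z J0 A hz hJ0) _.
  apply: Rmult_le_compat_l => //; apply: Rplus_le_compat; apply: hM.
    exact: double_sector_slice.
  by apply: double_sector_slice => //; apply: imag_unit_opp.
- move=> A al hal.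
  have [L1 hL1] := hI J0 al hJ0 hal; have [L2 hL2] := hI (opp J0) al (imag_unit_opp hJ0) hal.
  exists (fun r => K * (norm (f (polar r al J0)) / r + norm (f (polar r al (opp J0))) / r)), (K * (L1 + L2)).
  split; first by have := improper_scal K (improper_plus hL1 hL2).
  move=> r r0; have := hK (pt r al) J0 A (Dth_pt hth r0 hal) hJ0.
  rewrite -!polar_slice => h; rewrite /Rdiv -Rmult_plus_distr_r -Rmult_assoc.
  by apply: Rmult_le_compat_r => //; apply: Rlt_le; apply: Rinv_0_lt_compat.
Qed.

(** The factor [e] takes values in [C_J] on each plane [C_J], so it commutes with [J] and can be
    absorbed into the stem: the product has stem [F S z * E z], with the Clifford units still on the
    left. *)
Lemma slice_data_mul n (th : R) (f e : clifford n -> clifford n) (F : {set 'I_n} -> C -> C)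
    (E : C -> C) (K : R) :
  slice_data th f F ->
  (forall z J, Dth th z -> imag_unit J -> e (slice z J) = slice (E z) J) ->
  holo (Dth th) E -> (forall z, Dth th z -> E (Cconj z) = Cconj (E z)) ->
  (forall z, Dth th z -> Cmod (E z) <= K) -> 0 < th < PI / 2 ->
  slice_data th (fun s => cl_mul (f s) (e s)) (fun A z => (F A z * E z)%C).
Proof.
move=> hF he hE cE bE hth; split.
- move=> z J hz hJ; rewrite (sd_val hF hz hJ) (he z J hz hJ).
  have -> : slice (E z) J = plus (cl_real n (E z).1) (scal (E z).2 J) by [].
  rewrite cl_lmulD cl_lmulZ /cl_real cl_lmulZ cl_mul_unit0r cl_lmulDl.
  rewrite -(cl_lmulA (stem_im F z) J J) (imag_unit_sq hJ) /cl_real cl_lmulZ cl_mul_unit0r.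
  have -> : stem_re (fun A z => (F A z * E z)%C) z =
      minus (scal (E z).1 (stem_re F z)) (scal (E z).2 (stem_im F z)) :> cm_NormedModule n R_NormedModule.
    by apply/ffunP => A; rewrite /minus !ffunE /plus /opp /scal /= /mult /=; ring.
  have -> : stem_im (fun A z => (F A z * E z)%C) z =
      plus (scal (E z).2 (stem_re F z)) (scal (E z).1 (stem_im F z)) :> cm_NormedModule n R_NormedModule.
    by apply/ffunP => A; rewrite !ffunE /plus /opp /scal /= /mult /=; ring.
  rewrite cl_lmulDl !cl_lmulZl.
  apply/ffunP => A; rewrite /minus !ffunE /plus /opp /scal /= /mult /=; ring.
- by move=> A; apply: holo_mult hE; apply: sd_holo hF A.
- by move=> A z hz; rewrite (sd_conj hF A hz) cE // /Cconj /Cmult /=; congr pair; ring.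
- have [M hM] := sd_bound hF; exists (M * K) => A z hz; rewrite Cmod_mult.
  by apply: Rmult_le_compat; [exact: Cmod_ge_0 | exact: Cmod_ge_0 | exact: hM | exact: bE].
- move=> A al hal; have [g [L [hL hg]]] := sd_int hF A hal.
  exists (fun r => K * g r), (K * L); split; first by have := improper_scal K hL.
  move=> r r0; rewrite Cmod_mult; have := hg r r0; have := bE _ (Dth_pt hth r0 hal).
  have k := Cmod_ge_0 (E (pt r al)); have k2 := Cmod_ge_0 (F A (pt r al)).
  move=> h1 h2; rewrite (_ : _ / r = Cmod (E (pt r al)) * (Cmod (F A (pt r al)) / r)); last by rewrite /Rdiv; ring.
  apply: Rmult_le_compat => //; apply: Rmult_le_pos => //.
  by apply: Rlt_le; apply: Rinv_0_lt_compat.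
Qed.

(** * Resolvents *)

Section BlinComp.
Context (U V W : NormedModule R_AbsRing).
Lemma bl_comp_linear (f : blin V W) (g : blin U V) : is_linear (fun x => f (g x)).
Proof. exact: is_linear_comp (blin_linear g) (blin_linear f). Qed.
Definition bl_comp (f : blin V W) (g : blin U V) : blin U W := Blin (bl_comp_linear f g).
Lemma bl_comp_le (f : blin V W) (g : blin U V) : norm (bl_comp f g) <= norm f * norm g.
Proof.
apply: bl_norm_le; first by apply: Rmult_le_pos; apply: norm_ge_0.
move=> x; apply: Rle_trans (bl_norm_apply f (g x)) _; rewrite Rmult_assoc.
by apply: Rmult_le_compat_l; [apply: norm_ge_0 | apply: bl_norm_apply].
Qed.
End BlinComp.

Section ContinuityNorm.
Context (U : UniformSpace) (E : NormedModule R_AbsRing).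

Lemma continuous_norm_lt (f : U -> E) z : continuous f z ->
  forall eps, 0 < eps -> locally z (fun w => norm (minus (f w) (f z)) < eps).
Proof.
move=> /filterlim_locally h eps e0.
have k0 := @norm_factor_gt_0 _ E.
have d0 : 0 < eps / @norm_factor _ E by apply: Rdiv_lt_0_compat.
apply: filter_imp (h (mkposreal _ d0)) => x /norm_compat2 /=.
by rewrite (_ : norm_factor * _ = eps) //; field; lra.
Qed.

Lemma norm_lt_continuous (f : U -> E) z :
  (forall eps, 0 < eps -> locally z (fun w => norm (minus (f w) (f z)) < eps)) ->
  continuous f z.
Proof.
move=> h; apply/filterlim_locally => eps.
by apply: filter_imp (h eps (cond_pos eps)) => w; apply: norm_compat1.
Qed.

End ContinuityNorm.

Section Continuity.
Context (U : UniformSpace) (E F : NormedModule R_AbsRing).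

Lemma continuous_blin (phi : blin E F) (f : U -> E) z : continuous f z ->
  continuous (fun w => phi (f w)) z.
Proof.
by move=> cf; apply: (continuous_comp f phi) => //; apply: linear_cont; apply: blin_linear.
Qed.

Lemma continuous_apply (X : U -> blin E F) (u : U -> E) z : continuous X z -> continuous u z ->
  continuous (fun w => X w (u w)) z.
Proof.
move=> cX cu; apply: norm_lt_continuous => eps e0.
set M := norm (X z) + norm (u z) + 1.
have nX := norm_ge_0 (X z); have nu := norm_ge_0 (u z).
have M0 : 1 <= M by rewrite /M; lra.
have e1 : 0 < eps / (2 * M) by apply: Rdiv_lt_0_compat; lra.
have e2 : 0 < Rmin 1 (eps / (2 * M)) by apply: Rmin_pos; lra.
apply: filter_imp (filter_and _ _ (continuous_norm_lt cX e1) (continuous_norm_lt cu e2)) => w [h1 h2].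
have h3 := Rlt_le_trans _ _ _ h2 (Rmin_l _ _); have {}h2 := Rlt_le_trans _ _ _ h2 (Rmin_r _ _).
have -> : minus (X w (u w)) (X z (u z)) =
    plus ((minus (X w) (X z) : blin E F) (u w)) (X z (minus (u w) (u z))).
  by rewrite bl_minusE blB; vec.
apply: Rle_lt_trans (norm_triangle _ _) _.
have k1 := bl_norm_apply (minus (X w) (X z)) (u w).
have k2 := bl_norm_apply (X z) (minus (u w) (u z)).
have k3 : norm (u w) <= norm (u z) + 1.
  have -> : u w = plus (minus (u w) (u z)) (u z) by vec.
  by apply: Rle_trans (norm_triangle _ _) _; lra.
have p1 : norm (minus (X w) (X z)) * norm (u w) <= eps / (2 * M) * (norm (u z) + 1).
  by apply: Rmult_le_compat; try exact: norm_ge_0; try exact: Rlt_le; exact: k3.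
have p2 : norm (X z) * norm (minus (u w) (u z)) <= norm (X z) * (eps / (2 * M)).
  by apply: Rmult_le_compat_l => //; apply: Rlt_le.
apply: Rle_lt_trans (Rplus_le_compat _ _ _ _ (Rle_trans _ _ _ k1 p1) (Rle_trans _ _ _ k2 p2)) _.
have -> : eps / (2 * M) * (norm (u z) + 1) + norm (X z) * (eps / (2 * M)) = eps / 2.
  by rewrite (_ : norm (u z) + 1 = M - norm (X z)); [field; lra | rewrite /M; ring].
lra.
Qed.
End Continuity.
Arguments continuous_blin [U E F] phi [f z] _.

Section Resolvent.
Context (n : nat) (VR : NormedModule R_AbsRing) (T : operator n VR).
Context (linT : right_linear_op T).
Notation V := (cm_NormedModule n VR).
Notation Bd := (bounded_map n VR).
Implicit Types (a b c u v w : V) (z : C).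

Lemma cl_realE x (A : {set 'I_n}) : cl_real n x A = if A == set0 then x else 0.
Proof. by rewrite !ffunE /scal /= /mult /=; case: eqP => _; rring. Qed.

Lemma cl_rmul_real x v : cl_rmul v (cl_real n x) = scal x v.
Proof.
apply/ffunP => C; rewrite cl_rmulE (bigD1 set0) //= big1 => [|A /negbTE A0].
  by rewrite plus_zero_r symdiffC symdiff0 cl_sign0r Rmult_1_l cl_realE eqxx [RHS]ffunE.
by rewrite cl_realE A0 Rmult_0_r (@scal_zero_l R_Ring).
Qed.

(** Real homogeneity is right multiplication by a real Clifford number. *)
Lemma opT_scal (k : R) v w : T v w -> T (scal k v) (scal k w).
Proof. by move=> h; rewrite -!cl_rmul_real; apply: (op_rmul linT). Qed.

Lemma opT_plus v v' w w' : T v w -> T v' w' -> T (plus v v') (plus w w').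
Proof. exact: (op_plus linT). Qed.

Lemma opT_fun v w w' : T v w -> T v w' -> w = w'.
Proof. exact: (op_functional linT). Qed.

(** The graph of [Q_s[T]] with the compositions unfolded. Only [x] and [x^2 + y^2] occur, so it
    depends neither on [J] nor on the sign of [y]. *)
Definition Qrel z a v : Prop := exists b c, T a b /\ T b c /\
  v = plus (minus c (scal (2 * z.1) b)) (scal (z.1 ^ 2 + z.2 ^ 2) a).

Lemma Qop_slice z J a v : imag_unit J -> Qop (slice z J) T a v <-> Qrel z a v.
Proof.
move=> hJ; rewrite /Qop /op_add /op_sub /op_comp /op_cl slice_set0 // slice_norm_sq //; split.
- move=> [p [q [[c [b' [[b [h1 h2]] [[b2 [h3 ->]] ->]]]] [-> ->]]]].
  by exists b, c; rewrite !cl_lmul_real (opT_fun h3 h1).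
- move=> [b [c [h1 [h2 ->]]]]; exists (minus c (scal (2 * z.1) b)), (scal (z.1 ^ 2 + z.2 ^ 2) a).
  rewrite !cl_lmul_real; split=> //; exists c, (scal (2 * z.1) b); split; first by exists b.
  by split=> //; exists b; rewrite cl_lmul_real.
Qed.

Lemma Qrel_minus z a v a' v' : Qrel z a v -> Qrel z a' v' -> Qrel z (minus a a') (minus v v').
Proof.
move=> [b [c [h1 [h2 ->]]]] [b' [c' [h1' [h2' ->]]]].
have mT x y x' y' : T x y -> T x' y' -> T (minus x x') (minus y y').
  move=> k1 k2; rewrite /minus; apply: opT_plus => //.
  by have := opT_scal (opp (one : R_Ring)) k2; rewrite !scal_opp_one.
exists (minus b b'), (minus c c'); split; first exact: mT.
by split; [apply: mT | vec].
Qed.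

(* [A = Q_z^-1] and [B = T Q_z^-1]; [Q_z] depends only on the slice coordinate [z]. *)
Record res z (A B : Bd) : Prop := Res {
  res_rlA : right_linear A;
  res_rlB : right_linear B;
  res_TA : forall v, T (A v) (B v);
  res_TB : forall v, T (B v) (plus v (minus (scal (2 * z.1) (B v)) (scal (z.1 ^ 2 + z.2 ^ 2) (A v))));
  res_inv : forall a v, Qrel z a v -> a = A v }.

Lemma right_linear_lmul (a : clifford n) : right_linear (bl_lmul VR a).
Proof.
split; [by move=> v w; apply: cl_lmulD | by move=> v b /=; rewrite cl_lrmul].
Qed.

Lemma rl_zero : right_linear (zero : Bd).
Proof.
split; first by move=> v w /=; rewrite plus_zero_l.
by move=> v b /=; rewrite -(@scal_zero_l R_Ring _ (zero : V)) cl_rmulZ !(@scal_zero_l R_Ring).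
Qed.
Lemma rl_scal (k : R) (F : Bd) : right_linear F -> right_linear (scal k F).
Proof.
move=> [r1 r2]; split; first by move=> *; rewrite blD.
by move=> v b; rewrite !bl_scalE r2 cl_rmulZ.
Qed.
Lemma rl_plus (F G : Bd) : right_linear F -> right_linear G -> right_linear (plus F G).
Proof.
move=> [r1 r2] [r1' r2']; split; first by move=> *; rewrite blD.
by move=> v b; rewrite !bl_plusE r2 r2' cl_rmulD.
Qed.
Lemma rl_minus (F G : Bd) : right_linear F -> right_linear G -> right_linear (minus F G).
Proof.
move=> rF rG; apply: rl_plus => //.
by have := rl_scal (opp (one : R_Ring)) rG; rewrite scal_opp_one.
Qed.
Lemma rl_comp (F G : Bd) : right_linear F -> right_linear G -> right_linear (bl_comp F G).
Proof.
move=> [r1 r2] [r1' r2']; split; first by move=> *; rewrite blD.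
by move=> v b /=; rewrite r2' r2.
Qed.
Lemma rl_sum (I : Type) (r : seq I) (F : I -> Bd) : (forall i, right_linear (F i)) ->
  right_linear (\big[plus/zero]_(i <- r) F i).
Proof.
move=> h; elim: r => [|i r IH]; first by rewrite big_nil; apply: rl_zero.
by rewrite big_cons; apply: rl_plus.
Qed.

(* [Q_z^-1 v = (S_L(conj s) - S_L(s)) u] with [u = (s - conj s)^-1 v]. *)
Lemma resolvent_of_SL z J (F1 F2 : Bd) : imag_unit J -> z.2 <> 0 ->
  is_bounded_op (SL_inv (slice z J) T) F1 -> is_bounded_op (SL_inv (slice (Cconj z) J) T) F2 ->
  res z (bl_comp (scal (/ (2 * z.2)) (minus F2 F1)) (bl_lmul VR (opp J)))
        (minus (bl_comp (bl_comp (scal (/ (2 * z.2)) (minus F2 F1)) (bl_lmul VR (opp J)))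
                  (bl_lmul VR (slice (Cconj z) J))) F1).
Proof.
move=> hJ y0 [rl1 h1] [rl2 h2].
have Qc a v : Qrel (Cconj z) a v <-> Qrel z a v.
  have e : (Cconj z).1 ^ 2 + (Cconj z).2 ^ 2 = z.1 ^ 2 + z.2 ^ 2 by rewrite /Cconj /=; ring.
  by rewrite /Qrel e.
have z0 : z.1 ^ 2 + z.2 ^ 2 <> 0.
  by have := pow2_ge_0 z.1; have : 0 < z.2 ^ 2 by [have := pow2_gt_0 z.2 y0]; lra.
have cc : Cconj (Cconj z) = z by case: (z) => p q; rewrite /Cconj /= Ropp_involutive.
have SLE (F : Bd) (w : C) : (forall v x, SL_inv (slice w J) T v x <-> x = F v) -> forall v,
    exists a b u, Qrel w a (cl_lmul (slice (Cconj w) J) v) /\ Qrel w u v /\ T u b /\ F v = minus a b.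
  move=> h v; have /h [a [b [[x [-> ha]] [[u [hu hb]] e]]]] : F v = F v by [].
  exists a, b, u; rewrite slice_conj // in ha; split; first exact/(Qop_slice _ _ _ hJ).
  by split=> //; apply/(Qop_slice _ _ _ hJ).
have SLS (F : Bd) (w : C) : (forall v x, SL_inv (slice w J) T v x <-> x = F v) -> forall v a b u,
    Qrel w a (cl_lmul (slice (Cconj w) J) v) -> Qrel w u v -> T u b -> F v = minus a b.
  move=> h v a b u k1 k2 k3; symmetry; apply/h; exists a, b; split.
    exists (cl_lmul (slice (Cconj w) J) v); rewrite slice_conj //; split=> //.
    exact/(Qop_slice _ _ _ hJ).
  by split=> //; exists u; split=> //; apply/(Qop_slice _ _ _ hJ).
(* Choose [v0] with [conj(s) v0 = v]. Any solution [a] of [Q_z a = v] then satisfies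
   [S_L^-1(s) v0 = a - T Q_z^-1 v0], and single-valuedness of [S_L^-1] determines [a]. *)
have inj a a' v : Qrel z a v -> Qrel z a' v -> a = a'.
  move=> k1 k2; pose v0 := cl_lmul (slice (/ Cconj z)%C J) v.
  have ev : cl_lmul (slice (Cconj z) J) v0 = v.
    rewrite /v0 cl_lmulA slice_mul // (_ : (Cconj z * / Cconj z)%C = RtoC 1).
      by rewrite -slice_real cl_lmul_real (@scal_one R_Ring).
    by apply: Cinv_r => e; apply: z0; rewrite -cc e /Cconj /=; ring.
  have [x [b [u [_ [hu [hb _]]]]]] := SLE _ _ h1 v0.
  rewrite -ev in k1 k2.
  have e1 := SLS _ _ h1 _ _ _ _ k1 hu hb; have e2 := SLS _ _ h1 _ _ _ _ k2 hu hb.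
  have -> : a = plus (F1 v0) b by rewrite e1; vec.
  by rewrite e2; vec.
set A := bl_comp _ (bl_lmul VR (opp J)).
(* In [S_L^-1(conj s) u - S_L^-1(s) u] the terms [T Q_z^-1 u] cancel and leave
   [Q_z^-1 (s - conj s) u]. Here [s - conj s = 2 y J], whose inverse is [- J / (2 y)]. *)
have QA v : Qrel z (A v) v.
  pose u := cl_lmul (slice (RtoC (/ (2 * z.2)) * - Ci)%C J) v.
  have eA : A v = minus (F2 u) (F1 u).
    change (scal (/ (2 * z.2)) ((minus F2 F1 : Bd) (cl_lmul (opp J) v)) = minus (F2 u) (F1 u)).
    rewrite bl_minusE /u -slice_scal cl_lmulZl !blZ.
    have -> : slice (- Ci)%C J = opp J by apply/ffunP => B; rewrite sliceE ffunE /opp /=; case: eqP => _; rring.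
    by vec.
  have [a1 [b1 [u1 [p1 [q1 [t1 e1]]]]]] := SLE _ _ h1 u.
  have [a2 [b2 [u2 [p2 [q2 [t2 e2]]]]]] := SLE _ _ h2 u.
  move: p2 q2 => /Qc p2 /Qc q2; rewrite cc in p2.
  rewrite -(inj _ _ _ q1 q2) in t2; rewrite -(opT_fun t1 t2) in e2.
  have -> : A v = minus a2 a1 by rewrite eA e1 e2; vec.
  have := Qrel_minus p2 p1.
  have -> // : minus (cl_lmul (slice z J) u) (cl_lmul (slice (Cconj z) J) u) = v :> V.
  have -> : cl_lmul (slice (Cconj z) J) u = opp (cl_lmul (slice (- Cconj z)%C J) u) :> V.
    have -> : slice (- Cconj z)%C J = scal (-1) (slice (Cconj z) J) by rewrite slice_scal; congr slice; ring.
    by rewrite cl_lmulZl; vec.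
  have -> : minus (cl_lmul (slice z J) u) (opp (cl_lmul (slice (- Cconj z)%C J) u)) =
      cl_lmul (slice (z - Cconj z)%C J) u :> V.
    by rewrite /Cminus -slice_plus cl_lmulDl; vec.
  rewrite /u cl_lmulA slice_mul // (_ : (_ * _)%C = RtoC 1).
    by rewrite -slice_real cl_lmul_real (@scal_one R_Ring).
  by case: (z) y0 => p q /= q0; rewrite /Cconj /Cmult /Cminus /Cplus /Copp /RtoC /Ci /=; congr pair; field.
set B := minus _ F1.
(* [B] is read off from [S_L^-1(s) = Q_z^-1 conj(s) - T Q_z^-1]. *)
have TAB v : T (A v) (B v).
  have [a1 [b1 [u1 [p1 [q1 [t1 e1]]]]]] := SLE _ _ h1 v.
  have -> : A v = u1 by apply: inj (QA v) q1.
  suff -> : B v = b1 by [].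
  have eA : A (cl_lmul (slice (Cconj z) J) v) = a1 by apply: inj p1; apply: QA.
  rewrite /B bl_minusE; change (minus (A (cl_lmul (slice (Cconj z) J) v)) (F1 v) = b1).
  by rewrite eA e1; vec.

have rlA : right_linear A.
  by apply: rl_comp; [apply: rl_scal; apply: rl_minus | apply: right_linear_lmul].
split=> //.
- by apply: rl_minus => //; apply: rl_comp => //; apply: right_linear_lmul.
- move=> v; have [b [c [k1 [k2 k3]]]] := QA v.
  rewrite (opT_fun (TAB v) k1) {1}k3.
  by rewrite (_ : plus _ _ = c) //; vec.
- by move=> a v ha; apply: inj ha (QA v).
Qed.
End Resolvent.

Section ResolventIdentities.
Context (n : nat) (VR : NormedModule R_AbsRing) (T : operator n VR).
Context (linT : right_linear_op T).
Notation V := (cm_NormedModule n VR).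
Notation Bd := (bounded_map n VR).
Implicit Types (a b c u v w : V).

Lemma opT_lin (k1 k2 : R) v1 w1 v2 w2 : T v1 w1 -> T v2 w2 ->
  T (plus (scal k1 v1) (scal k2 v2)) (plus (scal k1 w1) (scal k2 w2)).
Proof. by move=> h1 h2; apply: (opT_plus linT); apply: (opT_scal linT). Qed.

(** [T] commutes with [Q_z]: applied to [T Q_z^-1 v], the operator [Q_z] gives [T v], so [res_inv]
    identifies [B v] with [A w]. *)
Lemma res_commT (z : C) (A B : Bd) v w : res T z A B -> T v w -> B v = A w.
Proof.
move=> r h; apply: (res_inv r).
have hA := res_TA r v; have hB := res_TB r v.
exists (plus v (minus (scal (2 * z.1) (B v)) (scal (z.1 ^ 2 + z.2 ^ 2) (A v)))).
set c := plus v _ in hB *.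
exists (plus (scal 1 w) (scal 1 (plus (scal (2 * z.1) c) (scal (- (z.1 ^ 2 + z.2 ^ 2)) (B v))))).
split=> //; split; last by rewrite /c; vec.
have {1}-> : c = plus (scal 1 v) (scal 1 (plus (scal (2 * z.1) (B v)) (scal (- (z.1 ^ 2 + z.2 ^ 2)) (A v)))).
  by rewrite /c; vec.
apply: opT_lin => //; exact: opT_lin.
Qed.

Section TwoPoints.
Context (z w : C) (A B A' B' : Bd) (r : res T z A B) (r' : res T w A' B').

Lemma res_TAA v : T (A (A' v)) (A (B' v)).
Proof. by rewrite -(res_commT r (res_TA r' v)); apply: (res_TA r). Qed.

Lemma res_BA v : B (A' v) = A (B' v).
Proof. exact: (res_commT r (res_TA r' v)). Qed.

(* [A_z v = A_z Q_w A_w v] *)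
Lemma res_Al v : A v = plus (B (B' v)) (minus (scal (w.1 ^ 2 + w.2 ^ 2) (A (A' v)))
  (scal (2 * w.1) (A (B' v)))).
Proof.
have := res_commT r (res_TB r' v); rewrite /minus !(blD, blN, blZ) => ->; vec.
Qed.

Lemma res_AA v : A (A' v) = A' (A v).
Proof.
apply: (res_inv r'); exists (A (B' v)).
exists (A (plus v (minus (scal (2 * w.1) (B' v)) (scal (w.1 ^ 2 + w.2 ^ 2) (A' v))))).
split; first exact: res_TAA.
split; first by rewrite -(res_commT r (res_TB r' v)); apply: (res_TA r).
by rewrite /minus !(blD, blN, blZ); vec.
Qed.
End TwoPoints.

Section TwoPoints2.
Context (z w : C) (A B A' B' : Bd) (r : res T z A B) (r' : res T w A' B').

Lemma res_AB v : A (B' v) = A' (B v).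
Proof.
apply: (opT_fun linT (res_TAA r r' v)); rewrite (res_AA r r').
exact: (res_TAA r' r).
Qed.

Lemma res_BB v : B (B' v) = B' (B v).
Proof.
apply: (opT_fun linT (res_TA r (B' v))); rewrite res_AB; exact: (res_TA r' (B v)).
Qed.

Lemma res_Ar v : A' v = plus (B (B' v)) (minus (scal (z.1 ^ 2 + z.2 ^ 2) (A (A' v)))
  (scal (2 * z.1) (A (B' v)))).
Proof. by rewrite [LHS](res_Al r' r) -res_BB -(res_AA r r') -res_AB. Qed.

(** This is [Q_z^-1 - Q_w^-1 = Q_z^-1 (Q_w - Q_z) Q_w^-1], where [Q_w - Q_z] equals
    [2 (x_z - x_w) T] plus the difference of the squared moduli. *)
Lemma res_Adiff v : minus (A v) (A' v) = plus (scal (2 * (z.1 - w.1)) (A (B' v)))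
  (scal (w.1 ^ 2 + w.2 ^ 2 - (z.1 ^ 2 + z.2 ^ 2)) (A (A' v))).
Proof. have := res_Ar v; have := res_Al r r' v; move: (A v) (A' v) (B (B' v)) (A (B' v)) (A (A' v)) => ? ? ? ? ? -> ->; vec. Qed.

(** Apply [T] to both sides of [res_Adiff]; [T] is single-valued. *)
Lemma res_Bdiff v : minus (B v) (B' v) = plus (scal (2 * (z.1 - w.1)) (B (B' v)))
  (scal (w.1 ^ 2 + w.2 ^ 2 - (z.1 ^ 2 + z.2 ^ 2)) (A (B' v))).
Proof.
have e : plus (A v) (scal (-1) (A' v)) = plus (scal (2 * (z.1 - w.1)) (A (B' v)))
    (scal (w.1 ^ 2 + w.2 ^ 2 - (z.1 ^ 2 + z.2 ^ 2)) (A (A' v))).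
  by rewrite -res_Adiff; vec.
have h1 := opT_lin (2 * (z.1 - w.1)) (w.1 ^ 2 + w.2 ^ 2 - (z.1 ^ 2 + z.2 ^ 2))
  (res_TA r (B' v)) (res_TAA r r' v).
have h2 := opT_lin 1 (-1) (res_TA r v) (res_TA r' v).
rewrite -e (_ : plus (A v) _ = plus (scal 1 (A v)) (scal (-1) (A' v))) in h1; last by vec.
rewrite -(opT_fun linT h2 h1); vec.
Qed.
End TwoPoints2.

(* The functional [psi] applied to [R(z) v], where [R(z) = (z - T)^-1 = U - i W] on the
   complexification, [U = x A - B] and [W = y A]. *)
Definition rho (psi : blin V R_NormedModule) (A B : C -> Bd) v (z : C) : C :=
  (z.1 * psi (A z v) - psi (B z v), - (z.2 * psi (A z v))).

(* [psi (R(z) R(w) v)] *)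
Definition rho2 (psi : blin V R_NormedModule) (A B : C -> Bd) v (z w : C) : C :=
  ((z.1 * w.1 - z.2 * w.2) * psi (A z (A w v)) - (z.1 + w.1) * psi (A z (B w v)) + psi (B z (B w v)),
   (z.2 + w.2) * psi (A z (B w v)) - (z.1 * w.2 + z.2 * w.1) * psi (A z (A w v))).

(** This is [R(z) = R(w) - (z - w) R(z) R(w)], already in the form that [cderiv] asks for, so
    holomorphy only needs continuity of [rho2] in [z]. *)
Lemma resolvent_identity psi (A B : C -> Bd) v (z w : C) :
  res T z (A z) (B z) -> res T w (A w) (B w) ->
  rho psi A B v z = (rho psi A B v w + - rho2 psi A B v z w * (z - w))%C.
Proof.
move=> r r'.
have eA' := congr1 psi (res_Ar r r' v); have eA := congr1 psi (res_Al r r' v).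
have eB := congr1 psi (res_Bdiff r r' v).
move: eA' eA eB; rewrite /minus !(blD, blN, blZ) /plus /opp /scal /= /mult /= => eA' eA eB.
rewrite /rho /rho2 /Cplus /Cmult /Copp /Cminus /=.
have {}eB : psi (B z v) = psi (B w v) + (2 * (z.1 - w.1) * psi (B z (B w v)) +
   (w.1 * (w.1 * 1) + w.2 * (w.2 * 1) - (z.1 * (z.1 * 1) + z.2 * (z.2 * 1))) * psi (A z (B w v))).
  by rewrite /= in eB; lra.
by congr pair; rewrite ?eB ?eA ?eA'; ring.
Qed.
End ResolventIdentities.

Lemma Cmod_sq (z : C) : Cmod z * Cmod z = z.1 ^ 2 + z.2 ^ 2.
Proof. by apply: sqrt_sqrt; have := pow2_ge_0 z.1; have := pow2_ge_0 z.2; lra. Qed.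

Lemma Sig_pos ph z : Sig ph z -> 0 < Cmod z.
Proof.
move=> [h _]; apply/Cmod_gt_0 => e; rewrite e /= in h; lra.
Qed.

Lemma Sig_im ph z : 0 < ph < PI / 2 -> Sig ph z -> sin ph * Cmod z <= z.2.
Proof.
move=> hph [y0 h]; have s0 : 0 < sin ph by apply: sin_gt_0; lra.
apply: Rnot_lt_le => k; have k2 : z.2 ^ 2 < (sin ph * Cmod z) ^ 2 by rewrite /=; nra.
have sc := sin2_cos2 ph; rewrite /Rsqr in sc.
have e : (sin ph * Cmod z) ^ 2 = sin ph * sin ph * (z.1 ^ 2 + z.2 ^ 2) by rewrite -Cmod_sq; ring.
have e2 : sin ph * sin ph = 1 - cos ph ^ 2 by rewrite -sc; ring.
by rewrite e e2 in k2; lra.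
Qed.

Lemma cos_sq_lt a b : 0 < a -> a < b -> b < PI - a -> cos b ^ 2 < cos a ^ 2.
Proof.
move=> a0 ab bP; have PI0 := PI_RGT_0.
have h1 : cos b < cos a by apply: cos_decreasing_1; lra.
have h2 : - cos a < cos b.
  rewrite -(cos_neg a) -neg_cos; apply: cos_decreasing_1; lra.
by rewrite /=; nra.
Qed.

Lemma Sig_pt ph r al : 0 < ph -> 0 < r -> ph < al < PI - ph -> Sig ph (pt r al).
Proof.
move=> ph0 r0 [h1 h2]; split=> /=.
  by apply: Rmult_lt_0_compat => //; apply: sin_gt_0; lra.
have h := cos_sq_lt ph0 h1 h2.
have := sin2_cos2 al; rewrite /Rsqr => sc.
have -> : r * cos al * (r * cos al * 1) + r * sin al * (r * sin al * 1) = r * r.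
  transitivity (r * r * (sin al * sin al + cos al * cos al)); [ring | by rewrite sc; ring].
have : 0 < r * r by apply: Rmult_lt_0_compat.
move: h => /=; nra.
Qed.

Lemma locally_Sig ph z : Sig ph z -> locally (z : R * R) (Sig ph).
Proof.
move=> [y0 hz].
pose k (p : R * R) := (cos ph) ^ 2 * (p.1 * p.1 + p.2 * p.2) - p.1 * p.1.
have c1 : continuous (fun p : R * R => p.1) z by case: (z) => a b; apply: continuous_fst.
have c2 : continuous (fun p : R * R => p.2) z by case: (z) => a b; apply: continuous_snd.
have m1 := continuous_mult _ _ _ c1 c1; have m2 := continuous_mult _ _ _ c2 c2.
have m3 := continuous_plus (V := R_NormedModule) _ _ _ m1 m2.
have m4 := continuous_mult _ _ _ (continuous_const ((cos ph) ^ 2) z) m3.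
have ck : continuous k z by exact: (continuous_minus (V := R_NormedModule) _ _ _ m4 m1).
have k0 : 0 < k z by rewrite /k; move: hz => /=; lra.
apply: filter_imp (filter_and _ _ (ccont_locally_lt ck k0) (ccont_locally_lt c2 y0)) => w [].
move=> /Rabs_def2 [_ h1] /Rabs_def2 [_ h2]; split; first by lra.
by rewrite /=; rewrite /k /= in h1; lra.
Qed.

Lemma Sig_not_Dth ph z : Sig ph z -> ~ Dth ph z.
Proof. by move=> [_ h]; rewrite /Dth; lra. Qed.

(** * Uniform bounds and continuity of the resolvent family *)

Section Family.
Context (n : nat) (VR : NormedModule R_AbsRing) (T : operator n VR).
Context (linT : right_linear_op T) (n1 : (1 <= n)%nat) (om : R) (hom : 0 < om < PI / 2).
Context (bisT : bisectorial om T).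
Notation V := (cm_NormedModule n VR).
Notation Bd := (bounded_map n VR).

Lemma bl_lmul_le (a : clifford n) : norm (bl_lmul VR a) <= card_index n * card_index n * norm a.
Proof.
have c0 : 0 <= card_index n := pos_INR _.
apply: bl_norm_le => [|v]; last exact: cl_lmul_le.
by apply: Rmult_le_pos; [apply: Rmult_le_pos | apply: norm_ge_0].
Qed.

(** On [Sig ph] the imaginary part is at least [sin ph * Cmod z], so dividing the difference of two
    values of [S_L^-1] by [2 * z.2] gains a further power of [/ Cmod z]. The bound on [B] follows
    from [B = A conj(s) - S_L^-1(s)]. *)
Lemma resolvent_bound ph : om < ph < PI / 2 -> exists K, 0 <= K /\ forall z, Sig ph z ->
  exists A B, res T z A B /\ norm A * (Cmod z * Cmod z) <= K /\ norm B * Cmod z <= K.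
Proof.
move=> hph; have [c [c0 hc]] := proj2 bisT ph hph.
have [J hJ] := imag_unit_exists n1.
have s0 : 0 < sin ph by apply: sin_gt_0; lra.
have hph' : 0 < ph < PI / 2 by lra.
set k := card_index n * card_index n.
have k0 : 0 <= k by apply: Rmult_le_pos; apply: pos_INR.
(* Two values of [S_L^-1], each at most [c / Cmod z], divided by [2 * z.2]; the factor [k] pays for
   a left multiplication. *)
set KA := c / sin ph * k.
have KA0 : 0 <= KA by apply: Rmult_le_pos => //; apply: Rmult_le_pos => //; apply: Rlt_le; apply: Rinv_0_lt_compat.
set KB := KA * k + c.
have KB0 : 0 <= KB by have := Rmult_le_pos _ _ KA0 k0; rewrite /KB; lra.
exists (KA + KB); split; first lra.
move=> z hz; have z0 := Sig_pos hz; have [y0 _] := hz.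
have bd w : w = z \/ w = Cconj z -> exists F : Bd, is_bounded_op (SL_inv (slice w J) T) F /\
    norm F <= c / Cmod z.
  move=> hw; have e : Cmod w = Cmod z by case: hw => ->; rewrite ?Cmod_conj.
  have [||F [h1 h2]] := hc (slice w J) (slice_paravector w hJ).
  - move=> /(slice_double_sector hph' hJ).
    case: hw => -> h; apply: (Sig_not_Dth hz) => //.
    have -> : z = Cconj (Cconj z) by case: (z) => p q; rewrite /Cconj /= Ropp_involutive.
    exact: Dth_conj.
  - by move=> h; have := slice_norm w hJ; rewrite h norm_zero e; lra.
  - by exists F; split=> //; rewrite -e -(slice_norm w hJ).
have [F1 [h1 n1']] := bd z (or_introl erefl); have [F2 [h2 n2']] := bd (Cconj z) (or_intror erefl).
have ny : z.2 <> 0 by lra.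
have r := resolvent_of_SL linT hJ ny h1 h2.
have nJ : norm (opp J) = 1 by rewrite norm_opp; case: hJ => _ [].
have iy : 0 < / (2 * z.2) by apply: Rinv_0_lt_compat; lra.
set A := bl_comp _ (bl_lmul VR (opp J)) in r; set B := minus _ F1 in r.
exists A, B; split=> //.
have nA : norm A <= / (2 * z.2) * (2 * (c / Cmod z)) * k.
  apply: Rle_trans (bl_comp_le _ _) _.
  apply: Rmult_le_compat; try exact: norm_ge_0.
    have := norm_scal (/ (2 * z.2)) (minus F2 F1); rewrite {1}/abs /= (Rabs_pos_eq (/ _)); last lra.
    move=> h; apply: Rle_trans h _; apply: Rmult_le_compat_l; first lra.
    by apply: Rle_trans (norm_triangle _ _) _; rewrite norm_opp; lra.
  by apply: Rle_trans (bl_lmul_le _) _; rewrite nJ /k; lra.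
have si := Sig_im hph' hz.
have nA2 : norm A * (Cmod z * Cmod z) <= KA.
  apply: (Rle_trans _ (/ (2 * z.2) * (2 * (c / Cmod z)) * k * (Cmod z * Cmod z))).
    by apply: Rmult_le_compat_r => //; apply: Rmult_le_pos; apply: Cmod_ge_0.
  have -> : / (2 * z.2) * (2 * (c / Cmod z)) * k * (Cmod z * Cmod z) = (c * k) * (Cmod z / z.2).
    by field; lra.
  have -> : KA = c * k * (/ sin ph) by rewrite /KA /Rdiv; ring.
  apply: Rmult_le_compat_l; first by apply: Rmult_le_pos.
  apply: (Rmult_le_reg_r z.2) => //; rewrite /Rdiv Rmult_assoc Rinv_l // Rmult_1_r.
  apply: (Rmult_le_reg_l (sin ph)) => //; rewrite -Rmult_assoc Rinv_r ?Rmult_1_l; lra.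
split; first lra.
suff : norm B * Cmod z <= KB by lra.
have nB : norm B <= norm A * (k * Cmod z) + c / Cmod z.
  apply: Rle_trans (norm_triangle _ _) _; rewrite norm_opp; apply: Rplus_le_compat => //.
  apply: Rle_trans (bl_comp_le _ _) _; apply: Rmult_le_compat_l; first exact: norm_ge_0.
  by apply: Rle_trans (bl_lmul_le _) _; rewrite slice_norm // Cmod_conj; apply: Rle_refl.
apply: Rle_trans (Rmult_le_compat_r _ _ _ (Rlt_le _ _ z0) nB) _.
have -> : (norm A * (k * Cmod z) + c / Cmod z) * Cmod z = norm A * (Cmod z * Cmod z) * k + c.
  by field; lra.
by rewrite /KB; apply: Rplus_le_compat_r; apply: Rmult_le_compat_r.
Qed.

Record resolvent_family (A B : C -> Bd) : Prop := ResolventFamily {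
  rf_res : forall ph z, om < ph < PI / 2 -> Sig ph z -> res T z (A z) (B z);
  rf_bound : forall ph, om < ph < PI / 2 -> exists K, 0 <= K /\ forall z, Sig ph z ->
    norm (A z) * (Cmod z * Cmod z) <= K /\ norm (B z) * Cmod z <= K }.

Lemma res_unique z (A B A' B' : Bd) : res T z A B -> res T z A' B' -> A = A' /\ B = B'.
Proof.
move=> r r'; have eA v : A v = A' v.
  apply: (res_inv r'); exists (B v), (plus v (minus (scal (2 * z.1) (B v)) (scal (z.1 ^ 2 + z.2 ^ 2) (A v)))).
  by split; [apply: (res_TA r) | split; [apply: (res_TB r) | vec]].
split; apply: blinP => // v; apply: (opT_fun linT (res_TA r v)).
by rewrite eA; apply: (res_TA r').
Qed.

(** One family has to serve all angles [ph]. It is chosen pointwise, and [res_unique] transfers to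
    it the bounds obtained for each [ph] separately. *)
Lemma resolvent_family_exists : exists A B, resolvent_family A B.
Proof.
pose P z (AB : Bd * Bd) := (exists ph, om < ph < PI / 2 /\ Sig ph z) -> res T z AB.1 AB.2.
have [f hf] : exists f, forall z, P z (f z).
  apply: ClassicalEpsilon.choice => z.
  case: (Classical_Prop.classic (exists ph, om < ph < PI / 2 /\ Sig ph z)) => [[ph [h1 h2]]|no].
    have [K [_ hK]] := resolvent_bound h1.
    by have [A [B [r _]]] := hK z h2; exists (A, B).
  (* A default value off all sectors, where nothing is claimed. *)
  by exists (zero, zero) => h; case: no.
exists (fun z => (f z).1), (fun z => (f z).2).
have r ph z : om < ph < PI / 2 -> Sig ph z -> res T z (f z).1 (f z).2.
  by move=> h1 h2; apply: hf; exists ph.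
split=> // ph hph; have [K [K0 hK]] := resolvent_bound hph; exists K; split=> // z hz.
have [A [B [r' h]]] := hK z hz.
by have [-> ->] := res_unique (r ph z hph hz) r'.
Qed.

Section Holomorphy.
Context (A B : C -> Bd) (fam : resolvent_family A B).

(** The difference identities express the increments as scalars tending to 0 times products of two
    members of the family, and these are bounded near [w]. *)
Lemma family_continuous ph w : om < ph < PI / 2 -> Sig ph w ->
  continuous (A : R * R -> Bd) w /\ continuous (B : R * R -> Bd) w.
Proof.
move=> hph hw; have [K [K0 hK]] := rf_bound fam hph.
have w0 := Sig_pos hw.
(* Staying beyond modulus [q] keeps [z] away from 0, where the bounds of [rf_bound] degenerate; [M]
   is then a common bound. *)
set q := Cmod w / 2; have q0 : 0 < q by rewrite /q; lra.
set M := K / (q * q) + K / q.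
have i0 : 0 <= K / q by apply: Rmult_le_pos => //; apply: Rlt_le; apply: Rinv_0_lt_compat.
have i1 : 0 <= K / (q * q) by apply: Rmult_le_pos => //; apply: Rlt_le; apply: Rinv_0_lt_compat; apply: Rmult_lt_0_compat.
have M0 : 0 <= M by rewrite /M; lra.
have nM z : Sig ph z -> q < Cmod z -> norm (A z) <= M /\ norm (B z) <= M.
  move=> hz qz; have [h1 h2] := hK z hz.
  have nA := norm_ge_0 (A z); have nB := norm_ge_0 (B z).
  have a1 : norm (A z) * (q * q) <= K.
    by apply: Rle_trans h1; apply: Rmult_le_compat_l => //; apply: Rmult_le_compat; lra.
  have a2 : norm (B z) * q <= K by apply: Rle_trans h2; apply: Rmult_le_compat_l; lra.
  have e1 : norm (A z) <= K / (q * q).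
    apply: (Rmult_le_reg_r (q * q)); first exact: Rmult_lt_0_compat.
    by rewrite /Rdiv Rmult_assoc Rinv_l; nra.
  have e2 : norm (B z) <= K / q.
    by apply: (Rmult_le_reg_r q) => //; rewrite /Rdiv Rmult_assoc Rinv_l; lra.
  by rewrite /M; lra.
pose d (z : R * R) := 2 * Rabs (z.1 - w.1) + Rabs (w.1 ^ 2 + w.2 ^ 2 - (z.1 ^ 2 + z.2 ^ 2)).
have c1 : continuous (fun p : R * R => p.1) w by case: (w) => a b; apply: continuous_fst.
have c2 : continuous (fun p : R * R => p.2) w by case: (w) => a b; apply: continuous_snd.
have cq : continuous (fun p : R * R => p.1 * p.1 + p.2 * p.2) w.
  exact: (continuous_plus (V := R_NormedModule) _ _ _ (continuous_mult _ _ _ c1 c1) (continuous_mult _ _ _ c2 c2)).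
have near_d del : 0 < del -> locally (w : R * R) (fun z => d z < del).
  move=> e0; have e4 : 0 < del / 4 by lra.
  apply: filter_imp (filter_and _ _ (ccont_locally_lt c1 e4) (ccont_locally_lt cq e4)) => z [h1 h2].
  have e : w.1 ^ 2 + w.2 ^ 2 - (z.1 ^ 2 + z.2 ^ 2) =
      - ((z.1 * z.1 + z.2 * z.2) - (w.1 * w.1 + w.2 * w.2)) by ring.
  by rewrite /d e Rabs_Ropp; move: h1 h2 => /=; lra.
have near_q : locally (w : R * R) (fun z => q < Cmod (z : C)).
  have hq : 0 < Cmod w * Cmod w * (3 / 4) by have := Rmult_lt_0_compat _ _ w0 w0; lra.
  apply: filter_imp (ccont_locally_lt cq hq) => z /Rabs_def2 [_ h].
  apply: Rnot_le_lt => k; have k0 := Cmod_ge_0 z.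
  have : Cmod z * Cmod z <= q * q by apply: Rmult_le_compat.
  rewrite {1}Cmod_sq; have := Cmod_sq w; rewrite /q /= => e1; move: h; rewrite /=; lra.
have hw2 : q < Cmod w by rewrite /q; lra.
have [nAw nBw] := nM w hw hw2.
have rw := rf_res fam hph hw.
have key (X Y : Bd) (Z1 Z2 Z3 : Bd) (s t : R) : norm Z1 <= M -> norm Z2 <= M -> norm Z3 <= M ->
    (forall v, minus (X v) (Y v) = plus (scal s (Z1 (Z2 v))) (scal t (Z1 (Z3 v)))) ->
    norm (minus X Y) <= (Rabs s + Rabs t) * (M * M).
  move=> h1 h2 h3 h; have -> : minus X Y = plus (scal s (bl_comp Z1 Z2)) (scal t (bl_comp Z1 Z3)).
    by apply: blinP => v; rewrite bl_minusE h.
  apply: Rle_trans (norm_triangle _ _) _; rewrite Rmult_plus_distr_r.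
  have n1'' := norm_ge_0 Z1; have n2'' := norm_ge_0 Z2; have n3'' := norm_ge_0 Z3.
  have k1 := norm_scal s (bl_comp Z1 Z2); have k2 := norm_scal t (bl_comp Z1 Z3).
  apply: Rplus_le_compat.
  - apply: Rle_trans k1 _; apply: Rmult_le_compat_l; first exact: Rabs_pos.
    by apply: Rle_trans (bl_comp_le _ _) _; apply: Rmult_le_compat.
  - apply: Rle_trans k2 _; apply: Rmult_le_compat_l; first exact: Rabs_pos.
    by apply: Rle_trans (bl_comp_le _ _) _; apply: Rmult_le_compat.
have near eps : 0 < eps -> locally (w : R * R) (fun z =>
    norm (minus (A z) (A w)) < eps /\ norm (minus (B z) (B w)) < eps).
  move=> e0; have MM : 0 <= M * M by apply: Rmult_le_pos.
  have e1 : 0 < eps / (M * M + 1) by apply: Rdiv_lt_0_compat; lra.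
  apply: filter_imp (filter_and _ _ (filter_and _ _ (near_d _ e1) near_q) (locally_Sig hw)) => z [[h1 h2] h3].
  have [nAz nBz] := nM z h3 h2; have rz := rf_res fam hph h3.
  have fin : d z * (M * M) < eps.
    move: h1 => /(Rmult_lt_compat_r (M * M + 1) _ _ ltac:(lra)).
    rewrite (_ : eps / _ * _ = eps); last by field; lra.
    have : 0 <= d z by apply: Rplus_le_le_0_compat; [apply: Rmult_le_pos; [lra | exact: Rabs_pos] | exact: Rabs_pos].
    nra.
  have ed : d z = Rabs (2 * (z.1 - w.1)) + Rabs (w.1 ^ 2 + w.2 ^ 2 - (z.1 ^ 2 + z.2 ^ 2)).
    by rewrite Rabs_mult (Rabs_pos_eq 2 ltac:(lra)).
  split; apply: Rle_lt_trans fin; rewrite ed.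
  - by apply: (key _ _ (A z) (B w) (A w)) => // v; apply: (res_Adiff linT rz rw).
  (* In [res_Bdiff] the left factors are [B z] and [A z]; commuting puts [B w] first in both terms,
     as [key] requires. *)
  - have e v : minus (B z v) (B w v) = plus (scal (2 * (z.1 - w.1)) (B w (B z v)))
        (scal (w.1 ^ 2 + w.2 ^ 2 - (z.1 ^ 2 + z.2 ^ 2)) (B w (A z v))).
      by rewrite (res_Bdiff linT rz rw) (res_BB linT rz rw) (res_AB linT rz rw) -(res_BA linT rw rz).
    exact: (key _ _ (B w) (B z) (A z)).
by split; apply: norm_lt_continuous => eps e0; apply: filter_imp (near eps e0) => z [].
Qed.
End Holomorphy.
End Family.

Section RealContinuity.
Context (U : UniformSpace).
Implicit Types (f g : U -> R) (z : U).
Lemma contR_plus f g z : continuous f z -> continuous g z -> continuous (fun w => f w + g w) z.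
Proof. exact: (continuous_plus (V := R_NormedModule)). Qed.
Lemma contR_minus f g z : continuous f z -> continuous g z -> continuous (fun w => f w - g w) z.
Proof. exact: (continuous_minus (V := R_NormedModule)). Qed.
Lemma contR_mult f g z : continuous f z -> continuous g z -> continuous (fun w => f w * g w) z.
Proof. exact: (continuous_mult (K := R_AbsRing)). Qed.
Lemma contR_opp f z : continuous f z -> continuous (fun w => - f w) z.
Proof. exact: (continuous_opp (V := R_NormedModule)). Qed.
End RealContinuity.

Ltac contR := repeat first [assumption | apply: continuous_const | apply: contR_minus |
  apply: contR_plus | apply: contR_mult | apply: contR_opp].

(** * The operator integrands along a ray *)

Section Calculus.
Context (n : nat) (VR : NormedModule R_AbsRing) (T : operator n VR).
Context (linT : right_linear_op T) (om : R) (hom : 0 < om < PI / 2).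
Notation V := (cm_NormedModule n VR).
Notation Bd := (bounded_map n VR).
Context (A B : C -> Bd) (fam : resolvent_family T om A B).
Implicit Types (psi : blin V R_NormedModule) (v : V).

(** [resolvent_identity] exhibits [- rho2] as the factor in the definition of [cderiv]; continuity
    of the family gives the rest. *)
Lemma rho_holo psi v ph : om < ph < PI / 2 -> holo (Sig ph) (rho psi A B v).
Proof.
move=> hph; exists (fun w => - rho2 psi A B v w w)%C => w hw.
have [cA cB] := family_continuous linT fam hph hw.
have c1 : continuous (fun p : R * R => p.1) w by case: (w) => a b; apply: continuous_fst.
have c2 : continuous (fun p : R * R => p.2) w by case: (w) => a b; apply: continuous_snd.
have ap (X : R * R -> Bd) (u : R * R -> V) : continuous X w -> continuous u w ->
    continuous (fun z => psi (X z (u z)) : R) w.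
  by move=> cX cu; exact: (continuous_blin psi (continuous_apply cX cu)).
have cAw : continuous (fun z : R * R => A z v) w by apply: continuous_apply => //; apply: continuous_const.
have cBw : continuous (fun z : R * R => B z v) w by apply: continuous_apply => //; apply: continuous_const.
split.
- exists (fun z => - rho2 psi A B v z w)%C; split; [|split=> //].
    have k1 := ap _ _ cA (continuous_const (A w v) w).
    have k2 := ap _ _ cA (continuous_const (B w v) w).
    have k3 := ap _ _ cB (continuous_const (B w v) w).
    by apply: ccont_opp; split; rewrite /=; contR.
  apply: filter_imp (locally_Sig hw) => z hz.
  exact: (resolvent_identity linT psi v (rf_res fam hph hz) (rf_res fam hph hw)).
- have k1 := ap _ _ cA cAw; have k2 := ap _ _ cA cBw; have k3 := ap _ _ cB cBw.
  by apply: ccont_opp; split; rewrite /=; contR.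
Qed.

Lemma rho_bound psi v ph : om < ph < PI / 2 -> exists K, 0 <= K /\
  forall z, Sig ph z -> Cmod z * Cmod (rho psi A B v z) <= K.
Proof.
move=> hph; have [K [K0 hK]] := rf_bound fam hph.
have np := norm_ge_0 psi; have nv := norm_ge_0 v.
exists (3 * (norm psi * (K * norm v))); split.
  by apply: Rmult_le_pos; [lra | apply: Rmult_le_pos => //; apply: Rmult_le_pos].
move=> z hz; have [h1 h2] := hK z hz; have z0 := Sig_pos hz.
have pb (X : Bd) : Rabs (psi (X v)) <= norm psi * (norm X * norm v).
  apply: Rle_trans (bl_norm_apply psi _) _; apply: Rmult_le_compat_l => //; exact: bl_norm_apply.
have bA : Cmod z * Rabs (psi (A z v)) * Cmod z <= norm psi * (K * norm v).
  apply: (Rle_trans _ (Cmod z * (norm psi * (norm (A z) * norm v)) * Cmod z)).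
    by apply: Rmult_le_compat_r; [lra | apply: Rmult_le_compat_l; [lra | exact: pb]].
  rewrite (_ : Cmod z * _ * _ = norm psi * (norm (A z) * (Cmod z * Cmod z) * norm v)); last by ring.
  by apply: Rmult_le_compat_l => //; apply: Rmult_le_compat_r.
have bB : Cmod z * Rabs (psi (B z v)) <= norm psi * (K * norm v).
  apply: (Rle_trans _ (Cmod z * (norm psi * (norm (B z) * norm v)))).
    by apply: Rmult_le_compat_l; [lra | exact: pb].
  rewrite (_ : Cmod z * _ = norm psi * (norm (B z) * Cmod z * norm v)); last by ring.
  by apply: Rmult_le_compat_l => //; apply: Rmult_le_compat_r.
have f1 := fst_le_Cmod z; have f2 := im_le_Cmod z.
have a0 := Rabs_pos (psi (A z v)).
have e1 : Rabs (rho psi A B v z).1 <= Cmod z * Rabs (psi (A z v)) + Rabs (psi (B z v)).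
  rewrite /rho /=; apply: Rle_trans (Rabs_triang _ _) _; rewrite Rabs_Ropp Rabs_mult.
  by apply: Rplus_le_compat_r; apply: Rmult_le_compat_r.
have e2 : Rabs (rho psi A B v z).2 <= Cmod z * Rabs (psi (A z v)).
  by rewrite /rho /= Rabs_Ropp Rabs_mult; apply: Rmult_le_compat_r.
apply: Rle_trans (Rmult_le_compat_l _ _ _ (Rlt_le _ _ z0) (Cmod_le_sum _)) _.
apply: (Rle_trans _ (Cmod z * (Cmod z * Rabs (psi (A z v)) + Rabs (psi (B z v)) + Cmod z * Rabs (psi (A z v))))).
  by apply: Rmult_le_compat_l; lra.
lra.
Qed.

Section Ray.
Context (F : {set 'I_n} -> C -> C) (J : clifford n) (al be e : R).

(* The integrand on the ray at angle [al], through the resolvents on the ray at angle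
   [be] in the upper half plane: [cos al = cos be] and [sin al = e * sin be], [e = 1] or [-1]. *)
Definition ray_coef (S : {set 'I_n}) (r : R) : C := (F S (pt r al) * (cis al * - Ci))%C.
Definition ray_U (r : R) : Bd := minus (scal (r * cos be) (A (pt r be))) (B (pt r be)).
Definition ray_W (r : R) : Bd := scal (e * (r * sin be)) (A (pt r be)).
(** With [c = ray_coef], this is [e_S (c.1 + c.2 J) (U - J W)] multiplied out by [J^2 = -1]; the
    last factor is [S_R^-1 = conj(s) Q^-1 - T Q^-1]. *)
Definition ray_term (S : {set 'I_n}) (r : R) : Bd :=
  bl_comp (bl_lmul VR (cl_unit S))
    (plus (plus (scal (ray_coef S r).1 (ray_U r))
                (scal (ray_coef S r).2 (bl_comp (bl_lmul VR J) (ray_U r))))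
          (plus (scal (ray_coef S r).2 (ray_W r))
                (scal (- (ray_coef S r).1) (bl_comp (bl_lmul VR J) (ray_W r))))).
Definition ray_G (r : R) : Bd := \big[plus/zero]_(S : {set 'I_n}) ray_term S r.

Lemma continuous_sum (U : UniformSpace) (E : NormedModule R_AbsRing) (I : Type) (s : seq I)
    (g : I -> U -> E) z : (forall i, continuous (g i) z) ->
  continuous (fun w => \big[plus/zero]_(i <- s) g i w) z.
Proof.
move=> h; elim: s => [|i s IH].
  by apply: (continuous_ext (fun _ => zero : E)) => [w|]; [rewrite big_nil | apply: continuous_const].
apply: (continuous_ext (fun w => plus (g i w) (\big[plus/zero]_(j <- s) g j w))).
  by move=> w; rewrite big_cons.
exact: continuous_plus.
Qed.

Lemma bl_comp_l_linear (X : Bd) : is_linear (fun Y : Bd => bl_comp X Y : Bd).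
Proof.
split.
- by move=> Y Z; apply: blinP => v /=; rewrite blD.
- by move=> k Y; apply: blinP => v /=; rewrite blZ.
- have n0 := norm_ge_0 X; exists (norm X + 1); split; first lra.
  by move=> Y; apply: Rle_trans (bl_comp_le _ _) _; have := norm_ge_0 Y; nra.
Qed.

Lemma continuous_bl_comp (U : UniformSpace) (X : Bd) (Y : U -> Bd) z : continuous Y z ->
  continuous (fun w => bl_comp X (Y w) : Bd) z.
Proof.
move=> cY; apply: (continuous_comp Y (fun Y : Bd => bl_comp X Y : Bd)) => //.
exact: linear_cont (bl_comp_l_linear X).
Qed.

Lemma continuous_ray_G ph r : om < ph < PI / 2 -> ph < be < PI - ph -> 0 < r ->
  (forall S, ccont (F S) (pt r al)) -> continuous ray_G r.
Proof.
move=> hph hbe r0 cF; have hz := Sig_pt (proj1 (conj (Rlt_trans _ _ _ (proj1 hom) (proj1 hph)) I)) r0 hbe.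
have [cA cB] := family_continuous linT fam hph hz.
have cp (X : C -> Bd) : continuous (X : R * R -> Bd) (pt r be) -> continuous (fun t => X (pt t be)) r.
  move=> cX; have k1 : continuous (fun t => t * cos be) r by contR; apply: continuous_id.
  have k2 : continuous (fun t => t * sin be) r by contR; apply: continuous_id.
  apply: (continuous_comp_2 _ _ (fun x y => X (x, y) : Bd) _ k1 k2).
  by apply: continuous_ext cX => -[].
have {}cA := cp _ cA; have {}cB := cp _ cB.
have cid : continuous (fun t : R => t) r by apply: continuous_id.
have cU : continuous ray_U r.
  apply: (continuous_minus (V := bl_NormedModule V V)) => //.
  by apply: (continuous_scal (V := bl_NormedModule V V)) => //; contR.
have cW : continuous ray_W r.
  by apply: (continuous_scal (V := bl_NormedModule V V)) => //; contR.
apply: (continuous_sum (E := bl_NormedModule V V)) => S; apply: continuous_bl_comp.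
have cc : ccont (fun z => F S z * (cis al * - Ci))%C (pt r al).
  by apply: ccont_mult => //; apply: ccont_const.
have [k1 k2] := ccont_ray cc.
have k3 := contR_opp k1.
apply: (continuous_plus (V := bl_NormedModule V V)); apply: (continuous_plus (V := bl_NormedModule V V));
  apply: (continuous_scal (V := bl_NormedModule V V)) => //; exact: continuous_bl_comp.
Qed.

Lemma rl_ray_G ph : om < ph < PI / 2 -> ph < be < PI - ph -> forall r, 0 < r -> right_linear (ray_G r).
Proof.
move=> hph hbe r r0; have hz := Sig_pt (Rlt_trans _ _ _ (proj1 hom) (proj1 hph)) r0 hbe.
have rs := rf_res fam hph hz.
have rU : right_linear (ray_U r).
  by apply: rl_minus; [apply: rl_scal; apply: (res_rlA rs) | apply: (res_rlB rs)].
have rW : right_linear (ray_W r) by apply: rl_scal; apply: (res_rlA rs).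
apply: rl_sum => S; apply: rl_comp; first exact: right_linear_lmul.
by apply: rl_plus; apply: rl_plus; apply: rl_scal => //; apply: rl_comp => //; apply: right_linear_lmul.
Qed.
End Ray.
End Calculus.

Lemma bl_sumE (U W : NormedModule R_AbsRing) (I : Type) (s : seq I) (f : I -> blin U W) x :
  (\big[plus/zero]_(i <- s) f i : blin U W) x = \big[plus/zero]_(i <- s) f i x.
Proof. by apply: (big_morph (fun f : blin U W => f x)). Qed.

Section CliffordExpansion.
Context (n : nat) (VR : NormedModule R_AbsRing).
Notation V := (cm_NormedModule n VR).

Lemma clifford_expand (a : clifford n) :
  a = \big[plus/zero]_(S : {set 'I_n}) scal (a S) (cl_unit S).
Proof.
apply/ffunP => C.
have h (s : seq {set 'I_n}) : (\big[plus/zero]_(S <- s) scal (a S) (cl_unit S) : clifford n) C =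
    \big[Rplus/0]_(S <- s) (a S * (if C == S then 1 else 0)).
  elim: s => [|S s IH]; first by rewrite !big_nil ffunE.
  by rewrite !big_cons cm_plusE IH cm_scalE ffunE.
rewrite h.
have k (s : seq {set 'I_n}) : uniq s ->
    \big[Rplus/0]_(S <- s) (a S * (if C == S then 1 else 0)) = if C \in s then a C else 0.
  elim: s => [|S s IH] /=; first by rewrite big_nil.
  move=> /andP [Ss us]; rewrite big_cons IH // in_cons; case: eqP => [e|_] /=.
    by rewrite e (negbTE Ss); ring.
  by case: (C \in s); ring.
by rewrite k ?index_enum_uniq // mem_index_enum.
Qed.

Lemma cl_lmul_expand (a : clifford n) (x : V) :
  cl_lmul a x = \big[plus/zero]_(S : {set 'I_n}) scal (a S) (cl_lmul (cl_unit S) x).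
Proof.
rewrite {1}(clifford_expand a).
elim: (index_enum _) => [|S s IH].
  rewrite !big_nil; have := cl_lmulZl 0 (a : clmod n R_NormedModule) x.
  by rewrite !(@scal_zero_l R_Ring).
by rewrite !big_cons cl_lmulDl IH cl_lmulZl.
Qed.

(** Expanding [f(s)] over the units [e_S] leaves constant factors on the left and brings the factors
    from [C_J] next to the resolvent, where they multiply as complex numbers. *)
Lemma slice_value_lmul (th : R) f F z (J : clifford n) (x : V) : slice_data th f F ->
  Dth th z -> imag_unit J ->
  cl_lmul (f (slice z J)) x = \big[plus/zero]_(S : {set 'I_n}) cl_lmul (cl_unit S) (cl_lmul (slice (F S z) J) x).
Proof.
move=> hF hz hJ; rewrite (sd_val hF hz hJ) cl_lmulDl -cl_lmulA.
rewrite (cl_lmul_expand (stem_re F z)) (cl_lmul_expand (stem_im F z)).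
rewrite -[LHS]big_split; apply: eq_bigr => S _ /=; rewrite !ffunE slice_lmul cl_lmulD !cl_lmulZ.
by [].
Qed.
End CliffordExpansion.

Section Calculus.
Context (n : nat) (VR : NormedModule R_AbsRing) (T : operator n VR).
Context (linT : right_linear_op T) (om : R) (hom : 0 < om < PI / 2).
Notation V := (cm_NormedModule n VR).
Notation Bd := (bounded_map n VR).
Context (A B : C -> Bd) (fam : resolvent_family T om A B).
Implicit Types (psi : blin V R_NormedModule) (v : V).

Section Ray.
Context (th : R) (f : clifford n -> clifford n) (F : {set 'I_n} -> C -> C).
Context (hth : 0 < th < PI / 2) (hF : slice_data th f F).
Context (J : clifford n) (hJ : imag_unit J) (al be e ph : R).
Context (hal : angle_set th al) (hph : om < ph < PI / 2) (hbe : ph < be < PI - ph).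
Context (hc : cos al = cos be) (hs : sin al = e * sin be) (he : e * e = 1).
Notation G := (ray_G A B F J al be e).

(** On a lower ray the resolvents of the reflected upper ray serve, since [Q_z] depends only on the
    real part and the modulus; the sign [e] records the reflection. *)
Lemma ray_G_graph r : 0 < r ->
  is_bounded_op
    (op_comp (op_cl (f (polar r al J)))
       (op_comp (op_cl (cl_mul (polar 1 al J) (opp J))) (SR_inv (polar r al J) T))) (G r).
Proof.
move=> r0; split; first exact: (rl_ray_G hom fam F J al e hph hbe r0).
have hz := Sig_pt (Rlt_trans _ _ _ (proj1 hom) (proj1 hph)) r0 hbe.
have rs := rf_res fam hph hz.
have dz := Dth_pt hth r0 hal.
set z := pt r al; set zb := pt r be.
have e1 : z.1 = zb.1 by rewrite /z /zb /= hc.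
have e2 : z.1 ^ 2 + z.2 ^ 2 = zb.1 ^ 2 + zb.2 ^ 2.
  rewrite /z /zb /= hc hs; transitivity (r * cos be * (r * cos be * 1) + (e * e) * (r * sin be * (r * sin be * 1))); [ring | by rewrite he; ring].
have Qb a v : Qrel T z a v <-> Qrel T zb a v by rewrite /Qrel e2 e1.
have QA v : Qrel T zb (A zb v) v.
  exists (B zb v), (plus v (minus (scal (2 * zb.1) (B zb v)) (scal (zb.1 ^ 2 + zb.2 ^ 2) (A zb v)))).
  by split; [apply: (res_TA rs) | split; [apply: (res_TB rs) | vec]].
have eG v : G r v = cl_lmul (f (slice z J)) (cl_lmul (cl_mul (polar 1 al J) (opp J))
    (minus (cl_lmul (para_conj (slice z J)) (A zb v)) (B zb v))).
  rewrite (slice_value_lmul _ hF dz hJ) /ray_G bl_sumE; apply: eq_bigr => S _.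
  have -> : cl_mul (polar 1 al J) (opp J) = slice (cis al * - Ci)%C J.
    rewrite polar_slice1 -slice_mul //; congr (cl_lmul _ _ : clifford n).
    by apply/ffunP => D; rewrite sliceE ffunE /opp /=; case: eqP => _; rring.
  rewrite (cl_lmulA (slice (F S z) J)) slice_mul // slice_conj //.
  change (ray_term A B F J al be e S r v) with
    (cl_lmul (cl_unit S) (plus (plus (scal (ray_coef F al S r).1 (ray_U A B be r v))
                (scal (ray_coef F al S r).2 (cl_lmul J (ray_U A B be r v))))
          (plus (scal (ray_coef F al S r).2 (ray_W A be e r v))
                (scal (- (ray_coef F al S r).1) (cl_lmul J (ray_W A be e r v)))))).
  congr cl_lmul; rewrite -/(ray_coef F al S r).
  set c := ray_coef F al S r; rewrite [RHS]slice_lmul slice_lmul.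
  have eU : ray_U A B be r v = minus (scal zb.1 (A zb v)) (B zb v) by rewrite /ray_U bl_minusE bl_scalE.
  have eW : ray_W A be e r v = scal z.2 (A zb v) by rewrite /ray_W bl_scalE /z /= hs; congr scal; rring.
  rewrite eU eW /Cconj /= -/z -/zb (_ : r * cos al = zb.1); last by rewrite hc.
  set a := A zb v; set b := B zb v; rewrite -[r * sin al]/(z.2).
  have jD x y : cl_lmul J (plus x y) = plus (cl_lmul J x) (cl_lmul J y) :> V by apply: cl_lmulD.
  have jZ (k : R) x : cl_lmul J (scal k x) = scal k (cl_lmul J x) :> V by apply: cl_lmulZ.
  have jN x : cl_lmul J (opp x) = opp (cl_lmul J x) :> V.
    by rewrite -(@scal_opp_one R_Ring) jZ (@scal_opp_one R_Ring).
  have jj x : cl_lmul J (cl_lmul J x) = opp x :> V by apply: imag_unit_lmul2.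
  rewrite /minus !(jD, jZ, jN, jj); vec.
move=> v w; rewrite eG polar_slice -/z; split.
- move=> [u [[u' [[a [ha [p [q [-> [hq ->]]]]]] ->]] ->]].
  have ea : a = A zb v by apply: (res_inv rs); apply/Qb/(Qop_slice linT _ _ _ hJ).
  by rewrite ea in hq *; rewrite (opT_fun linT (res_TA rs v) hq).
- move=> ->; exists (cl_lmul (cl_mul (polar 1 al J) (opp J))
    (minus (cl_lmul (para_conj (slice z J)) (A zb v)) (B zb v))); split=> //.
  exists (minus (cl_lmul (para_conj (slice z J)) (A zb v)) (B zb v)); split=> //.
  exists (A zb v); split; first by apply/(Qop_slice linT _ _ _ hJ)/Qb.
  exists (cl_lmul (para_conj (slice z J)) (A zb v)), (B zb v).
  by split=> //; split=> //; apply: (res_TA rs).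
Qed.

(** The factors [ray_U] and [ray_W] are [O(1 / r)], which is precisely the weight in [sd_int]; the
    majorants of the finitely many terms are added. *)
Lemma ray_G_bound : exists g L, improper g L /\ forall r, 0 < r -> norm (G r) <= g r.
Proof.
have [K [K0 hK]] := rf_bound fam hph.
have he1 : Rabs e = 1.
  have : Rabs e * Rabs e = 1 by rewrite -Rabs_mult he Rabs_R1.
  have := Rabs_pos e; nra.
set k := card_index n * card_index n.
have k0 : 0 <= k by apply: Rmult_le_pos; apply: pos_INR.
have nU r : 0 < r -> norm (ray_U A B be r) <= 2 * K / r /\ norm (ray_W A be e r) <= 2 * K / r.
  move=> r0; have hz := Sig_pt (Rlt_trans _ _ _ (proj1 hom) (proj1 hph)) r0 hbe.
  have [h1 h2] := hK _ hz; rewrite Cmod_pt in h1 h2; try lra.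
  have nA := norm_ge_0 (A (pt r be)); have nB := norm_ge_0 (B (pt r be)).
  have a1 : r * norm (A (pt r be)) <= K / r.
    by apply: (Rmult_le_reg_r r) => //; rewrite (_ : K / r * r = K); [lra | field; lra].
  have b1 : norm (B (pt r be)) <= K / r.
    by apply: (Rmult_le_reg_r r) => //; rewrite (_ : K / r * r = K); [lra | field; lra].
  have c1 : Rabs (cos be) <= 1 by have := COS_bound be; move=> ?; apply: Rabs_le; lra.
  have s1 : Rabs (sin be) <= 1 by have := SIN_bound be; move=> ?; apply: Rabs_le; lra.
  have kr : 0 <= K / r by apply: Rle_trans a1; apply: Rmult_le_pos; lra.
  split.
  - apply: Rle_trans (norm_triangle _ _) _; rewrite norm_opp.
    have h := norm_scal (r * cos be) (A (pt r be)).
    rewrite {1}/abs /= Rabs_mult (Rabs_pos_eq r) in h; last lra.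
    have h3 : r * Rabs (cos be) * norm (A (pt r be)) <= r * norm (A (pt r be)).
      by rewrite Rmult_assoc; apply: Rmult_le_compat_l; [lra | nra].
    have -> : 2 * K / r = K / r + K / r by field; lra.
    by apply: Rplus_le_compat b1; apply: Rle_trans h (Rle_trans _ _ _ h3 a1).
  - have h := norm_scal (e * (r * sin be)) (A (pt r be)).
    rewrite {1}/abs /= !Rabs_mult he1 (Rabs_pos_eq r) in h; last lra.
    have h3 : 1 * (r * Rabs (sin be)) * norm (A (pt r be)) <= r * norm (A (pt r be)).
      by rewrite Rmult_1_l Rmult_assoc; apply: Rmult_le_compat_l; [lra | nra].
    have -> : 2 * K / r = K / r + K / r by field; lra.
    by apply: Rle_trans h _; lra.
have nt S : exists g L, improper g L /\ forall r, 0 < r -> norm (ray_term A B F J al be e S r) <= g r.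
  have [g [L [hL hg]]] := sd_int hF S hal.
  set K2 := k * norm (cl_unit S : clifford n) * ((2 + 2 * (k * norm J)) * (2 * K)).
  have nS := norm_ge_0 (cl_unit S : clifford n); have nJ0 := norm_ge_0 J.
  have kJ : 0 <= k * norm J by apply: Rmult_le_pos.
  exists (fun r => K2 * g r), (K2 * L); split; first by have := improper_scal K2 hL.
  move=> r r0; have [u1 w1] := nU r r0.
  have ir : 0 < / r by apply: Rinv_0_lt_compat.
  set c := ray_coef F al S r.
  have cm : Cmod c = Cmod (F S (pt r al)).
    by rewrite /c /ray_coef !Cmod_mult Cmod_cis Cmod_opp Cmod_Ci; ring.
  have c1 := fst_le_Cmod c; have c2 := im_le_Cmod c.
  have c0 := Cmod_ge_0 c.
  have nc (q : R) (X : Bd) : Rabs q <= Cmod c -> norm X <= 2 * K / r -> norm (scal q X) <= Cmod c * (2 * K / r).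
    move=> h1 h2; apply: Rle_trans (norm_scal _ _) _.
    by apply: Rmult_le_compat => //; [apply: Rabs_pos | apply: norm_ge_0].
  have ncJ (q : R) (X : Bd) : Rabs q <= Cmod c -> norm X <= 2 * K / r ->
      norm (scal q (bl_comp (bl_lmul VR J) X)) <= Cmod c * (k * norm J * (2 * K / r)).
    move=> h1 h2; apply: Rle_trans (norm_scal _ _) _.
    apply: Rmult_le_compat => //; [exact: Rabs_pos | exact: norm_ge_0 |].
    apply: Rle_trans (bl_comp_le _ _) _; apply: Rmult_le_compat => //; try exact: norm_ge_0.
    exact: bl_lmul_le.
  apply: Rle_trans (bl_comp_le _ _) _.
  apply: (Rle_trans _ (k * norm (cl_unit S : clifford n) *
      (Cmod c * (2 * K / r) + Cmod c * (k * norm J * (2 * K / r)) +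
       (Cmod c * (2 * K / r) + Cmod c * (k * norm J * (2 * K / r)))))).
    apply: Rmult_le_compat; try exact: norm_ge_0; first exact: bl_lmul_le.
    apply: Rle_trans (norm_triangle _ _) _; apply: Rplus_le_compat;
      apply: Rle_trans (norm_triangle _ _) _; apply: Rplus_le_compat.
    - exact: nc.
    - exact: ncJ.
    - exact: nc.
    - by apply: ncJ => //; rewrite Rabs_Ropp.
  have -> : k * norm (cl_unit S : clifford n) *
      (Cmod c * (2 * K / r) + Cmod c * (k * norm J * (2 * K / r)) +
       (Cmod c * (2 * K / r) + Cmod c * (k * norm J * (2 * K / r)))) = K2 * (Cmod (F S (pt r al)) / r).
    by rewrite /K2 cm; field; lra.
  apply: Rmult_le_compat_l; last exact: hg.
  by apply: Rmult_le_pos; [apply: Rmult_le_pos | apply: Rmult_le_pos; lra].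
rewrite /ray_G; elim: (index_enum _) => [|S s [g [L [hL hg]]]].
  exists (fun _ => 0), 0; split; first by have := @improper_zero R_NormedModule.
  by move=> r _; rewrite big_nil norm_zero; apply: Rle_refl.
have [g' [L' [hL' hg']]] := nt S; exists (fun r => g' r + g r), (L' + L); split.
  exact: improper_plus hL' hL.
move=> r r0; rewrite big_cons; apply: Rle_trans (norm_triangle _ _) _.
by apply: Rplus_le_compat; [apply: hg' | apply: hg].
Qed.
End Ray.
End Calculus.

(** * The scalar form of the calculus *)

Section Sums.
Definition csum (I : Type) (s : seq I) (H : I -> C -> C) (z : C) : C :=
  \big[Cplus/RtoC 0]_(i <- s) H i z.

Lemma csum_nil (I : Type) (H : I -> C -> C) z : csum [::] H z = RtoC 0.
Proof. by rewrite /csum big_nil. Qed.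
Lemma csum_cons (I : Type) i (s : seq I) (H : I -> C -> C) z :
  csum (i :: s) H z = (H i z + csum s H z)%C.
Proof. by rewrite /csum big_cons. Qed.

Lemma holo_csum D (I : Type) (s : seq I) (H : I -> C -> C) :
  (forall i, holo D (H i)) -> holo D (csum s H).
Proof.
move=> h; elim: s => [|i s IH].
  by have := holo_const D (RtoC 0); congr holo; apply: functional_extensionality => z; rewrite csum_nil.
have := holo_plus (h i) IH.
by congr holo; apply: functional_extensionality => z; rewrite csum_cons.
Qed.

Lemma Cmod_csum_le (I : Type) (s : seq I) (H : I -> C -> C) z (g : I -> R) :
  (forall i, Cmod (H i z) <= g i) -> Cmod (csum s H z) <= \big[Rplus/0]_(i <- s) g i.
Proof.
move=> h; elim: s => [|i s IH]; first by rewrite csum_nil big_nil Cmod_0; apply: Rle_refl.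
rewrite csum_cons big_cons; apply: Rle_trans (Cmod_triangle _ _) _.
exact: Rplus_le_compat.
Qed.

Lemma ray_im_csum (I : Type) (s : seq I) (H : I -> C -> C) al r :
  ray_im (csum s H) al r = \big[Rplus/0]_(i <- s) ray_im (H i) al r.
Proof.
elim: s => [|i s IH]; first by rewrite /ray_im csum_nil big_nil /=; ring.
by rewrite big_cons -IH /ray_im csum_cons /=; ring.
Qed.
End Sums.

Lemma continuous_Cmod_ray (H : C -> C) al r : ccont H (pt r al) ->
  continuous (fun t => Cmod (H (pt t al))) r.
Proof.
move=> /ccont_ray [c1 c2]; apply: continuous_sqrt_comp.
have s (g : R -> R) : continuous g r -> continuous (fun t => g t ^ 2) r.
  by move=> cg; rewrite /=; apply: contR_mult => //; apply: contR_mult => //; apply: continuous_const.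
by apply: contR_plus; apply: s.
Qed.

Lemma ray_integrable (H : C -> C) al g L : (forall r, 0 < r -> ccont H (pt r al)) ->
  (forall r, 0 < r -> Cmod (H (pt r al)) <= g r) -> improper g L ->
  (exists L', improper (fun r => Cmod (H (pt r al))) L') /\ (exists l, improper (ray_im H al) l).
Proof.
move=> cH hg hL; split.
- apply: (improper_dominated (E := R_CompleteNormedModule) (g := g) _ _ hL).
    by move=> r r0; apply: continuous_Cmod_ray; apply: cH.
  by move=> r r0; rewrite /norm /= /abs /= Rabs_pos_eq; [apply: hg | apply: Cmod_ge_0].
- apply: (improper_dominated (E := R_CompleteNormedModule) (g := g) _ _ hL).
    by move=> r r0; apply: ccont_ray_im; apply: cH.
  by move=> r r0; apply: Rle_trans (ray_im_le _ _ _) (hg r r0).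
Qed.

Section Calculus.
Context (n : nat) (VR : CompleteNormedModule R_AbsRing) (T : operator n VR).
Context (linT : right_linear_op T) (om : R) (hom : 0 < om < PI / 2).
Notation V := (cm_NormedModule n VR).
Notation Bd := (bounded_map n VR).
Context (A B : C -> Bd) (fam : resolvent_family T om A B).
Implicit Types (psi : blin V R_NormedModule) (v : V).

Lemma ray_exists (th : R) f F J al be e ph : 0 < th < PI / 2 -> slice_data th f F ->
  imag_unit J -> angle_set th al -> om < ph < PI / 2 -> ph < be < PI - ph ->
  cos al = cos be -> sin al = e * sin be -> e * e = 1 ->
  exists X : Bd, ray_integral T f J al X /\ improper (ray_G A B F J al be e) X.
Proof.
move=> hth hF hJ hal hph hbe hc hs he.
have [g [L [hL hg]]] := ray_G_bound hom fam hF J hal hph hbe he.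
have cG r : 0 < r -> continuous (ray_G A B F J al be e) r.
  move=> r0; apply: (continuous_ray_G linT hom fam hph hbe r0) => S.
  by apply: (holo_ccont (sd_holo hF S)); apply: Dth_pt.
have [X hX] := improper_dominated (E := bl_CompleteNormedModule V (cm_CompleteNormedModule n VR)) cG hg hL.
exists X; split=> //; exists (ray_G A B F J al be e); split=> // r r0.
exact: (ray_G_graph linT hom fam hth hF hJ hal hph hbe hc hs he).
Qed.

(* [psi (R(z) e_S v)] weighted by the stem function: the scalar density of the calculus. *)
Definition density (F : {set 'I_n} -> C -> C) psi v (z : C) : C :=
  csum (index_enum {set 'I_n}) (fun S z => F S z * rho (bl_comp psi (bl_lmul VR (cl_unit S))) A B v z)%C z.

(* The contributions of [J] cancel between a ray and its conjugate. *)
Lemma ray_pair (th : R) f F J al1 al2 be psi v r : slice_data th f F ->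
  angle_set th al1 -> angle_set th al2 -> 0 < th < PI / 2 -> 0 < r ->
  cos al1 = cos be -> cos al2 = cos be -> sin al1 = - sin be -> sin al2 = sin be ->
  psi (ray_G A B F J al1 be (-1) r v) - psi (ray_G A B F J al2 be 1 r v) =
  -2 * ray_im (density F psi v) be r.
Proof.
move=> hF h1 h2 hth r0 c1 c2 s1 s2.
have e2 : pt r al2 = pt r be by rewrite /pt c2 s2.
have e1 : pt r al1 = Cconj (pt r be) by rewrite /pt /Cconj /= c1 s1; congr pair; ring.
have dz : Dth th (pt r be) by rewrite -e2; apply: Dth_pt.
rewrite /density ray_im_csum /ray_G !bl_sumE !bl_sum.
set s := index_enum _.
suff h : forall S, psi (ray_term A B F J al1 be (-1) S r v) - psi (ray_term A B F J al2 be 1 S r v) =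
    -2 * ray_im (fun z => F S z * rho (bl_comp psi (bl_lmul VR (cl_unit S))) A B v z)%C be r.
  elim: s => [|S s IH]; first by rewrite !big_nil /zero /=; ring.
  rewrite !big_cons Rmult_plus_distr_l -IH -h /plus /=; ring.
move=> S; set u := bl_comp psi (bl_lmul VR (cl_unit S)).
have et al e : psi (ray_term A B F J al be e S r v) =
   (ray_coef F al S r).1 * u (ray_U A B be r v) + (ray_coef F al S r).2 * u (cl_lmul J (ray_U A B be r v)) +
   ((ray_coef F al S r).2 * u (ray_W A be e r v) - (ray_coef F al S r).1 * u (cl_lmul J (ray_W A be e r v))).
  change (psi (ray_term A B F J al be e S r v)) with (u (plus (plus (scal (ray_coef F al S r).1 (ray_U A B be r v))
                (scal (ray_coef F al S r).2 (cl_lmul J (ray_U A B be r v))))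
          (plus (scal (ray_coef F al S r).2 (ray_W A be e r v))
                (scal (- (ray_coef F al S r).1) (cl_lmul J (ray_W A be e r v)))))).
  move: (ray_U A B be r v) (ray_W A be e r v) (ray_coef F al S r) => a b c.
  by clearbody u; rewrite !blD !blZ /plus /scal /= /mult /=; ring.
have eW (e : R) : ray_W A be e r v = scal e (ray_W A be 1 r v).
  by rewrite /ray_W !bl_scalE scal_assoc /mult /=; congr scal; rring.
have eJW (e : R) : cl_lmul J (ray_W A be e r v) = scal e (cl_lmul J (ray_W A be 1 r v)) :> V.
  by rewrite {1}eW; apply: cl_lmulZ.
rewrite !et (eJW (-1)) (eW (-1)) !(blZ u (-1)).
(* The factor [- Ci] produces the minus sign. Together with the sign of [ray_W] it makes the terms
   with [J] equal on the two rays and the others opposite, so the difference kills the former and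
   doubles the latter. *)
have k1 : ray_coef F al1 S r = (- Cconj (ray_coef F al2 S r))%C.
  rewrite /ray_coef e1 e2 (sd_conj hF S dz) /cis c1 s1 c2 s2 /Cconj /Cmult /Copp /Ci /=.
  by congr pair; ring.
rewrite k1; have k2 : (ray_coef F al2 S r * Ci)%C = (F S (pt r be) * cis be)%C.
  by rewrite /ray_coef e2 /cis c2 s2 -/(cis be) -Cmult_assoc -Cmult_assoc (_ : - Ci * Ci = 1)%C ?Cmult_1_r // /Cmult /Copp /Ci /=; congr pair; ring.
have eu : u (ray_U A B be r v) = (rho u A B v (pt r be)).1.
  by rewrite /rho /ray_U bl_minusE bl_scalE blB blZ /= /minus /plus /opp /scal /= /mult /=; ring.
have ew : u (ray_W A be 1 r v) = - (rho u A B v (pt r be)).2.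
  by rewrite /rho /ray_W bl_scalE blZ /= /scal /= /mult /=; ring.
rewrite eu ew /ray_im.
have -> : (F S (pt r be) * rho u A B v (pt r be) * cis be)%C =
    (ray_coef F al2 S r * Ci * rho u A B v (pt r be))%C by rewrite k2; ring.
rewrite /scal /= /mult /=; ring.
Qed.

Lemma bl_eval_linear v : is_linear (fun X : Bd => X v : V).
Proof.
split=> //; have nv := norm_ge_0 v; exists (norm v + 1); split; first lra.
move=> X; apply: Rle_trans (bl_norm_apply X v) _; have := norm_ge_0 X; nra.
Qed.
Definition bl_eval v : blin (bl_NormedModule V V) V := Blin (bl_eval_linear v).

Lemma improper_density (th : R) f F J be X1 X2 al1 al2 psi v : slice_data th f F ->
  angle_set th al1 -> angle_set th al2 -> 0 < th < PI / 2 ->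
  cos al1 = cos be -> cos al2 = cos be -> sin al1 = - sin be -> sin al2 = sin be ->
  improper (ray_G A B F J al1 be (-1)) X1 -> improper (ray_G A B F J al2 be 1) X2 ->
  improper (ray_im (density F psi v) be) (- / 2 * psi (minus X1 X2 v)).
Proof.
move=> hF h1 h2 hth c1 c2 s1 s2 i1 i2.
have k := improper_scal (- / 2) (improper_blin psi (improper_blin (bl_eval v) (improper_minus i1 i2))).
apply: improper_ext k => r r0.
change (- / 2 * psi ((minus (ray_G A B F J al1 be (-1) r) (ray_G A B F J al2 be 1 r) : Bd) v) =
  ray_im (density F psi v) be r).
rewrite bl_minusE blB.
change (- / 2 * (psi (ray_G A B F J al1 be (-1) r v) - psi (ray_G A B F J al2 be 1 r v)) =
  ray_im (density F psi v) be r).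
by rewrite (ray_pair J psi v hF h1 h2 hth r0 c1 c2 s1 s2); field.
Qed.
End Calculus.

Lemma improper_sum (I : Type) (s : seq I) (G : I -> R -> R) (L : I -> R) :
  (forall i, improper (G i) (L i)) ->
  improper (fun r => \big[Rplus/0]_(i <- s) G i r) (\big[Rplus/0]_(i <- s) L i).
Proof.
move=> h; elim: s => [|i s IH].
  apply: (improper_ext (G := fun _ => 0)) => [r _|]; first by rewrite big_nil.
  by rewrite big_nil; have := @improper_zero R_NormedModule.
apply: (improper_ext (G := fun r => G i r + \big[Rplus/0]_(j <- s) G j r)) => [r _|].
  by rewrite big_cons.
by rewrite big_cons; have := improper_plus (h i) IH.
Qed.

Lemma sum_choice (I : finType) (Q : I -> (R -> R) -> R -> Prop) :
  (forall i, exists g L, Q i g L) -> exists g L, forall i, Q i (g i) (L i).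
Proof.
move=> h; have [gL hgL] := ClassicalEpsilon.choice (fun i (p : (R -> R) * R) => Q i p.1 p.2)
  (fun i => let: ex_intro g (ex_intro L q) := h i in ex_intro _ (g, L) q).
by exists (fun i => (gL i).1), (fun i => (gL i).2).
Qed.

Section Calculus.
Context (n : nat) (VR : CompleteNormedModule R_AbsRing) (T : operator n VR).
Context (linT : right_linear_op T) (om : R) (hom : 0 < om < PI / 2).
Context (n1 : (1 <= n)%nat).
Notation V := (cm_NormedModule n VR).
Notation Bd := (bounded_map n VR).
Context (A B : C -> Bd) (fam : resolvent_family T om A B).
Context (th : R) (hth : om < th < PI / 2).
Implicit Types (psi : blin V R_NormedModule) (v : V) (F : {set 'I_n} -> C -> C).
Notation density := (density A B).

Lemma th_pos : 0 < th < PI / 2.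
Proof. lra. Qed.

Lemma density_holo f F psi v D ph : slice_data th f F -> om < ph < PI / 2 ->
  (forall z, D z -> Dth th z) -> (forall z, D z -> Sig ph z) -> holo D (density F psi v).
Proof.
move=> hF hph h1 h2; apply: holo_csum => S; apply: holo_mult.
- exact: holo_sub h1 (sd_holo hF S).
- exact: holo_sub h2 (rho_holo linT fam _ _ hph).
Qed.

Lemma density_bound f F psi v ph : slice_data th f F -> om < ph < PI / 2 ->
  exists K, forall z, Dth th z -> Sig ph z -> Cmod z * Cmod (density F psi v z) <= K.
Proof.
move=> hF hph; have [M hM] := sd_bound hF.
have [K hK] : exists K : {set 'I_n} -> R, forall S, 0 <= K S /\ forall z, Sig ph z ->
    Cmod z * Cmod (rho (bl_comp psi (bl_lmul VR (cl_unit S))) A B v z) <= K S.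
  by apply: (ClassicalEpsilon.choice _ (fun S => rho_bound fam (bl_comp psi (bl_lmul VR (cl_unit S))) v hph)).
exists (\big[Rplus/0]_(S : {set 'I_n}) (M * K S)) => z h1 h2.
have z0 := Sig_pos h2.
have h : Cmod (density F psi v z) <= \big[Rplus/0]_(S : {set 'I_n}) (M * K S * / Cmod z).
  apply: Cmod_csum_le => S; rewrite Cmod_mult Rmult_assoc; apply: Rmult_le_compat; try exact: Cmod_ge_0.
    exact: hM.
  have [_ k] := hK S; apply: (Rmult_le_reg_l (Cmod z)) => //.
  by rewrite (Rmult_comm (K S)) -Rmult_assoc Rinv_r ?Rmult_1_l; [apply: k | lra].
rewrite sumR_mulr in h; apply: Rle_trans (Rmult_le_compat_l _ _ _ (Rlt_le _ _ z0) h) _.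
by rewrite (Rmult_comm _ (/ _)) -Rmult_assoc Rinv_r ?Rmult_1_l; [apply: Rle_refl | lra].
Qed.

Lemma density_majorant f F psi v ph al : slice_data th f F -> om < ph < PI / 2 ->
  angle_set th al -> ph < al < PI - ph ->
  exists g L, improper g L /\ forall r, 0 < r -> Cmod (density F psi v (pt r al)) <= g r.
Proof.
move=> hF hph hal h; have ph0 : 0 < ph by lra.
have [g [L hgL]] := sum_choice (fun S => sd_int hF S hal).
have [K hK] : exists K : {set 'I_n} -> R, forall S, 0 <= K S /\ forall z, Sig ph z ->
    Cmod z * Cmod (rho (bl_comp psi (bl_lmul VR (cl_unit S))) A B v z) <= K S.
  by apply: (ClassicalEpsilon.choice _ (fun S => rho_bound fam (bl_comp psi (bl_lmul VR (cl_unit S))) v hph)).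
exists (fun r => \big[Rplus/0]_(S : {set 'I_n}) (K S * g S r)), (\big[Rplus/0]_(S : {set 'I_n}) (K S * L S)).
split.
  by apply: improper_sum => S; have := improper_scal (K S) (proj1 (hgL S)).
move=> r r0; apply: Cmod_csum_le => S; rewrite Cmod_mult.
have [K0 k] := hK S; have {}k := k _ (Sig_pt ph0 r0 h); rewrite Cmod_pt in k; last lra.
have hg := proj2 (hgL S) r r0; have c0 := Cmod_ge_0 (F S (pt r al)).
apply: (Rle_trans _ (Cmod (F S (pt r al)) / r * K S)).
  rewrite /Rdiv Rmult_assoc; apply: Rmult_le_compat_l => //.
  apply: (Rmult_le_reg_l r) => //; rewrite -Rmult_assoc Rinv_r ?Rmult_1_l; lra.
by rewrite Rmult_comm; apply: Rmult_le_compat_l.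
Qed.

Lemma angle_Dth al r : angle_set th al -> 0 < r -> Dth th (pt r al).
Proof. by move=> h r0; apply: Dth_pt => //; apply: th_pos. Qed.

Lemma density_integrable f F psi v ph al : slice_data th f F -> om < ph < PI / 2 ->
  angle_set th al -> ph < al < PI - ph ->
  (exists L, improper (fun r => Cmod (density F psi v (pt r al))) L) /\
  (exists l, improper (ray_im (density F psi v) al) l).
Proof.
move=> hF hph hal h; have ph0 : 0 < ph by lra.
have [g [L [hL hg]]] := density_majorant psi v hF hph hal h.
apply: ray_integrable hg hL => r r0.
apply: (holo_ccont (D := fun z => Dth th z /\ Sig ph z)).
  by apply: (density_holo psi v hF hph) => z [].
by split; [apply: angle_Dth | apply: Sig_pt].
Qed.

Lemma density_shift f F psi v ph lo hi al1 al2 l1 l2 : slice_data th f F -> om < ph < PI / 2 ->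
  ph <= lo -> hi <= PI - ph -> (forall al, lo < al < hi -> angle_set th al) ->
  lo < al1 -> al1 <= al2 -> al2 < hi ->
  improper (ray_im (density F psi v) al1) l1 -> improper (ray_im (density F psi v) al2) l2 -> l1 = l2.
Proof.
move=> hF hph h1 h2 hang a1 a12 a2 i1 i2; have PI0 := PI_RGT_0.
have ph0 : 0 < ph by lra.
have [K hK] := density_bound psi v hF hph.
have [[L1 hL1] _] := density_integrable psi v hF hph (hang al1 ltac:(lra)) ltac:(lra).
have [[L2 hL2] _] := density_integrable psi v hF hph (hang al2 ltac:(lra)) ltac:(lra).
apply: (@ray_shift _ lo hi al1 al2 K L1 L2) hL1 hL2 i1 i2; try lra.
- apply: (density_holo psi v hF hph) => z [r [al [r0 [hal ->]]]].
    by apply: angle_Dth => //; apply: hang.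
  by apply: Sig_pt => //; lra.
- move=> r al r0 hal; have := hK (pt r al); rewrite Cmod_pt; last lra.
  by apply; [apply: angle_Dth => //; apply: hang; lra | apply: Sig_pt => //; lra].
Qed.

(** By [ray_pair] a conjugate pair of rays contributes [-2] times an integral of [ray_im]. The two
    pairs enter with opposite signs, and the factor [/ (2 * PI)] leaves [(I2 - I1) / PI]. No [J]
    occurs, whence the independence of [J]. *)
Definition weak_calc F (X : Bd) : Prop := right_linear X /\
  forall psi v ph, om < ph < th -> exists I1 I2,
    improper (ray_im (density F psi v) ph) I1 /\
    improper (ray_im (density F psi v) (PI - ph)) I2 /\ psi (X v) = (I2 - I1) / PI.

Lemma four_rays f F (J : clifford n) ph : slice_data th f F -> imag_unit J -> om < ph < th ->
  exists F1 F2 F3 F4 : Bd,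
  (ray_integral T f J (- ph) F1 /\ ray_integral T f J ph F2 /\
   ray_integral T f J (PI - ph) F3 /\ ray_integral T f J (PI + ph) F4) /\
  (improper (ray_G A B F J (- ph) ph (-1)) F1 /\ improper (ray_G A B F J ph ph 1) F2 /\
   improper (ray_G A B F J (PI - ph) (PI - ph) 1) F3 /\
   improper (ray_G A B F J (PI + ph) (PI - ph) (-1)) F4) /\
  forall psi v,
    improper (ray_im (density F psi v) ph) (- / 2 * psi (minus F1 F2 v)) /\
    improper (ray_im (density F psi v) (PI - ph)) (- / 2 * psi (minus F4 F3 v)).
Proof.
move=> hF hJ hph; have PI0 := PI_RGT_0.
(* An angle strictly between [om] and [ph], so that the rays at [ph] and [PI - ph] lie inside
   [Sig p]. *)
set p := (om + ph) / 2.
have hp : om < p < PI / 2 by rewrite /p; lra.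
have b1 : p < ph < PI - p by rewrite /p; lra.
have b2 : p < PI - ph < PI - p by rewrite /p; lra.
have a1 : angle_set th (- ph) by left; lra.
have a2 : angle_set th ph by left; lra.
have a3 : angle_set th (PI - ph) by right; lra.
have a4 : angle_set th (PI + ph) by right; lra.
have c1 : cos (- ph) = cos ph by apply: cos_neg.
have s1 : sin (- ph) = - sin ph by apply: sin_neg.
have c4 : cos (PI + ph) = cos (PI - ph).
  by rewrite Rplus_comm neg_cos /Rminus Rplus_comm neg_cos cos_neg.
have s4 : sin (PI + ph) = - sin (PI - ph).
  by rewrite Rplus_comm neg_sin /Rminus Rplus_comm neg_sin sin_neg; ring.
have ht := th_pos.
have [F1 [r1 i1]] := ray_exists linT hom fam (e := -1) ht hF hJ a1 hp b1 c1 ltac:(rewrite s1; ring) ltac:(ring).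
have [F2 [r2 i2]] := ray_exists linT hom fam (e := 1) ht hF hJ a2 hp b1 erefl ltac:(ring) ltac:(ring).
have [F3 [r3 i3]] := ray_exists linT hom fam (e := 1) ht hF hJ a3 hp b2 erefl ltac:(ring) ltac:(ring).
have [F4 [r4 i4]] := ray_exists linT hom fam (e := -1) ht hF hJ a4 hp b2 c4 ltac:(rewrite s4; ring) ltac:(ring).
exists F1, F2, F3, F4; split=> //; split=> // psi v; split.
- exact: (improper_density hF a1 a2 ht c1 erefl s1 erefl i1 i2).
- exact: (improper_density hF a4 a3 ht c4 erefl s4 erefl i4 i3).
Qed.

Lemma weak_calc_omega f F X : slice_data th f F -> weak_calc F X ->
  is_omega_calculus om th T f X.
Proof.
move=> hF [rX hX]; split=> // ph J hph hJ.
have [F1 [F2 [F3 [F4 [[r1 [r2 [r3 r4]]] [_ hd]]]]]] := four_rays hF hJ hph.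
exists F1, F2, F3, F4; split=> //; split=> //; split=> //; split=> //.
apply: blinP => v; apply: dual_eq => psi.
have [I1 [I2 [i1 [i2 e]]]] := hX psi v ph hph; have [j1 j2] := hd psi v.
rewrite e (improper_unique i1 j1) (improper_unique i2 j2).
rewrite /= !(blD, blZ) /plus /opp /scal /= /mult /=.
by apply: Rminus_diag_uniq; field; have := PI_RGT_0; lra.
Qed.

Lemma improper_right_linear (G : R -> Bd) X : (forall r, 0 < r -> right_linear (G r)) ->
  improper G X -> right_linear X.
Proof.
move=> hG hX; split; first by move=> *; rewrite blD.
move=> v a; apply: dual_eq => psi.
have h1 := improper_blin psi (improper_blin (bl_eval (cl_rmul v a : V)) hX).
have h2 := improper_blin psi (improper_blin (bl_rmul VR a) (improper_blin (bl_eval v) hX)).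
apply: (improper_unique h1); apply: improper_ext h2 => r r0 /=.
by rewrite (proj2 (hG r r0)).
Qed.

(** The four integrals at one angle [p0] and one [J] define [X]. Other angles are reached by
    [density_shift], separately on the right and on the left. *)
Lemma weak_calc_exists f F : slice_data th f F -> exists X, weak_calc F X.
Proof.
move=> hF; have [J hJ] := imag_unit_exists n1; have PI0 := PI_RGT_0.
set p0 := (om + th) / 2; have hp0 : om < p0 < th by rewrite /p0; lra.
have [F1 [F2 [F3 [F4 [_ [[i1 [i2 [i3 i4]]] hd]]]]]] := four_rays hF hJ hp0.
exists (scal (/ (2 * PI)) (plus (minus F1 F2) (minus F3 F4))); split.
  have hp : om < (om + p0) / 2 < PI / 2 by lra.
  have b1 : (om + p0) / 2 < p0 < PI - (om + p0) / 2 by lra.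
  have b2 : (om + p0) / 2 < PI - p0 < PI - (om + p0) / 2 by lra.
  have rl al be e X : (om + p0) / 2 < be < PI - (om + p0) / 2 ->
      improper (ray_G A B F J al be e) X -> right_linear X.
    by move=> hb; apply: improper_right_linear => r; apply: (rl_ray_G hom fam F J al e hp hb).
  apply: rl_scal; apply: rl_plus; apply: rl_minus.
  - exact: rl i1.
  - exact: rl i2.
  - exact: rl i3.
  - exact: rl i4.
move=> psi v ph hph; have [j1 j2] := hd psi v.
(* Below both [p0] and [ph], so that one region [Sig ph1] contains the old and the new rays. *)
set ph1 := (om + Rmin p0 ph) / 2.
have m1 := Rmin_l p0 ph; have m2 := Rmin_r p0 ph.
have m3 : om < Rmin p0 ph by apply: Rmin_glb_lt; lra.
have hph1 : om < ph1 < PI / 2 by rewrite /ph1; lra.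
have ar : forall al, ph1 < al < th -> angle_set th al by move=> al h; left; lra.
have al' : forall al, PI - th < al < PI - ph1 -> angle_set th al by move=> al h; right; lra.
have hlt : ph1 < Rmin p0 ph by rewrite /ph1; lra.
have hb1 : ph1 < ph < PI - ph1 by lra.
have hb2 : ph1 < PI - ph < PI - ph1 by lra.
have hc1 : ph1 < ph < th by lra.
have hc2 : PI - th < PI - ph < PI - ph1 by lra.
have [_ [I1 k1]] := density_integrable psi v hF hph1 (ar _ hc1) hb1.
have [_ [I2 k2]] := density_integrable psi v hF hph1 (al' _ hc2) hb2.
exists I1, I2; split=> //; split=> //.
have e1 : I1 = - / 2 * psi (minus F1 F2 v).
  case: (Rle_dec ph p0) => h.
    by apply: (density_shift hF hph1 _ _ ar _ _ _ k1 j1); lra.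
  by symmetry; apply: (density_shift hF hph1 _ _ ar _ _ _ j1 k1); lra.
have e2 : I2 = - / 2 * psi (minus F4 F3 v).
  case: (Rle_dec (PI - ph) (PI - p0)) => h.
    by apply: (density_shift hF hph1 _ _ al' _ _ _ k2 j2); lra.
  by symmetry; apply: (density_shift hF hph1 _ _ al' _ _ _ j2 k2); lra.
rewrite e1 e2 /= !(blD, blZ) /plus /opp /scal /= /mult /=.
by apply: Rminus_diag_uniq; field; lra.
Qed.
End Calculus.

(** * Multiplication by the regularizer *)

Lemma Cmod_ge (z : C) m : 0 <= m -> m * m <= z.1 ^ 2 + z.2 ^ 2 -> m <= Cmod z.
Proof.
move=> m0 h; rewrite -(sqrt_square m) //; apply: sqrt_le_1_alt; exact: h.
Qed.

(** With [q = |z|^2] and [c = cos th], the square of the right side minus that of the left is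
    [(1 - c^2) (1 - q)^2 + 4 (x^2 - c^2 q)], and the last bracket is positive on [Dth]. *)
Lemma Dth_denominator th (z : C) : 0 < th < PI / 2 -> Dth th z ->
  cos th * (1 + Cmod z * Cmod z) <= Cmod (1 + z * z)%C.
Proof.
move=> hth; rewrite /Dth Cmod_sq => hz.
have c0 : 0 < cos th by apply: cos_gt_0; lra.
have c1 : cos th * cos th <= 1 by have := sin2_cos2 th; rewrite /Rsqr; have := Rle_0_sqr (sin th); rewrite /Rsqr; lra.
case: z hz => x y /= hz.
have q0 : 0 <= x * x + y * y by have := Rle_0_sqr x; have := Rle_0_sqr y; rewrite /Rsqr; lra.
apply: Cmod_ge => /=; first by apply: Rmult_le_pos; lra.
set q := x * x + y * y in q0; have k := Rle_0_sqr (1 - q); rewrite /Rsqr in k.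
have k2 : 0 <= (1 - cos th * cos th) * ((1 - q) * (1 - q)) by apply: Rmult_le_pos; lra.
have hz' : 0 <= 4 * (x * (x * 1) - cos th * (cos th * 1) * q).
  by move: hz; rewrite (_ : x * (x * 1) + y * (y * 1) = q); [lra | rewrite /q; ring].
apply: Rminus_le.
rewrite (_ : _ - _ = - ((1 - cos th * cos th) * ((1 - q) * (1 - q)) + 4 * (x * (x * 1) - cos th * (cos th * 1) * q))).
  by clearbody q; lra.
by rewrite /q; ring.
Qed.

Definition e1 (z : C) : C := (z / (1 + z * z))%C.

Lemma denominator_neq0 th (z : C) : 0 < th < PI / 2 -> Dth th z -> (1 + z * z)%C <> 0%C.
Proof.
move=> hth hz; apply: Cneq0_mod; apply: Rlt_le_trans (Dth_denominator hth hz).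
have c0 : 0 < cos th by apply: cos_gt_0; lra.
by apply: Rmult_lt_0_compat => //; have := Cmod_ge_0 z; nra.
Qed.

Lemma e1_holo th D : 0 < th < PI / 2 -> (forall z, D z -> Dth th z) -> holo D e1.
Proof.
move=> hth h; apply: holo_div; first exact: holo_id.
  apply: holo_plus; first exact: holo_const.
  by apply: holo_mult; apply: holo_id.
by move=> z /h; apply: denominator_neq0.
Qed.

Lemma quotient_bound (c a b : R) (z d : C) : 0 < c -> c * (1 + Cmod z * Cmod z) <= Cmod d ->
  Cmod z * Cmod ((RtoC a + RtoC b * z) / d)%C <= (Rabs a + Rabs b) / c.
Proof.
move=> c0 hd; have z0 := Cmod_ge_0 z.
have p : 0 < c * (1 + Cmod z * Cmod z) by apply: Rmult_lt_0_compat => //; nra.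
have d0 : d <> 0%C by apply: Cneq0_mod; lra.
rewrite Cmod_div //.
have num : Cmod (RtoC a + RtoC b * z)%C <= Rabs a + Rabs b * Cmod z.
  by apply: Rle_trans (Cmod_triangle _ _) _; rewrite Cmod_mult !Cmod_R; lra.
have a0 := Rabs_pos a; have b0 := Rabs_pos b.
apply: (Rmult_le_reg_r (Cmod d)); first lra.
rewrite (_ : Cmod z * _ * Cmod d = Cmod z * Cmod (RtoC a + RtoC b * z)%C); last by field; lra.
apply: (Rle_trans _ ((Rabs a + Rabs b) * (1 + Cmod z * Cmod z))).
  apply: (Rle_trans _ (Cmod z * (Rabs a + Rabs b * Cmod z))).
    exact: Rmult_le_compat_l.
  have := Rmult_le_pos (Rabs a) (1 - Cmod z + Cmod z * Cmod z) a0 ltac:(nra).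
  by clear - b0; nra.
apply: (Rle_trans _ ((Rabs a + Rabs b) / c * (c * (1 + Cmod z * Cmod z)))).
  by apply: Req_le; field; lra.
apply: Rmult_le_compat_l => //; apply: Rmult_le_pos; first lra.
by apply: Rlt_le; apply: Rinv_0_lt_compat.
Qed.

Section Correction.
Context (n : nat) (th : R) (f : clifford n -> clifford n) (F : {set 'I_n} -> C -> C).
Context (hth : 0 < th < PI / 2) (hF : slice_data th f F) (a b : R) (S : {set 'I_n}).

(** The shape of what [rho_E] leaves over when [e1 z * R(z) v] is compared with [R(z) (E v)].
    Without a resolvent it is holomorphic across the real axis. *)
Definition corr (z : C) : C := (F S z * ((RtoC a + RtoC b * z) / (1 + z * z)))%C.

Lemma corr_holo D : (forall z, D z -> Dth th z) -> holo D corr.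
Proof.
move=> h; apply: holo_mult; first exact: holo_sub h (sd_holo hF S).
apply: holo_div.
- by apply: holo_plus; [apply: holo_const | apply: holo_mult; [apply: holo_const | apply: holo_id]].
- by apply: holo_plus; [apply: holo_const | apply: holo_mult; apply: holo_id].
- by move=> z /h; apply: denominator_neq0.
Qed.

Lemma corr_integrable al : angle_set th al ->
  (exists L, improper (fun r => Cmod (corr (pt r al))) L) /\ (exists l, improper (ray_im corr al) l).
Proof.
move=> hal; have [g [L [hL hg]]] := sd_int hF S hal.
have c0 : 0 < cos th by apply: cos_gt_0; lra.
set k := (Rabs a + Rabs b) / cos th.
have hkL := improper_scal k hL.
apply: ray_integrable (hkL) => r r0.
  by apply: (holo_ccont (@corr_holo (Dth th) _)) => //; apply: Dth_pt.
have dz := Dth_pt hth r0 hal.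
have q := quotient_bound a b c0 (Dth_denominator hth dz).
have e := Cmod_pt al (Rlt_le _ _ r0); rewrite e in q.
rewrite /corr Cmod_mult; have h := hg r r0.
have c1 := Cmod_ge_0 (F S (pt r al)).
apply: (Rle_trans _ (Cmod (F S (pt r al)) / r * k)).
  rewrite /Rdiv Rmult_assoc; apply: Rmult_le_compat_l => //.
  apply: (Rmult_le_reg_l r) => //; rewrite (_ : r * (/ r * k) = k); last by field; lra.
  exact: q.
rewrite Rmult_comm; apply: Rmult_le_compat_l => //; rewrite /k /Rdiv; apply: Rmult_le_pos.
  by have := Rabs_pos a; have := Rabs_pos b; lra.
by apply: Rlt_le; apply: Rinv_0_lt_compat.
Qed.

Lemma corr_bound : exists M, forall z, Dth th z -> Cmod z * Cmod (corr z) <= M.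
Proof.
have [M hM] := sd_bound hF; have c0 : 0 < cos th by apply: cos_gt_0; lra.
exists (M * ((Rabs a + Rabs b) / cos th)) => z hz.
have q := quotient_bound a b c0 (Dth_denominator hth hz).
rewrite /corr Cmod_mult -Rmult_assoc (Rmult_comm (Cmod z)) Rmult_assoc.
apply: Rmult_le_compat => //; [exact: Cmod_ge_0 | | exact: hM].
by apply: Rmult_le_pos; apply: Cmod_ge_0.
Qed.

Lemma corr_real (x : R) : Dth th (x, 0) -> (corr (x, 0)).2 = 0.
Proof.
move=> hx; have := sd_conj hF S hx.
have -> : Cconj (x, 0) = (x, 0) by rewrite /Cconj /= Ropp_0.
move=> /(congr1 snd) /= h; have {}h : (F S (x, 0)).2 = 0 by lra.
by rewrite /corr /Cmult /Cdiv /Cinv /Cplus /RtoC /= h; rewrite /Cmult /=; rewrite /Rdiv; ring.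
Qed.

(** After a shift to the positive real axis the integrand is real by [sd_conj], so its imaginary
    part integrates to 0. [corr_left] does the same on the negative real axis. *)
Lemma corr_right al : 0 <= al < th -> improper (ray_im corr al) 0.
Proof.
move=> hal; have PI0 := PI_RGT_0.
have hang x : - th < x < th -> angle_set th x by left.
have [[L1 hL1] _] := corr_integrable (hang 0 ltac:(lra)).
have [[L2 hL2] [l hl]] := corr_integrable (hang al ltac:(lra)).
have [M hM] := corr_bound.
have i0 : improper (ray_im corr 0) 0.
  apply: (improper_ext (G := fun _ => 0)); last by have := @improper_zero R_NormedModule.
  move=> r r0; have dz := Dth_pt hth r0 (hang 0 ltac:(lra)).
  rewrite /ray_im (_ : pt r 0 = (r, 0)) in dz *; last by rewrite /pt cos_0 sin_0; congr pair; ring.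
  by move: (corr_real dz); case: (corr (r, 0)) => u w /= ->; rewrite sin_0; ring.
have e0 : 0 = l; last by rewrite -e0 in hl.
apply: (@ray_shift corr (- th) th 0 al M L1 L2) hL1 hL2 i0 hl; try lra.
- by apply: corr_holo => z [r [x [r0 [hx ->]]]]; apply: Dth_pt => //; apply: hang.
- move=> r x r0 hx; have := hM (pt r x); rewrite Cmod_pt; last lra.
  by apply; apply: Dth_pt => //; apply: hang; lra.
Qed.

Lemma corr_left al : PI - th < al <= PI -> improper (ray_im corr al) 0.
Proof.
move=> hal; have PI0 := PI_RGT_0.
have hang x : PI - th < x < PI + th -> angle_set th x by right.
have [[L1 hL1] _] := corr_integrable (hang PI ltac:(lra)).
have [[L2 hL2] [l hl]] := corr_integrable (hang al ltac:(lra)).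
have [M hM] := corr_bound.
have i0 : improper (ray_im corr PI) 0.
  apply: (improper_ext (G := fun _ => 0)); last by have := @improper_zero R_NormedModule.
  move=> r r0; have dz := Dth_pt hth r0 (hang PI ltac:(lra)).
  rewrite /ray_im (_ : pt r PI = (- r, 0)) in dz *; last by rewrite /pt cos_PI sin_PI; congr pair; ring.
  by move: (corr_real dz); case: (corr (- r, 0)) => u w /= ->; rewrite sin_PI; ring.
have e0 : 0 = l; last by rewrite -e0 in hl.
symmetry; apply: (@ray_shift corr (PI - th) (PI + th) al PI M L2 L1) hL2 hL1 hl i0; try lra.
- by apply: corr_holo => z [r [x [r0 [hx ->]]]]; apply: Dth_pt => //; apply: hang.
- move=> r x r0 hx; have := hM (pt r x); rewrite Cmod_pt; last lra.
  by apply; apply: Dth_pt => //; apply: hang; lra.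
Qed.
End Correction.

Lemma Sig_Ci ph : 0 < ph < PI / 2 -> Sig ph Ci.
Proof.
move=> hph; have c0 : 0 < cos ph by apply: cos_gt_0; lra.
by split=> /=; [lra | nra].
Qed.

Section Product.
Context (n : nat) (VR : CompleteNormedModule R_AbsRing) (T : operator n VR).
Context (linT : right_linear_op T) (om : R) (hom : 0 < om < PI / 2).
Notation V := (cm_NormedModule n VR).
Notation Bd := (bounded_map n VR).
Context (A B : C -> Bd) (fam : resolvent_family T om A B).
Context (th : R) (hth : om < th < PI / 2).
Implicit Types (psi : blin V R_NormedModule) (v : V) (F : {set 'I_n} -> C -> C).

(* [(1 + z^2) R(z) E = z R(z) - (Q_i^{-1} - z E)] for [E = T (1 + T^2)^{-1}] *)
Lemma rho_E psi v ph z : om < ph < PI / 2 -> Sig ph z ->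
  ((1 + z * z) * rho psi A B (B Ci v) z =
   z * rho psi A B v z + (RtoC (- psi (A Ci v)) + RtoC (psi (B Ci v)) * z))%C.
Proof.
move=> hph hz; have hi := @Sig_Ci ph ltac:(lra).
have r := rf_res fam hph hz; have r' := rf_res fam hph hi.
have eA := congr1 psi (res_Al linT r r' v); have eA' := congr1 psi (res_Ar linT r r' v).
have eB := congr1 psi (res_Bdiff linT r r' v).
move: eA eA' eB; rewrite /minus !(blD, blN, blZ) /plus /opp /scal /= /mult /= => eA eA' eB.
have {}eB : psi (B z v) = psi (B Ci v) + (2 * (z.1 - 0) * psi (B z (B Ci v)) +
   (0 * (0 * 1) + 1 * (1 * 1) - (z.1 * (z.1 * 1) + z.2 * (z.2 * 1))) * psi (A z (B Ci v))).
  by rewrite /= in eB; lra.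
rewrite /rho /Cplus /Cmult /RtoC /=.
by congr pair; rewrite ?eB ?eA ?eA'; ring.
Qed.

(** Dividing [rho_E] by [1 + z^2] shows that the densities of [(f e)(T)] at [v] and of [f(T)] at
    [E v] differ by terms [corr]. Those integrate to 0, so the same [I1] and [I2] serve. *)
Lemma weak_calc_mul f F X : slice_data th f F -> weak_calc om A B th F X ->
  weak_calc om A B th (fun S z => F S z * e1 z)%C (bl_comp X (B Ci)).
Proof.
move=> hF [rX hX]; have PI0 := PI_RGT_0.
have hth' : 0 < th < PI / 2 by lra.
have hp : om < (om + th) / 2 < PI / 2 by lra.
have rB := res_rlB (rf_res fam hp (@Sig_Ci ((om + th) / 2) ltac:(lra))).
split; first exact: rl_comp.
move=> psi v ph hph; have [I1 [I2 [i1 [i2 e]]]] := hX psi (B Ci v) ph hph.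
exists I1, I2.
set u := fun S : {set 'I_n} => bl_comp psi (bl_lmul VR (cl_unit S)).
have eq_ray al r p : om < p < PI / 2 -> angle_set th al -> p < al < PI - p -> 0 < r ->
    ray_im (density A B F psi (B Ci v)) al r + \big[Rplus/0]_(S : {set 'I_n})
      (ray_im (corr F (u S (A Ci v)) (- u S (B Ci v)) S) al r) =
    ray_im (density A B (fun S z => F S z * e1 z)%C psi v) al r.
  move=> hp' hal h r0; rewrite /density !ray_im_csum -sumR_plus.
  apply: eq_bigr => S _; rewrite /ray_im.
  have dz := Dth_pt hth' r0 hal; have sz := @Sig_pt p r al ltac:(lra) r0 h.
  have dn := denominator_neq0 hth' dz.
  have k := rho_E (u S) v hp' sz.
  set z := pt r al in dz sz dn k *.
  have -> : (F S z * e1 z * rho (bl_comp psi (bl_lmul VR (cl_unit S))) A B v z * cis al)%C =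
      (F S z * rho (u S) A B (B Ci v) z * cis al +
       corr F (u S (A Ci v)) (- u S (B Ci v)) S z * cis al)%C.
    have -> : rho (bl_comp psi (bl_lmul VR (cl_unit S))) A B v z = rho (u S) A B v z by [].
    have e2 : rho (u S) A B (B Ci v) z = ((z * rho (u S) A B v z +
        (RtoC (- u S (A Ci v)) + RtoC (u S (B Ci v)) * z)) / (1 + z * z))%C.
      by rewrite -k; field.
    rewrite e2 /corr /e1 !RtoC_opp; field; exact: dn.
  by [].
have fin al I p : om < p < PI / 2 -> angle_set th al -> p < al < PI - p ->
    (forall S, improper (ray_im (corr F (u S (A Ci v)) (- u S (B Ci v)) S) al) 0) ->
    improper (ray_im (density A B F psi (B Ci v)) al) I ->
    improper (ray_im (density A B (fun S z => F S z * e1 z)%C psi v) al) I.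
  move=> hp' hal h h0 hI.
  have hs := @improper_sum _ (index_enum {set 'I_n}) _ _ h0.
  have := improper_plus hI hs; rewrite (_ : plus I _ = I); last first.
    rewrite /plus /= (_ : \big[Rplus/0]_(i <- _) 0 = 0) ?Rplus_0_r //.
    by apply: (big_ind (fun x => x = 0)) => // x y -> ->; ring.
  by apply: improper_ext => r r0; apply: eq_ray h r0.
have hp2 : om < (om + ph) / 2 < PI / 2 by lra.
split; [|split].
- apply: fin i1; [exact: hp2 | by left; lra | lra |].
  by move=> S; apply: (corr_right hth' hF); lra.
- apply: fin i2; [exact: hp2 | by right; lra | lra |].
  by move=> S; apply: (corr_left hth' hF); lra.
- exact: e.
Qed.
End Product.

(** * The pole at [i] and the calculus of the regularizer *)

Lemma improper_atan (k : R) : 0 < k ->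
  improper (fun r => k * (1 + r * r) / (k * k * (r * r) + (r * r - 1) * (r * r - 1))) PI.
Proof.
move=> k0; have PI0 := PI_RGT_0.
set g := fun r : R => _.
(* The primitive is [atan ((r - / r) / k)], which runs from [- PI / 2] at 0 to [PI / 2] at
   infinity. *)
pose q (r : R) := (r - / r) / k; pose G r := atan (q r).
have den r : 0 < r -> 0 < k * k * (r * r) + (r * r - 1) * (r * r - 1).
  move=> r0; have h1 := Rmult_lt_0_compat _ _ r0 r0; have h2 := Rmult_lt_0_compat _ _ k0 k0.
  by have := Rmult_lt_0_compat _ _ h2 h1; have := Rle_0_sqr (r * r - 1); rewrite /Rsqr; lra.
have dG r : 0 < r -> is_derive G r (g r).
  move=> r0; rewrite /G /q /g; auto_derive; first by lra.
  by rewrite /Rsqr; field; have := den r r0; lra.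
have cg r : 0 < r -> continuous g r.
  move=> r0; apply: ex_derive_continuous; rewrite /g; auto_derive.
  by have := den r r0; lra.
apply/improperP => eps; set e := Rmin (eps / 2) (PI / 4).
have e0 : 0 < e by apply: Rmin_pos; have := cond_pos eps; lra.
have e1 := Rmin_l (eps / 2) (PI / 4); have e2 := Rmin_r (eps / 2) (PI / 4).
rewrite -/e in e1 e2.
set M := tan (PI / 2 - e).
have M0 : 0 < M by apply: tan_gt_0; lra.
have aM : atan M = PI / 2 - e by apply: atan_tan; lra.
have p : 0 < 1 + k * M by have := Rmult_lt_0_compat _ _ k0 M0; lra.
have big r : 1 + k * M < r -> M < q r.
  move=> hr; have r1 : 1 < r by have := Rmult_lt_0_compat _ _ k0 M0; lra.
  have i1 : / r < 1 by rewrite -Rinv_1; apply: Rinv_lt_contravar; lra.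
  apply: (Rmult_lt_reg_r k) => //; rewrite /q (_ : (r - / r) / k * k = r - / r); [lra | by field; lra].
(* Inverting [r] exchanges the two ends, so the estimate [big] at infinity also serves at 0. *)
have qinv r : 0 < r -> q (/ r) = - q r by move=> r0; rewrite /q Rinv_inv /Rdiv; ring.
exists (/ (1 + k * M)); split; first exact: Rinv_0_lt_compat.
move=> a b [a0 ha] hb; rewrite Rinv_inv in hb.
exists (G b - G a); split.
  have b0 : 0 < b by lra.
  apply: is_RInt_derive => x [hx _]; have x0 : 0 < x by apply: Rlt_le_trans hx; apply: Rmin_pos.
    exact: dG.
  exact: cg.
have hB : PI / 2 - e < G b by rewrite -aM; apply: atan_increasing; apply: big.
have hA : PI / 2 - e < - G a.
  rewrite /G -atan_opp -qinv // -aM; apply: atan_increasing; apply: big.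
  by rewrite -(Rinv_inv (1 + k * M)); apply: Rinv_lt_contravar => //; apply: Rmult_lt_0_compat => //; apply: Rinv_0_lt_compat.
have := atan_bound (q a); have := atan_bound (q b); rewrite -/(G a) -/(G b) => h1 h2.
by apply/ball_R; apply: Rabs_def1; lra.
Qed.

Lemma cos_PI_minus x : cos (PI - x) = - cos x.
Proof. by rewrite /Rminus Rplus_comm neg_cos cos_neg. Qed.

Lemma pt_reflect r al : pt r (PI - al) = (- Cconj (pt r al))%C.
Proof. by rewrite /pt /Cconj /Copp /= cos_PI_minus sin_PI_x; congr pair; ring. Qed.

Lemma ray_im_reflect (H : C -> C) al r : H (- Cconj (pt r al))%C = Cconj (H (pt r al)) ->
  ray_im H (PI - al) r = ray_im H al r.
Proof.
by move=> h; rewrite /ray_im pt_reflect h /cis cos_PI_minus sin_PI_x /=; ring.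
Qed.

Definition pole (z : C) : C := (Ci / (1 + z * z))%C.

(** On the ray the squared modulus of [1 + z^2] is [(2 cos al)^2 r^2 + (r^2 - 1)^2], the denominator
    in [improper_atan]. *)
Lemma ray_im_pole al r : 0 < r -> cos al <> 0 -> let k := 2 * cos al in
  ray_im pole al r = / 2 * (k * (1 + r * r) / (k * k * (r * r) + (r * r - 1) * (r * r - 1))).
Proof.
move=> r0 c0 /=; set c := cos al in c0 *; set D := 2 * c * (2 * c) * _ + _.
have sc := sin2_cos2 al; rewrite /Rsqr -/c in sc; set s := sin al in sc.
have D0 : D <> 0.
  have h1 := Rmult_lt_0_compat _ _ r0 r0; have h2 := Rsqr_pos_lt _ c0; rewrite /Rsqr in h2.
  by have := Rmult_lt_0_compat _ _ h2 h1; have := Rle_0_sqr (r * r - 1); rewrite /D /Rsqr; lra.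
pose x := 1 + r * r * (c * c - s * s); pose y := 2 * (r * r) * c * s.
have eN : x ^ 2 + y ^ 2 = D.
  rewrite (_ : x ^ 2 + y ^ 2 = 1 + 2 * (r * r) * (c * c * 2 - (s * s + c * c)) +
     r * r * (r * r) * ((s * s + c * c) * (s * s + c * c))); last by rewrite /x /y; ring.
  by rewrite sc /D; ring.
have ew : (1 + pt r al * pt r al)%C = (x, y) :> C.
  by rewrite /pt -/c -/s /Cplus /Cmult /RtoC /x /y /=; congr pair; ring.
rewrite /ray_im /pole ew /Cdiv /Cinv /cis -/c -/s; change (fst (x, y)) with x; change (snd (x, y)) with y.
rewrite eN; transitivity ((y * s + x * c) / D); first by rewrite /Cmult /=; field.
rewrite (_ : y * s + x * c = c * (1 + r * r * (s * s + c * c))); last by rewrite /x /y; ring.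
by rewrite sc; field.
Qed.

(** Passing to [PI - al] changes the sign of the cosine and hence of the integrand. The jump [PI] is
    the imaginary part of [2 pi i] times the residue [1 / 2] at [i]. *)
Lemma improper_pole al : 0 < al < PI / 2 ->
  improper (ray_im pole al) (PI / 2) /\ improper (ray_im pole (PI - al)) (- (PI / 2)).
Proof.
move=> hal; have c0 : 0 < cos al by apply: cos_gt_0; lra.
have h := improper_scal (/ 2) (improper_atan (k := 2 * cos al) ltac:(lra)).
have e : scal (/ 2) PI = PI / 2 :> R by rewrite /scal /= /mult /=; field.
have pI : improper (ray_im pole al) (PI / 2).
  by rewrite -e; apply: improper_ext h => r r0; rewrite ray_im_pole //; lra.
split=> //; have := improper_scal (-1) pI.
rewrite (_ : scal (-1) (PI / 2) = - (PI / 2)); last by rewrite /scal /= /mult /=; ring.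
apply: improper_ext => r r0; rewrite !ray_im_pole ?cos_PI_minus //; try lra.
rewrite /scal /= /mult /=; rewrite (_ : 2 * - cos al * (2 * - cos al) = 2 * cos al * (2 * cos al)); last ring.
by rewrite /Rdiv; ring.
Qed.

Lemma e1_le th (z : C) : 0 < th < PI / 2 -> Dth th z -> Cmod (e1 z) <= / cos th.
Proof.
move=> hth hz; have c0 : 0 < cos th by apply: cos_gt_0; lra.
have hd := Dth_denominator hth hz; have z0 := Cmod_ge_0 z.
have p : 0 < cos th * (1 + Cmod z * Cmod z) by apply: Rmult_lt_0_compat => //; nra.
rewrite /e1 Cmod_div; last exact: denominator_neq0 hth hz.
apply: (Rmult_le_reg_r (Cmod (1 + z * z)%C)); first lra.
rewrite /Rdiv Rmult_assoc Rinv_l ?Rmult_1_r; last lra.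
apply: (Rmult_le_reg_l (cos th)) => //; rewrite -Rmult_assoc Rinv_r ?Rmult_1_l; last lra.
apply: Rle_trans hd; apply: Rmult_le_compat_l; first lra.
by nra.
Qed.

Lemma e1_conj (z : C) : (1 + z * z)%C <> 0%C -> e1 (Cconj z) = Cconj (e1 z).
Proof.
move=> h; rewrite /e1 Cdiv_conj // Cplus_conj Cmult_conj.
by rewrite (_ : Cconj 1 = 1%C) // /Cconj /RtoC /= Ropp_0.
Qed.

(** The integrand of [improper_atan] at [k = 1], left unsimplified to match it; an integrable
    function dominating [1 / (1 + r^2)]. *)
Definition majorant (r : R) : R := 1 * (1 + r * r) / (1 * 1 * (r * r) + (r * r - 1) * (r * r - 1)).

Lemma le_majorant (c x r : R) : 0 <= c -> 0 < r -> x * (1 + r * r) <= c -> x <= c * majorant r.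
Proof.
move=> c0 r0 h; have r2 := Rmult_lt_0_compat _ _ r0 r0.
have d : 0 < r * r + (r * r - 1) * (r * r - 1) by have := Rle_0_sqr (r * r - 1); rewrite /Rsqr; lra.
apply: (Rmult_le_reg_r (1 + r * r)); first lra.
apply: Rle_trans h _; rewrite Rmult_assoc -{1}(Rmult_1_r c); apply: Rmult_le_compat_l => //.
apply: (Rmult_le_reg_r (r * r + (r * r - 1) * (r * r - 1))) => //.
rewrite (_ : majorant r * _ * _ = (1 + r * r) * (1 + r * r)); last by rewrite /majorant; field; lra.
by nra.
Qed.

Lemma improper_majorant c : improper (fun r => c * majorant r) (c * PI).
Proof. exact: (improper_scal c (improper_atan Rlt_0_1)). Qed.
Arguments improper_majorant c : clear implicits.

Definition stem1 n (S : {set 'I_n}) (z : C) : C := if S == set0 then e1 z else 0%C.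

Lemma slice_data_regularizer1 n th : 0 < th < PI / 2 ->
  slice_data (n := n) th (regularizer 1) (@stem1 n).
Proof.
move=> hth; have c0 : 0 < cos th by apply: cos_gt_0; lra.
have ic0 : 0 < / cos th by apply: Rinv_0_lt_compat.
split.
- move=> z J hz hJ; rewrite regularizer_slice //.
  have -> : regz 1 z = e1 z by rewrite /regz /e1 /Cpow /= !Cmult_1_r.
  have -> : stem_im (@stem1 n) z = scal (e1 z).2 (cl_unit set0) :> clifford n.
    by apply/ffunP => S; rewrite !ffunE /stem1 /scal /= /mult /=; case: eqP => _ /=; ring.
  have -> : stem_re (@stem1 n) z = cl_real n (e1 z).1.
    by apply/ffunP => S; rewrite !ffunE /stem1 /scal /= /mult /=; case: eqP => _ /=; ring.
  rewrite cl_lmulZl cl_lmul_unit0.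
  by [].
- move=> S; rewrite /stem1; case: eqP => _; last exact: holo_const.
  exact: (e1_holo hth).
- move=> S z hz; rewrite /stem1; case: eqP => _; last by rewrite /Cconj /RtoC /= Ropp_0.
  by apply: e1_conj; apply: denominator_neq0 hth hz.
- exists (/ cos th) => S z hz; rewrite /stem1; case: eqP => _; first exact: e1_le.
  by rewrite Cmod_0; lra.
- move=> S al hal; exists (fun r => / cos th * majorant r), (/ cos th * PI); split; first by have := improper_majorant (/ cos th).
  move=> r r0; apply: le_majorant => //; first lra.
  rewrite /stem1; case: eqP => _; last by rewrite Cmod_0 /Rdiv; lra.
  have dz := Dth_pt hth r0 hal; have dn := denominator_neq0 hth dz.
  have e := Cmod_pt al (Rlt_le _ _ r0).
  have d := Dth_denominator hth dz; rewrite e in d.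
  rewrite /e1 Cmod_div // e; have d0 : 0 < cos th * (1 + r * r) by apply: Rmult_lt_0_compat => //; nra.
  move: (Cmod (1 + pt r al * pt r al)%C) d => D d.
  rewrite (_ : r / D / r * (1 + r * r) = (1 + r * r) / D); last by field; lra.
  apply: (Rmult_le_reg_r D); first lra.
  rewrite (_ : (1 + r * r) / D * D = 1 + r * r); last by field; lra.
  apply: (Rmult_le_reg_l (cos th)) => //; rewrite -Rmult_assoc Rinv_r; lra.
Qed.

Lemma slice_data_ext n th (f g : clifford n -> clifford n) F :
  (forall z J, Dth th z -> imag_unit J -> f (slice z J) = g (slice z J)) ->
  slice_data th f F -> slice_data th g F.
Proof.
move=> h hF; split; [|exact: sd_holo hF|exact: sd_conj hF|exact: sd_bound hF|exact: sd_int hF].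
by move=> z J hz hJ; rewrite -h // (sd_val hF).
Qed.

Lemma regz_pow k z : (1 + z * z)%C <> 0%C -> regz k z = Cpow (e1 z) k.
Proof.
move=> h; rewrite /regz /e1; elim: k => [|k IH] /=; first by field.
rewrite -IH; field; split=> //; exact: Cpow_nz.
Qed.

Lemma holo_pow D F k : holo D F -> holo D (fun z => Cpow (F z) k).
Proof.
by move=> h; elim: k => [|k IH] /=; [apply: holo_const | apply: holo_mult].
Qed.

Lemma Cmod_pow_le z c k : Cmod z <= c -> Cmod (Cpow z k) <= c ^ k.
Proof.
move=> h; elim: k => [|k IH] /=; first by rewrite Cmod_1; lra.
by rewrite Cmod_mult; apply: Rmult_le_compat => //; apply: Cmod_ge_0.
Qed.

Definition twist n (k : nat) (F : {set 'I_n} -> C -> C) S z : C := (F S z * Cpow (e1 z) k)%C.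

Lemma slice_data_twist n th (f : clifford n -> clifford n) F k : 0 < th < PI / 2 ->
  slice_data th f F ->
  slice_data th (fun s => cl_mul (f s) (regularizer k s)) (twist k F).
Proof.
move=> hth hF; have nz z := @denominator_neq0 th z hth.
apply: (slice_data_mul (K := (/ cos th) ^ k) hF) => //.
- by move=> z J hz hJ; rewrite regularizer_slice // regz_pow //; apply: nz.
- exact: holo_pow (e1_holo hth _).
- by move=> z hz; rewrite Cpow_conj e1_conj //; apply: nz.
- by move=> z hz; apply: Cmod_pow_le; apply: e1_le.
Qed.

(** One factor [e1] sits in [stem1] and supplies the decay at 0 and at infinity; the other [k] are
    bounded multipliers. *)
Lemma slice_data_regularizer n th k : 0 < th < PI / 2 ->
  slice_data (n := n) th (regularizer k.+1) (twist k (@stem1 n)).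
Proof.
move=> hth; have := slice_data_twist k hth (slice_data_regularizer1 n hth).
apply: slice_data_ext => z J hz hJ; rewrite !regularizer_slice // slice_mul //.
have nz := denominator_neq0 hth hz.
by congr slice; rewrite !regz_pow // /= Cmult_1_r.
Qed.

Section Residue.
Context (n : nat) (VR : CompleteNormedModule R_AbsRing) (T : operator n VR).
Context (linT : right_linear_op T) (om : R) (hom : 0 < om < PI / 2).
Notation V := (cm_NormedModule n VR).
Notation Bd := (bounded_map n VR).
Context (A B : C -> Bd) (fam : resolvent_family T om A B).
Context (th : R) (hth : om < th < PI / 2).
Implicit Types (psi : blin V R_NormedModule) (v : V) (F : {set 'I_n} -> C -> C).

Fixpoint bl_twist (Y X : Bd) (k : nat) : Bd :=
  if k is k'.+1 then bl_comp (bl_twist Y X k') X else Y.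

Lemma weak_calc_twist f F X k : slice_data th f F -> weak_calc om A B th F X ->
  weak_calc om A B th (twist k F) (bl_twist X (B Ci) k).
Proof.
move=> hF hX; have hth' : 0 < th < PI / 2 by lra.
elim: k => [|k IH] /=.
  rewrite (_ : twist 0 F = F) //; apply: functional_extensionality => S.
  by apply: functional_extensionality => z; rewrite /twist /= Cmult_1_r.
rewrite (_ : twist k.+1 F = fun S z => (twist k F S z * e1 z)%C).
  exact: (weak_calc_mul linT hom fam hth (slice_data_twist k hth' hF) IH).
apply: functional_extensionality => S; apply: functional_extensionality => z.
by rewrite /twist /=; ring.
Qed.

Lemma density_stem1 psi v z : density A B (@stem1 n) psi v z = (e1 z * rho psi A B v z)%C.
Proof.
have key (s : seq {set 'I_n}) (H : {set 'I_n} -> C) : uniq s ->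
    \big[Cplus/RtoC 0]_(S <- s) (if S == set0 then H S else 0%C) = if set0 \in s then H set0 else 0%C.
  elim: s => [|S s IH] /=; first by rewrite big_nil.
  move=> /andP [Ss us]; rewrite big_cons IH // in_cons (eq_sym set0).
  case: eqP => [e|_] /=; last by case: (_ \in s); ring.
  by rewrite -e (negbTE Ss); ring.
rewrite /density /csum.
pose H (S : {set 'I_n}) := (e1 z * rho (bl_comp psi (bl_lmul VR (cl_unit S))) A B v z)%C.
transitivity (\big[Cplus/RtoC 0]_(S : {set 'I_n}) (if S == set0 then H S else 0%C)).
  by apply: eq_bigr => S _; rewrite /stem1 /H; case: eqP => // _; ring.
rewrite key ?index_enum_uniq // mem_index_enum /H (_ : bl_comp psi _ = psi) //.
by apply: blinP => u; rewrite /= cl_lmul_unit0.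
Qed.

(** What remains of [e1 z * R(z) v] once the terms with denominator [1 + z^2] are split off; [z + i]
    has no zero in the upper half plane. *)
Definition regular_part psi v (z : C) : C :=
  (rho psi A B (B Ci v) z - RtoC (psi (B Ci v)) / (z + Ci))%C.

Lemma Cmod_plus_Ci ph z : Sig ph z -> Cmod z <= Cmod (z + Ci)%C /\ 0 < Cmod (z + Ci)%C.
Proof.
move=> hz; have z0 := Sig_pos hz; suff h : Cmod z <= Cmod (z + Ci)%C by split=> //; lra.
by case: hz => y0 _; apply: sqrt_le_1_alt; rewrite /=; nra.
Qed.

(** Divide [rho_E] by [1 + z^2] and use the partial fraction [z / (1 + z^2) = 1 / (z + i) + i / (1 +
    z^2)]. *)
Lemma density_split psi v ph z : om < ph < PI / 2 -> Sig ph z -> Dth th z ->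
  (e1 z * rho psi A B v z = regular_part psi v z +
     (RtoC (psi (A Ci v)) / (1 + z * z) - RtoC (psi (B Ci v)) * pole z))%C.
Proof.
move=> hph hz dz; have hth' : 0 < th < PI / 2 by lra.
have d0 := denominator_neq0 hth' dz.
have zi : (z + Ci)%C <> 0%C by apply: Cneq0_mod; case: (Cmod_plus_Ci hz).
have e2 : (1 + z * z)%C = ((z + Ci) * (z - Ci))%C.
  by rewrite /Cmult /Cplus /Cminus /Copp /Ci /RtoC /=; congr pair; ring.
have zi' : (z - Ci)%C <> 0%C by move=> e; apply: d0; rewrite e2 e; ring.
have k := rho_E linT hom fam psi v hph hz; rewrite RtoC_opp in k.
have -> : (e1 z * rho psi A B v z)%C = ((z * rho psi A B v z) / (1 + z * z))%C.
  by rewrite /e1; field.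
have -> : (z * rho psi A B v z = (1 + z * z) * rho psi A B (B Ci v) z + psi (A Ci v) - psi (B Ci v) * z)%C.
  by rewrite k; ring.
rewrite /regular_part /pole e2; field; by split.
Qed.

(** Of the three terms of [density_split], the regular part has equal integrals at [ph] and
    [PI - ph] by [ray_shift], and the term with [psi (A Ci v)] by reflection in the imaginary axis.
    The pole term changes by [PI * psi (B Ci v)], so this is all that survives in [I2 - I1]. *)
Lemma weak_calc_stem1 : weak_calc om A B th (@stem1 n) (B Ci).
Proof.
have PI0 := PI_RGT_0; have hth' : 0 < th < PI / 2 by lra.
have hq : om < (om + th) / 2 < PI / 2 by lra.
have rB := res_rlB (rf_res fam hq (@Sig_Ci ((om + th) / 2) ltac:(lra))).
split; first exact: rB.
move=> psi v ph hph.
have hF := slice_data_regularizer1 n hth'.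
set p := (om + ph) / 2.
have hp : om < p < PI / 2 by rewrite /p; lra.
have hp' : 0 < p < PI / 2 by lra.
have b1 : p < ph < PI - p by rewrite /p; lra.
have b2 : p < PI - ph < PI - p by rewrite /p; lra.
have a1 : angle_set th ph by left; lra.
have a2 : angle_set th (PI - ph) by right; lra.
have [[L1 hL1] [I1 i1]] := density_integrable linT hom fam hth psi v hF hp a1 b1.
have [[L2 hL2] [I2 i2]] := density_integrable linT hom fam hth psi v hF hp a2 b2.
exists I1, I2; split=> //; split=> //.
set a := psi (A Ci v); set b := psi (B Ci v).
pose Y z : C := (RtoC a / (1 + z * z))%C.
have c0 : 0 < cos th by apply: cos_gt_0; lra.
have ic0 : 0 < / cos th by apply: Rinv_0_lt_compat.
have bd k al r : angle_set th al -> 0 < r ->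
    Cmod (k / (1 + pt r al * pt r al))%C <= Cmod k * / cos th * majorant r.
  move=> hal r0; have dz := Dth_pt hth' r0 hal; have k0 := Cmod_ge_0 k.
  apply: le_majorant => //; first by apply: Rmult_le_pos; lra.
  have dn := denominator_neq0 hth' dz; have d := Dth_denominator hth' dz.
  rewrite (Cmod_pt al (Rlt_le _ _ r0)) in d; rewrite Cmod_div //.
  have d0 : 0 < cos th * (1 + r * r) by apply: Rmult_lt_0_compat => //; nra.
  move: (Cmod (1 + pt r al * pt r al)%C) d => D d.
  rewrite /Rdiv !Rmult_assoc; apply: Rmult_le_compat_l => //.
  apply: (Rmult_le_reg_r (cos th * D)); first by apply: Rmult_lt_0_compat; lra.
  rewrite (_ : / D * (1 + r * r) * (cos th * D) = cos th * (1 + r * r)); last by field; lra.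
  by rewrite (_ : / cos th * (cos th * D) = D) //; field; lra.
have cY al r : angle_set th al -> 0 < r -> ccont Y (pt r al).
  move=> hal r0; have dz := Dth_pt hth' r0 hal.
  apply: (@ccont_mult (fun _ => RtoC a) (fun z => / (1 + z * z))%C); first exact: ccont_const.
  apply: ccont_inv; last exact: denominator_neq0 hth' dz.
  apply: (@ccont_plus (fun _ => RtoC 1) (fun z => z * z)%C); first exact: ccont_const.
  by apply: (@ccont_mult (fun z => z) (fun z => z)); apply: ccont_id.
have [_ [LY1 y1]] : (exists L, improper (fun r => Cmod (Y (pt r ph))) L) /\ (exists l, improper (ray_im Y ph) l).
  have m := improper_majorant (Cmod (RtoC a) * / cos th).
  by apply: ray_integrable (m) => r r0; [exact: cY | exact: bd].
have y2 : improper (ray_im Y (PI - ph)) LY1.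
  apply: improper_ext y1 => r r0; symmetry; apply: ray_im_reflect.
  have dn := denominator_neq0 hth' (Dth_pt hth' r0 a1).
  rewrite /Y; set z := pt r ph in dn *.
  rewrite Cdiv_conj // Cplus_conj Cmult_conj.
  have cr (x : R) : Cconj (RtoC x) = RtoC x by rewrite /Cconj /RtoC /= Ropp_0.
  by rewrite !cr; congr Cdiv; ring.
have [p1 p2] := improper_pole (al := ph) ltac:(lra).
pose R0 := regular_part psi v.
have hR : holo (Sig p) R0.
  apply: holo_minus; first exact: (rho_holo linT fam psi (B Ci v) hp).
  apply: holo_div; first exact: holo_const.
    by apply: holo_plus; [apply: holo_id | apply: holo_const].
  by move=> z hz; apply: Cneq0_mod; case: (Cmod_plus_Ci hz).
have split_at al r : angle_set th al -> p < al < PI - p -> 0 < r ->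
    density A B (@stem1 n) psi v (pt r al) = (R0 (pt r al) + (Y (pt r al) - RtoC b * pole (pt r al)))%C.
  move=> hal hb r0; rewrite density_stem1; apply: density_split hp _ _; last exact: Dth_pt.
  by apply: Sig_pt => //; lra.
have iR al L : angle_set th al -> p < al < PI - p ->
    improper (fun r => Cmod (density A B (@stem1 n) psi v (pt r al))) L ->
    (exists L', improper (fun r => Cmod (R0 (pt r al))) L') /\ (exists l, improper (ray_im R0 al) l).
  move=> hal hb hL.
  have m1 := improper_majorant (Cmod (RtoC a) * / cos th).
  have m2 := improper_majorant (Cmod (RtoC b * Ci)%C * / cos th).
  have m := improper_plus hL (improper_plus m1 m2).
  apply: ray_integrable (m) => r r0.
    by apply: holo_ccont hR _; apply: Sig_pt => //; lra.
  have -> : R0 (pt r al) = (density A B (@stem1 n) psi v (pt r al) +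
      (- Y (pt r al) + (RtoC b * Ci) / (1 + pt r al * pt r al)))%C.
    by rewrite split_at // /pole /Cdiv; ring.
  apply: Rle_trans (Cmod_triangle _ _) _; apply: Rplus_le_compat_l.
  apply: Rle_trans (Cmod_triangle _ _) _; rewrite Cmod_opp; apply: Rplus_le_compat; exact: bd.
have [[K1 k1] [l1 r1]] := iR _ _ a1 b1 hL1; have [[K2 k2] [l2 r2]] := iR _ _ a2 b2 hL2.
have sum_at al I l y q : angle_set th al -> p < al < PI - p ->
    improper (ray_im (density A B (@stem1 n) psi v) al) I -> improper (ray_im R0 al) l ->
    improper (ray_im Y al) y -> improper (ray_im pole al) q -> I = l + (y - b * q).
  move=> hal hb hI hl hy hr; apply: (improper_unique hI).
  apply: improper_ext (improper_plus hl (improper_minus hy (improper_scal b hr))) => r r0.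
  rewrite /ray_im split_at //; move: (R0 _) (Y _) (pole _) => x y' q'.
  by rewrite /minus /plus /opp /scal /= /mult /=; ring.
have [K0 [K00 hK0]] := rho_bound fam psi (B Ci v) hp.
have l12 : l1 = l2.
  apply: (@ray_shift R0 p (PI - p) ph (PI - ph) (K0 + Rabs b) K1 K2) k1 k2 r1 r2; try lra.
  - by apply: holo_sub hR => z [r [al [r0 [hal ->]]]]; apply: Sig_pt => //; lra.
  - move=> r al r0 hal; have sz : Sig p (pt r al) by apply: Sig_pt; lra.
    have := hK0 _ sz; have [m1 m2] := Cmod_plus_Ci sz.
    have e := Cmod_pt al (Rlt_le _ _ r0); rewrite e in m1 *; move=> h.
    apply: (Rle_trans _ (r * (Cmod (rho psi A B (B Ci v) (pt r al)) + Rabs b / Cmod (pt r al + Ci)%C))).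
      apply: Rmult_le_compat_l; first lra.
      apply: Rle_trans (Cmod_triangle _ _) _; rewrite Cmod_opp Cmod_div ?Cmod_R; first exact: Rle_refl.
      exact: Cneq0_mod.
    rewrite Rmult_plus_distr_l; apply: Rplus_le_compat => //.
    rewrite (_ : r * _ = Rabs b * (r / Cmod (pt r al + Ci)%C)); last by rewrite /Rdiv; ring.
    rewrite -{2}(Rmult_1_r (Rabs b)); apply: Rmult_le_compat_l; first exact: Rabs_pos.
    by apply/Rle_div_l; lra.
rewrite (sum_at _ _ _ _ _ a1 b1 i1 r1 y1 p1) (sum_at _ _ _ _ _ a2 b2 i2 r2 y2 p2) l12.
by apply: Rminus_diag_uniq; field; lra.
Qed.
End Residue.

(** * Density of the range *)

Lemma bounded_limsup (u : nat -> R) M : (forall k, Rabs (u k) <= M) ->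
  exists l, is_LimSup_seq u (Finite l).
Proof.
move=> hM; have [[l||] h] := ex_LimSup_seq u; first by exists l.
- by have [k [_ hk]] := h M O; have /Rabs_le_between := hM k; lra.
- by have [k hk] := h (- M); have := hk k (Nat.le_refl k); have /Rabs_le_between := hM k; lra.
Qed.

Section WeakLimit.
Context (E : NormedModule R_AbsRing).

(* The limit superior along [x] is sublinear on the dual; a linear functional below it
   is evaluation at some [w] by reflexivity. *)
Lemma reflexive_weak_limit (x : nat -> E) (M : R) : reflexive_space E ->
  (forall k, norm (x k) <= M) ->
  exists w, forall (phi : blin E R_NormedModule) (l c : R),
    (forall k, Rabs (phi (x k) - l) <= c / INR k.+1) -> phi w = l.
Proof.
move=> refl hM; have M0 : 0 <= M by apply: Rle_trans (norm_ge_0 _) (hM O).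
have hb (phi : blin E R_NormedModule) k : Rabs (phi (x k)) <= norm phi * M.
  apply: Rle_trans (bl_norm_apply phi (x k)) _.
  by apply: Rmult_le_compat_l (hM k); apply: norm_ge_0.
have [p hp] := ClassicalEpsilon.choice _ (fun phi : blin E R_NormedModule => bounded_limsup (hb phi)).
pose D := blin E R_NormedModule.
have pmax (phi : D) c : (exists N, forall k, (N <= k)%coq_nat -> phi (x k) <= c) -> p phi <= c.
  move=> [N hN]; apply: Rnot_lt_le => h; have e0 : 0 < p phi - c by lra.
  have [h1 _] := hp phi (mkposreal _ e0); have [k [Nk /= hk]] := h1 N.
  by have := hN k Nk; lra.
have pev (phi : D) (e : R) : 0 < e -> exists N, forall k, (N <= k)%coq_nat -> phi (x k) < p phi + e.
  by move=> e0; have [_ h2] := hp phi (mkposreal _ e0).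
have sp : sublinear (p : bl_NormedModule E R_NormedModule -> R).
  split.
  - move=> a b; apply: Rnot_lt_le => h; set e := (p (plus a b) - (p a + p b)) / 2.
    have e0 : 0 < e / 2 by rewrite /e; lra.
    have [N1 h1] := pev a _ e0; have [N2 h2] := pev b _ e0.
    suff : p (plus a b) <= p a + p b + e by rewrite /e; lra.
    apply: pmax; exists (Nat.max N1 N2) => k hk.
    have := h1 k (Nat.le_trans _ _ _ (Nat.le_max_l _ _) hk).
    have := h2 k (Nat.le_trans _ _ _ (Nat.le_max_r _ _) hk).
    rewrite bl_plusE /plus /=; lra.
  - move=> t a t0; apply: Rnot_lt_le => h; set e := (p (scal t a) - t * p a) / 2.
    have e0 : 0 < e / t by apply: Rdiv_lt_0_compat; rewrite /e; lra.
    have [N1 h1] := pev a _ e0.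
    suff : p (scal t a) <= t * p a + e by rewrite /e; lra.
    apply: pmax; exists N1 => k hk; rewrite bl_scalE /scal /= /mult /=.
    have := Rmult_lt_compat_l _ _ _ t0 (h1 k hk).
    by rewrite Rmult_plus_distr_l (_ : t * (e / t) = e); [lra | field; lra].
have [l [lD [lZ [lp _]]]] := hahn_banach (zero : bl_NormedModule E R_NormedModule) sp.
have lN a : l (opp a) = - l a by rewrite -(@scal_opp_one R_Ring) lZ /opp /one /=; ring.
have pn (phi : D) : p phi <= norm phi * M.
  by apply: pmax; exists O => k _; have /Rabs_le_between := hb phi k; lra.
have ll : is_linear (l : bl_NormedModule E R_NormedModule -> R_NormedModule).
  split=> //; exists (M + 1); split; first lra.
  move=> phi; change (Rabs (l phi) <= (M + 1) * norm phi); apply: Rabs_le.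
  have := lp phi; have := lp (opp phi); have := pn phi; have := pn (opp phi).
  by have := norm_ge_0 phi; rewrite lN norm_opp; lra.
have [w hw] := refl (Blin ll); exists w => phi r c h.
rewrite -hw /=.
(* Convergence at an explicit rate bounds the limit superior by [s]. Used for [phi] and for
   [opp phi], it forces [l phi] to be the limit. *)
have small (psi : D) s : (forall k, Rabs (psi (x k) - s) <= c / INR k.+1) -> p psi <= s.
  move=> hs; apply: Rnot_lt_le => lt; set e := (p psi - s) / 2.
  have e0 : 0 < e by rewrite /e; lra.
  suff : p psi <= s + e by rewrite /e; lra.
  apply: pmax; have c0 : 0 <= c.
    by have := hs O; rewrite /= Rdiv_1_r; have := Rabs_pos (psi (x O) - s); lra.
  have [N hN] := INR_unbounded (c / e); exists N => k Nk.
  have hk : c / INR k.+1 <= e.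
    have k0 : 0 < INR k.+1 by apply: lt_0_INR; apply: Nat.lt_0_succ.
    have Nk' : INR N <= INR k.+1 by apply: le_INR; apply: Nat.le_trans Nk (Nat.le_succ_diag_r _).
    apply/Rle_div_l => //; apply: (Rmult_le_reg_r (/ e)); first exact: Rinv_0_lt_compat.
    by rewrite (_ : e * INR k.+1 * / e = INR k.+1); [move: hN; rewrite /Rdiv; lra | field; lra].
  by have /Rabs_le_between := hs k; lra.
have h1 := small phi r h.
have h2 : p (opp phi) <= - r.
  apply: small => k; rewrite bl_oppE /opp /= (_ : - phi (x k) - - r = - (phi (x k) - r)); last ring.
  by rewrite Rabs_Ropp.
by have := lp phi; have := lp (opp phi); rewrite lN; lra.
Qed.
End WeakLimit.

Section DenseRange.
Context (n : nat) (VR : CompleteNormedModule R_AbsRing) (T : operator n VR).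
Context (linT : right_linear_op T) (injT : injective_op T) (om : R) (hom : 0 < om < PI / 2).
Notation V := (cm_NormedModule n VR).
Notation Bd := (bounded_map n VR).
Context (A B : C -> Bd) (fam : resolvent_family T om A B).
Context (refl : reflexive_space V).
Implicit Types (psi phi : blin V R_NormedModule) (v u w : V).

Let ph := (om + PI / 2) / 2.
Let hph : om < ph < PI / 2.
Proof. rewrite /ph; lra. Qed.
Let ri : res T Ci (A Ci) (B Ci).
Proof. by apply: (rf_res fam hph); apply: Sig_Ci; have := hph; lra. Qed.

Lemma A_injective v : A Ci v = zero -> v = zero.
Proof.
move=> h; have hB := res_TA ri v; rewrite h in hB.
have B0 := opT_fun linT hB (op_zero linT).
have := res_TB ri v; rewrite h B0 => k.
have := opT_fun linT k (op_zero linT).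
by move=> <-; rewrite !scal_zero_r /minus opp_zero !plus_zero_r.
Qed.

Lemma B_injective v : B Ci v = zero -> v = zero.
Proof.
move=> h; apply: A_injective; have k := res_TA ri v; rewrite h in k.
exact: (injT k (op_zero linT)).
Qed.

Definition it (t : R) : C := (0, t).
Lemma res_it t : 0 < t -> res T (it t) (A (it t)) (B (it t)).
Proof.
move=> t0; apply: (rf_res fam hph); split=> //=.
have c0 : 0 < cos ph by apply: cos_gt_0; have := hph; lra.
have := Rmult_lt_0_compat _ _ (Rmult_lt_0_compat _ _ c0 t0) (Rmult_lt_0_compat _ _ c0 t0); lra.
Qed.

Lemma it_bound : exists K, 0 <= K /\ forall t, 0 < t ->
  norm (A (it t)) * (t * t) <= K /\ norm (B (it t)) * t <= K.
Proof.
have [K [K0 hK]] := rf_bound fam hph; exists K; split=> // t t0.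
have [s1 s2] : Sig ph (it t).
  split=> //=; have c0 : 0 < cos ph by apply: cos_gt_0; have := hph; lra.
  have := Rmult_lt_0_compat _ _ (Rmult_lt_0_compat _ _ c0 t0) (Rmult_lt_0_compat _ _ c0 t0); lra.
have e : Cmod (it t) = t.
  by apply: sqrt_unique => /=; [lra | ring].
by have := hK _ (conj s1 s2); rewrite e.
Qed.

(** Two-point identities for [it t] and [Ci], whose real parts vanish. By the second,
    [A Ci v - t^2 A (it t) (A Ci v)] lies in the range of [B Ci]; by the third, [A (it t) v] lies in
    the range of [A Ci]; the fourth shows that [A Ci] maps [t^2 A (it t) v] close to [A Ci v] for
    large [t]. *)
Lemma it_ident t v : 0 < t ->
  B Ci (A (it t) v) = A Ci (B (it t) v) /\
  A Ci v = plus (B Ci (B (it t) v)) (scal (t * t) (A (it t) (A Ci v))) /\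
  A (it t) v = A Ci (plus v (scal (1 - t * t) (A (it t) v))) /\
  A Ci (scal (t * t) (A (it t) v)) = plus (A Ci v) (minus (A Ci (A (it t) v)) (A (it t) v)).
Proof.
move=> t0; have r := res_it t0.
have e1 := res_BA linT ri r v.
have e2 := res_Ar linT r ri v; rewrite (res_BB linT r ri) /= in e2.
have e3 := res_Adiff linT r ri v; rewrite (res_AA linT r ri) /= in e3.
have e4 : minus (A (it t) v) (A Ci v) = scal (1 - t * t) (A Ci (A (it t) v)).
  by rewrite e3; vec.
split=> //; split; first by rewrite {1}e2; vec.
split.
  by rewrite blD blZ -e4; vec.
rewrite blZ.
have e5 : A (it t) v = plus (A Ci v) (scal (1 - t * t) (A Ci (A (it t) v))).
  by rewrite -e4; vec.
by move: (A (it t) v) (A Ci (A (it t) v)) (A Ci v) e5 => p q w ->; vec.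
Qed.

(** The vectors [x k] are bounded and [B Ci] maps them to vectors of size [O(t)], so their weak
    limit is 0 by injectivity of [B Ci]. But [x k] differs from [A Ci v] by an element of the range
    of [B Ci], where [phi] vanishes, so [phi (x k)] is constantly [phi (A Ci v)]. *)
Lemma annihilator_A phi : (forall v, phi (B Ci v) = 0) -> forall v, phi (A Ci v) = 0.
Proof.
move=> h v; have [K [K0 hK]] := it_bound.
pose t k := / INR k.+1; have t0 k : 0 < t k.
  by apply: Rinv_0_lt_compat; apply: lt_0_INR; apply: Nat.lt_0_succ.
pose x k := scal (t k * t k) (A (it (t k)) (A Ci v)).
have [|w hw] := @reflexive_weak_limit V x (K * norm (A Ci v)) refl.
  move=> k; apply: Rle_trans (norm_scal _ _) _; rewrite {1}/abs /= Rabs_pos_eq; last by have := t0 k; nra.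
  apply: (Rle_trans _ (t k * t k * (norm (A (it (t k))) * norm (A Ci v)))).
    by apply: Rmult_le_compat_l (bl_norm_apply _ _); have := t0 k; nra.
  rewrite -Rmult_assoc; apply: Rmult_le_compat_r; first exact: norm_ge_0.
  by rewrite Rmult_comm; apply: (proj1 (hK _ (t0 k))).
have w0 : w = zero.
  apply: B_injective; apply: dual_eq => psi; rewrite bl0.
  apply: (hw (bl_comp psi (B Ci)) 0 (norm psi * (norm (A Ci) * (K * norm (A Ci v))))) => k.
  have [e _] := it_ident (A Ci v) (t0 k).
  rewrite /= /x blZ e Rminus_0_r; apply: Rle_trans (bl_norm_apply psi _) _.
  rewrite /Rdiv Rmult_assoc; apply: Rmult_le_compat_l; first exact: norm_ge_0.
  apply: Rle_trans (norm_scal _ _) _; rewrite {1}/abs /= Rabs_pos_eq; last by have := t0 k; nra.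
  apply: (Rle_trans _ (t k * t k * (norm (A Ci) * (norm (B (it (t k))) * norm (A Ci v))))).
    apply: Rmult_le_compat_l; first by have := t0 k; nra.
    apply: Rle_trans (bl_norm_apply _ _) _; apply: Rmult_le_compat_l (bl_norm_apply _ _).
    exact: norm_ge_0.
  rewrite (_ : t k * t k * _ = norm (A Ci) * (norm (B (it (t k))) * t k * norm (A Ci v)) * t k); last ring.
  apply: Rmult_le_compat_r; first exact: Rlt_le.
  apply: Rmult_le_compat_l; first exact: norm_ge_0.
  apply: Rmult_le_compat_r; first exact: norm_ge_0.
  by apply: (proj2 (hK _ (t0 k))).
rewrite -(hw phi (phi (A Ci v)) 0) ?w0 ?bl0 // => k.
have [_ [e _]] := it_ident v (t0 k).
have -> : x k = minus (A Ci v) (B Ci (B (it (t k)) v)).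
  rewrite /x; move: e; move: (A Ci v) (B Ci (B (it (t k)) v)) (scal (t k * t k) (A (it (t k)) (A Ci v))) => p q s ->.
  by vec.
rewrite blB h /minus /plus /opp /= (_ : _ - _ = 0); last ring.
by rewrite Rabs_R0 /Rdiv Rmult_0_l; apply: Rle_refl.
Qed.

(** For [t = k + 1] the images [A Ci (x k)] tend to [A Ci v], so injectivity of [A Ci] makes [v] the
    weak limit of [x k]. Each [x k] lies in the range of [A Ci], where [phi] vanishes by
    [annihilator_A]. *)
Lemma annihilator phi : (forall v, phi (B Ci v) = 0) -> forall v, phi v = 0.
Proof.
move=> /annihilator_A h v; have [K [K0 hK]] := it_bound.
pose t k := INR k.+1.
have t1 k : 1 <= t k by apply: (le_INR 1); apply: le_n_S; apply: Nat.le_0_l.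
have t0 k : 0 < t k by have := t1 k; lra.
pose x k := scal (t k * t k) (A (it (t k)) v).
have hA k : norm (A (it (t k)) v) <= K * norm v / (t k * t k).
  apply: Rle_trans (bl_norm_apply _ _) _.
  rewrite (_ : K * norm v / (t k * t k) = K / (t k * t k) * norm v); last by rewrite /Rdiv; ring.
  apply: Rmult_le_compat_r; first exact: norm_ge_0.
  by apply/Rle_div_r; [have := t0 k; nra | apply: (proj1 (hK _ (t0 k)))].
have nv := norm_ge_0 v; have Kv := Rmult_le_pos _ _ K0 nv.
have [|w hw] := @reflexive_weak_limit V x (K * norm v) refl.
  move=> k; apply: Rle_trans (norm_scal _ _) _; rewrite {1}/abs /= Rabs_pos_eq; last by have := t0 k; nra.
  rewrite Rmult_comm; apply/Rle_div_r; [have := t0 k; nra | exact: hA].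
have wv : w = v.
  suff e : A Ci (minus w v) = zero by apply: plus_reg_r (opp v) _ _ _; rewrite plus_opp_r -(A_injective e).
  rewrite blB; suff -> : A Ci w = A Ci v by rewrite minus_eq_zero.
  apply: dual_eq => psi.
  apply: (hw (bl_comp psi (A Ci)) (psi (A Ci v)) (norm psi * ((norm (A Ci) + 1) * (K * norm v)))) => k.
  have [_ [_ [_ e]]] := it_ident v (t0 k).
  have -> : bl_comp psi (A Ci) (x k) - psi (A Ci v) = psi (minus (A Ci (A (it (t k)) v)) (A (it (t k)) v)).
    by rewrite /= /x e !blD; rewrite /plus /=; ring.
  apply: Rle_trans (bl_norm_apply psi _) _; rewrite /Rdiv Rmult_assoc.
  apply: Rmult_le_compat_l; first exact: norm_ge_0.
  apply: Rle_trans (norm_triangle _ _) _; rewrite norm_opp.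
  apply: (Rle_trans _ ((norm (A Ci) + 1) * norm (A (it (t k)) v))).
    by rewrite Rmult_plus_distr_r Rmult_1_l; apply: Rplus_le_compat_r; apply: bl_norm_apply.
  have nA := norm_ge_0 (A Ci); rewrite Rmult_assoc; apply: Rmult_le_compat_l; first lra.
  apply: Rle_trans (hA k) _; apply: Rmult_le_compat_l => //.
  by apply: Rinv_le_contravar; [apply: t0 | have := t1 k; rewrite -/(t k); nra].
rewrite -wv; apply: (hw phi 0 0) => k.
have [_ [_ [e _]]] := it_ident v (t0 k).
rewrite /x blZ e h scal_zero_r /zero /= Rminus_0_r Rabs_R0 /Rdiv Rmult_0_l; exact: Rle_refl.
Qed.

Lemma dense_range v (eps : R) : 0 < eps -> exists u, norm (minus v (B Ci u)) < eps.
Proof.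
move=> e0; apply: Classical_Prop.NNPP => no.
have [||||phi [h1 h2]] := @functional_separation V (fun y => exists u, y = B Ci u) v eps _ _ _ e0.
- by exists zero; rewrite bl0.
- by move=> _ _ [a ->] [b ->]; exists (plus a b); rewrite blD.
- by move=> s _ [a ->]; exists (scal s a); rewrite blZ.
- by move=> _ [u ->]; apply: Rnot_lt_le => lt; apply: no; exists u.
have := annihilator (fun u => h1 _ (ex_intro _ u erefl)) v; lra.
Qed.
End DenseRange.

(** * Closed graphs and powers of an operator with dense range *)

Section Closure.
Context (n : nat) (VR : CompleteNormedModule R_AbsRing).
Notation V := (cm_NormedModule n VR).
Notation Bd := (bounded_map n VR).

Lemma closed_op_fun (X : Bd) : right_linear X -> closed_op (op_fun X).
Proof.
move=> [_ rX]; split; first split.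
- by move=> v w w' -> ->.
- by rewrite /op_fun bl0.
- by move=> v v' w w' -> ->; rewrite /op_fun blD.
- by move=> v w a ->; rewrite /op_fun rX.
- move=> [v w] /= h; apply: Classical_Prop.NNPP => ne; apply: h.
  have d0 : minus w (X v) <> zero.
    move=> e; apply: ne; rewrite /op_fun.
    by apply: plus_reg_r (opp (X v)) _ _ _; rewrite plus_opp_r.
  have n0 : 0 < norm (minus w (X v)).
    by case: (Rle_lt_or_eq_dec _ _ (norm_ge_0 (minus w (X v)))) => // /esym /norm_eq_zero.
  have c : continuous (fun p : V * V => minus p.2 (X p.1)) (v, w).
    apply: continuous_minus; first exact: continuous_snd.
    apply: (continuous_comp (fun p : V * V => p.1) X); first exact: continuous_fst.
    exact: (linear_cont _ _ (blin_linear X)).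
  apply: filter_imp (continuous_norm_lt c n0) => -[v' w'] /= lt e.
  rewrite e minus_eq_zero /minus plus_zero_l norm_opp -/(minus w (X v)) in lt; lra.
Qed.

(** Every point [(v, X v)] is a limit of points [(D u, X (D u))], which lie on the closed graph of
    [S]. *)
Lemma closed_op_dense (S : operator n VR) (X D : Bd) : closed_op S ->
  (forall v eps, 0 < eps -> exists u, norm (minus v (D u)) < eps) ->
  (forall u, S (D u) (X (D u))) -> op_incl (op_fun X) S.
Proof.
move=> [_ cS] dD hS v w ->; apply: (cS (v, X v)) => h.
have c : continuous (fun y : V => (y, X y)) v.
  apply: (continuous_comp_2 (fun y => y) X (fun a b => (a, b))).
  - exact: continuous_id.
  - exact: (linear_cont _ _ (blin_linear X)).
  - by move=> P [e he]; exists e => -[a b]; apply: (he (a, b)).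
have [e he] := locally_norm_le_locally _ _ (c _ h).
have [u hu] := dD v e (cond_pos e).
by apply: (he (D u)) (hS u); rewrite /ball_norm -norm_opp opp_minus.
Qed.

(** [bl_twist Y E k] is [Y E^k], so [bl_twist E E k] already has the exponent [k + 1]. *)
Lemma bl_twist_comp (X E : Bd) k v : bl_twist X E k.+1 v = X (bl_twist E E k v).
Proof. by elim: k v => [|k IH] v //; rewrite [LHS]IH. Qed.

Lemma bl_twist_injective (E : Bd) k v : (forall u, E u = zero -> u = zero) ->
  bl_twist E E k v = zero -> v = zero.
Proof. by move=> h; elim: k v => [|k IH] v; [apply: h | move=> /IH /h]. Qed.

Lemma bl_twist_dense (E : Bd) k v eps :
  (forall v eps, 0 < eps -> exists u, norm (minus v (E u)) < eps) -> 0 < eps ->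
  exists u, norm (minus v (bl_twist E E k u)) < eps.
Proof.
move=> h; elim: k v eps => [|k IH] v eps e0; first exact: h.
have [u' h1] := IH v (eps / 2) ltac:(lra); set X := bl_twist E E k in h1 *.
have nX := norm_ge_0 X; have d0 : 0 < eps / 2 / (norm X + 1) by apply: Rdiv_lt_0_compat; lra.
have [u h2] := h u' _ d0; exists u.
have -> : minus v (bl_twist E E k.+1 u) = plus (minus v (X u')) (X (minus u' (E u))).
  by rewrite blB /=; rewrite -/X; vec.
apply: Rle_lt_trans (norm_triangle _ _) _.
have h3 : norm (X (minus u' (E u))) <= eps / 2.
  apply: Rle_trans (bl_norm_apply X _) _.
  apply: (Rle_trans _ ((norm X + 1) * (eps / 2 / (norm X + 1)))); last by apply: Req_le; field; lra.
  by apply: Rmult_le_compat; [| apply: norm_ge_0 | lra | lra].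
lra.
Qed.
End Closure.

Theorem theorem4p6 (n : nat) (hn : (1 <= n)%nat)
    (VR : CompleteNormedModule R_AbsRing)
    (T : operator n VR) (omega theta : R)
    (f : clifford n -> clifford n) (m : nat) :
  reflexive_space (cm_NormedModule n VR) ->
  closed_op T -> injective_op T ->
  0 < omega < PI / 2 -> bisectorial omega T ->
  omega < theta < PI / 2 ->
  SH_R0 theta f ->
  (1 <= m)%nat ->
  exists fT eT feT : bounded_map n VR,
    is_omega_calculus omega theta T f fT /\
    is_omega_calculus omega theta T (regularizer m) eT /\
    is_omega_calculus omega theta T (fun s => cl_mul (f s) (regularizer m s)) feT /\
    injective_op (op_fun eT) /\
    closable_op (op_comp (op_fun feT) (op_inv (op_fun eT))) /\
    is_closure_op (op_comp (op_fun feT) (op_inv (op_fun eT))) (op_fun fT).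
Proof.
move=> refl [linT _] injT hom bisT hth hf; case: m => // k _.
have hth' : 0 < theta < PI / 2 by lra.
have [F hF] := SH_R0_slice_data hn hth' hf.
have [A [B fam]] := resolvent_family_exists linT hn hom bisT.
have [fT wf] := weak_calc_exists linT hom hn fam hth hF.
set E := B Ci.
have inj u := B_injective linT injT hom fam (v := u).
have dense := dense_range linT injT hom fam refl.
have slice1 := slice_data_regularizer1 n hth'.
(* With [m = k.+1] the witnesses are [f(T)], [E^m] and [f(T) E^m]. *)
exists fT, (bl_twist E E k), (bl_twist fT E k.+1).
have closedf : closed_op (op_fun fT) by apply: closed_op_fun; case: wf.
have incl : op_incl (op_comp (op_fun (bl_twist fT E k.+1)) (op_inv (op_fun (bl_twist E E k)))) (op_fun fT).
  by move=> v w [u [-> ->]]; rewrite /op_fun bl_twist_comp.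
have we := weak_calc_twist linT hom fam hth k slice1 (weak_calc_stem1 linT hom fam hth).
have wfe := weak_calc_twist linT hom fam hth k.+1 hF wf.
split; [|split; [|split; [|split; [|split]]]].
- exact: (weak_calc_omega linT hom fam hth hF wf).
- exact: (weak_calc_omega linT hom fam hth (slice_data_regularizer n k hth') we).
- exact: (weak_calc_omega linT hom fam hth (slice_data_twist k.+1 hth' hF) wfe).
- move=> v v' w e1' e2'; have e : bl_twist E E k (minus v v') = zero.
    by rewrite blB -e1' -e2' minus_eq_zero.
  by apply: plus_reg_r (opp v') _ _ _; rewrite plus_opp_r; apply: (bl_twist_injective inj e).
- by exists (op_fun fT).
(* Minimality: a closed extension [S] contains the graph of [fT] over the dense range of [E^m],
   hence all of it. *)
- split=> //; split=> // S cS hS; apply: (closed_op_dense (D := bl_twist E E k) cS).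
    by move=> v eps e0; apply: bl_twist_dense.
  by move=> u; apply: hS; exists u; split=> //; rewrite /op_fun bl_twist_comp.
Qed.
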